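(* Let $W$ be a double well potential as in the context. Any axially symmetric, stable solution $u$ of $\Delta u=W'(u)$ in $\mathbb{R}^3$ depends only on $z$.
   Context: Double well potential: $W\in C^3([-1,1])$ satisfies: $W>0$ in $(-1,1)$ and $W(\pm1)=0$; $W'(\pm1)=0$ and $W''(-1)=W''(1)=2$; $W$ is even and $0$ is the unique critical point of $W$ in $(-1,1)$. Solutions $u$ of $\Delta u=W'(u)$ take values in $[-1,1]$, the domain of $W$. Points of $\mathbb{R}^{3}$ are written $(x_1,x_2,z)$ and $r:=\sqrt{x_1^2+x_2^2}$. A function $u$ is axially symmetric if $u(x_1,x_2,z)=u(r,z)$. A solution $u$ is stable (in $\mathbb{R}^3$) if $\int_{\mathbb{R}^3}[|\nabla\varphi|^2+W''(u)\varphi^2]\ge0$ for every $\varphi\in C_0^\infty(\mathbb{R}^3)$. *)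

(* Defs.v *)
From HB Require Import structures.
From mathcomp Require Import all_boot all_order all_algebra.
From mathcomp Require Import all_classical all_reals all_analysis.

Set Implicit Arguments.
Unset Strict Implicit.
Unset Printing Implicit Defensive.

Import Order.TTheory GRing.Theory Num.Theory.
Import numFieldNormedType.Exports.

Local Open Scope classical_set_scope.
Local Open Scope ring_scope.

(* Calculus relative to a subset [I] of the line: difference quotients only
   use points of [I], so derivatives at the endpoints of a compact interval
   are one-sided and the values of [f] outside [I] play no role. *)
Section CalculusOn.
Context {R : realType}.
Implicit Types (I : set R) (f : R -> R).

Definition quotient_on f (x : R) : R -> R := fun y => (f y - f x) / (y - x).

Definition derivable_on I f (x : R) : Prop :=
  cvg (quotient_on f x @ within I x^').

Definition derive_on I f (x : R) : R :=
  lim (quotient_on f x @ within I x^').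

Definition derive_onn I (k : nat) f : R -> R := iter k (derive_on I) f.

Fixpoint Ck_on I (k : nat) f : Prop :=
  if k is k'.+1 then
    (forall x, I x -> derivable_on I f x) /\ Ck_on I k' (derive_on I f)
  else {within I, continuous f}.

End CalculusOn.

Section DoubleWell.
Context {R : realType}.

Definition Icc : set R := `[-1, 1]%classic.

Record double_well (W : R -> R) : Prop := DoubleWell {
  double_well_C3 : Ck_on Icc 3 W ;
  double_well_gt0 : forall x : R, -1 < x < 1 -> 0 < W x ;
  double_well_val : W (-1) = 0 /\ W 1 = 0 ;
  double_well_d1 : derive_onn Icc 1 W (-1) = 0 /\ derive_onn Icc 1 W 1 = 0 ;
  double_well_d2 : derive_onn Icc 2 W (-1) = 2 /\ derive_onn Icc 2 W 1 = 2 ;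
  double_well_even : forall x : R, -1 <= x <= 1 -> W (- x) = W x ;
  double_well_crit : forall x : R, -1 < x < 1 ->
    (derive_onn Icc 1 W x = 0 <-> x = 0)
}.

End DoubleWell.

(* The point (x1, x2, z) of the space is encoded as ((x1, x2), z). *)
Notation R3 R := (R * R * R)%type.

Section Space.
Context {R : realType}.
Implicit Types (f u phi : R3 R -> R) (p : R3 R).

Definition basis3 (i : 'I_3) : R3 R :=
  ((i == 0%N :> nat)%:R, (i == 1%N :> nat)%:R, (i == 2%N :> nat)%:R).

Definition partial (i : 'I_3) f : R3 R -> R :=
  fun p => 'D_(basis3 i) f p.

Fixpoint Ck (k : nat) f : Prop :=
  continuous f /\
  (if k is k'.+1 then
     forall i : 'I_3,
       (forall p, derivable f p (basis3 i)) /\ Ck k' (partial i f)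
   else True).

Definition smooth f : Prop := forall k, Ck k f.

Definition grad_sq f p : R := \sum_(i < 3) partial i f p ^+ 2.

Definition laplacian f p : R := \sum_(i < 3) partial i (partial i f) p.

Definition compact_support f : Prop :=
  compact (closure [set p | f p != 0]).

Definition volume : set (R3 R) -> \bar R :=
  ((lebesgue_measure \x lebesgue_measure) \x lebesgue_measure)%E.

Definition axially_symmetric u : Prop :=
  exists v : R -> R -> R,
    forall x1 x2 z, u (x1, x2, z) = v (Num.sqrt (x1 ^+ 2 + x2 ^+ 2)) z.

(* Classical solutions; the range condition keeps [u p] in the domain of [W]. *)
Definition solution (W : R -> R) u : Prop :=
  [/\ Ck 2 u,
      forall p, -1 <= u p <= 1
    & forall p, laplacian u p = derive_onn Icc 1 W (u p)].

Definition stable (W : R -> R) u : Prop :=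
  forall phi, smooth phi -> compact_support phi ->
    (0 <= \int[volume]_p
            (grad_sq phi p + derive_onn Icc 2 W (u p) * phi p ^+ 2)%:E)%E.

End Space.

(* Main.v *)
(** Write [r^2 = x1^2 + x2^2] and [v = x1 u_1 + x2 u_2 = r u_r]. Each [u_j] solves the
linearised equation weakly, and axial symmetry gives [x1 u_2 = x2 u_1]. Inserting
[phi = v xi] in the stability inequality and subtracting the weak equations of [u_1]
and [u_2], tested with [v x_1 xi^2] and [v x_2 xi^2], therefore leaves
[0 <= int (u_1^2 + u_2^2) (2 xi x . grad' xi + r^2 |grad xi|^2)], where [grad'] is the
gradient in [(x1, x2)]; the potential has disappeared.

Take [xi = omega chi] with [omega = (1 + r^2)^-1] and [chi] a cutoff at scale [a] in
[x1, x2] and [b] in [z]. The main term becomes [- 4 r^2 omega^4 chi^2], and the terms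
with derivatives of [chi] are bounded by a multiple of [a^-4 + b^-2 / (1 + x1^2)] on
the support of [chi]. Since [|u| <= 1] and [W'] is bounded, a Caccioppoli estimate
bounds the integral of [|grad u|^2] against this weight by a multiple of
[b / a^2 + a / b]. With [a = t^2] and [b = t^3] this tends to [0], so [r u_r = 0]. *)

(* The potential cancels because [x1 u_1 + x2 u_2 = v]: the two tested equations together carry
   [c v^2 xi^2], with [c = W''(u)], which is the potential term of the stability form at [v xi]. For
   a power [xi = r^-s] the remaining form is [(s^2 - 2 s) r^(-2 s)], negative only for [0 < s < 2].
   The weight [omega] regularises the borderline [s = 2], the fastest decay allowed, and the
   regularisation itself supplies the strict sign. The fast decay makes the cutoff errors small, but
   the bounds [b / a^2] and [a / b] tend to zero only if [a << b << a^2], so cubes are excluded;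
   [b = a^(3/2)] balances the two. Regularity is the obstacle that shapes the development. As [u] is
   only C^2, [v] is only C^1, whereas stability is tested with smooth functions and the linearised
   equation for [u_j] has no pointwise meaning. Both are therefore extended to test functions
   [g zeta] with [g] of class C^1 and [zeta] smooth, through an explicit approximation of [g] by
   finite sums of smooth bumps over a grid. *)
Require Import Defs.
From HB Require Import structures.
From mathcomp Require Import all_boot all_order all_algebra.
From mathcomp Require Import all_classical all_reals all_analysis.
From mathcomp Require Import ring lra.

Set Implicit Arguments.
Unset Strict Implicit.
Unset Printing Implicit Defensive.

Import Order.TTheory GRing.Theory Num.Theory.
Import numFieldNormedType.Exports.

Local Open Scope classical_set_scope.
Local Open Scope ring_scope.

(** * Directional derivatives and C^k functions *)

Section Directional.
Context {R : realType} {V : normedModType R}.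
Implicit Types (f g : V -> R) (p v : V).

Lemma is_deriveDf f g p v a b : is_derive p v f a -> is_derive p v g b ->
  is_derive p v (fun q => f q + g q) (a + b).
Proof. by move=> hf hg; exact: is_deriveD. Qed.

Lemma is_deriveBf f g p v a b : is_derive p v f a -> is_derive p v g b ->
  is_derive p v (fun q => f q - g q) (a - b).
Proof. by move=> hf hg; exact: is_deriveB. Qed.

Lemma is_deriveMf f g p v a b : is_derive p v f a -> is_derive p v g b ->
  is_derive p v (fun q => f q * g q) (a * g p + f p * b).
Proof.
move=> hf hg; apply: (is_derive_eq (is_deriveM hf hg)).
by rewrite /GRing.scale /= addrC [g p * a]mulrC.
Qed.

Lemma is_deriveVf f p v a : f p != 0 -> is_derive p v f a ->
  is_derive p v (fun q => (f q)^-1) (- (a / f p ^+ 2)).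
Proof.
move=> f0 hf; apply: DeriveDef.
  by apply: derivableV => //; exact: ex_derive.
rewrite deriveV // derive_val /GRing.scale /= mulNr mulrC.
by congr (- (_ * _)).
Qed.

(** Both sides are limits of the same difference quotient. This is the passage by which the chain
    rule and the mean value theorem of one variable apply to directional derivatives. *)
Lemma is_derive_line f p v (t : R) a :
  is_derive (p + t *: v) v f a <-> is_derive t 1 (fun s : R => f (p + s *: v)) a.
Proof.
have E : (fun h => h^-1 *: (((fun s : R => f (p + s *: v)) \o shift t) (h *: (1 : R)) - f (p + t *: v))) =
  (fun h => h^-1 *: ((f \o shift (p + t *: v)) (h *: v) - f (p + t *: v))).
  apply/funext => h /=; congr (_ *: (f _ - _)).
  change (p + (h * 1 + t) *: v = h *: v + (p + t *: v)).
  by rewrite mulr1 scalerDl addrCA.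
split=> -[h1 h2]; split; rewrite /derivable /derive in h1 h2 *.
- by rewrite E.
- by rewrite E.
- by rewrite -E.
- by rewrite -E.
Qed.

Lemma is_derive_shiftf f p v w a : is_derive (p + w) v f a ->
  is_derive p v (fun q => f (q + w)) a.
Proof.
move=> hf; rewrite -[p]addr0 -(scale0r v); apply/is_derive_line.
rewrite (_ : (fun s => _) = (fun s => f ((p + w) + s *: v))).
  by apply/is_derive_line; rewrite scale0r addr0.
by apply/funext => s; rewrite addrAC.
Qed.

(** Only the derivative of [f] along [v] is assumed, so the chain rule is applied on the line
    through [p]. *)
Lemma is_derive_compf (g : R -> R) f p v a b : is_derive p v f a ->
  is_derive (f p) 1 g b -> is_derive p v (fun q => g (f q)) (b * a).
Proof.
move=> hf hg; rewrite -[p]addr0 -(scale0r v) in hf hg *.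
move/is_derive_line: hf => hf; apply/is_derive_line.
apply: (is_derive_eq (@is_derive1_comp _ g (fun s => f (p + s *: v)) 0 b a hg hf)).
by [].
Qed.

End Directional.

Section Continuity.
Context {R : realType}.

Lemma continuousDf (T : topologicalType) (f g : T -> R) :
  continuous f -> continuous g -> continuous (fun p => f p + g p).
Proof. by move=> hf hg p; apply: cvgD; [exact: hf|exact: hg]. Qed.

Lemma continuousBf (T : topologicalType) (f g : T -> R) :
  continuous f -> continuous g -> continuous (fun p => f p - g p).
Proof. by move=> hf hg p; apply: cvgB; [exact: hf|exact: hg]. Qed.

Lemma continuousMf (T : topologicalType) (f g : T -> R) :
  continuous f -> continuous g -> continuous (fun p => f p * g p).
Proof. by move=> hf hg p; apply: cvgM; [exact: hf|exact: hg]. Qed.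

Lemma continuousNf (T : topologicalType) (f : T -> R) :
  continuous f -> continuous (fun p => - f p).
Proof. by move=> hf p; apply: cvgN; exact: hf. Qed.

Lemma continuousXf (T : topologicalType) (f : T -> R) n :
  continuous f -> continuous (fun p => f p ^+ n).
Proof.
move=> hf; elim: n => [|n IH]; first by move=> p; apply: cvg_cst.
rewrite (_ : (fun p => _) = (fun p => f p * f p ^+ n)).
  exact: continuousMf.
by apply/funext => p; rewrite exprS.
Qed.

Lemma continuousVf (T : topologicalType) (f : T -> R) :
  (forall p, f p != 0) -> continuous f -> continuous (fun p => (f p)^-1).
Proof. by move=> f0 hf p; apply: cvgV => //; exact: hf. Qed.

Lemma continuous_compf (T : topologicalType) (f : T -> R) (g : R -> R) :
  continuous f -> continuous g -> continuous (fun p => g (f p)).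
Proof. by move=> hf hg p; apply: continuous_comp; [exact: hf|exact: hg]. Qed.

Lemma continuous_absf (T : topologicalType) (f : T -> R) :
  continuous f -> continuous (fun p => `|f p|).
Proof. by move=> hf p; apply: cvg_norm; exact: hf. Qed.

Lemma derivable1_continuous (g : R -> R) : (forall x, derivable g x 1) -> continuous g.
Proof. by move=> hg x; apply: differentiable_continuous; apply/derivable1_diffP; exact: hg. Qed.

Lemma MVTr (g dg : R -> R) (a b : R) : (forall x : R, is_derive x 1 g (dg x)) ->
  exists2 c, (`|c - a| <= `|b - a|) & g b - g a = dg c * (b - a).
Proof.
move=> hg.
have cg : continuous g by apply: derivable1_continuous => x; have [] := hg x.
have [ab|ba] := leP a b.
  have [c] := @MVT_segment _ g dg a b ab (fun x _ => hg x) (continuous_subspaceT cg).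
  rewrite in_itv /= => /andP[ac cb] E; exists c => //.
  by rewrite !ger0_norm ?subr_ge0 // lerD2r.
have [c] := @MVT_segment _ g dg b a (ltW ba) (fun x _ => hg x) (continuous_subspaceT cg).
rewrite in_itv /= => /andP[ac cb] E; exists c; last by rewrite -opprB E -mulrN opprB.
by rewrite !ler0_norm ?subr_le0 // ?lerN2 ?lerD2r // ltW.
Qed.

End Continuity.

Section Calculus.
Context {R : realType}.
Implicit Types (f g : R3 R -> R) (p q : R3 R) (i j : 'I_3).

Definition coord3 i p : R :=
  match val i with 0%N => p.1.1 | 1%N => p.1.2 | _ => p.2 end.

Lemma coord3_line j p v (t : R) : coord3 j (p + t *: v) = coord3 j p + t * coord3 j v.
Proof. by case: p v => [[a b] c] [[d e] k]; case: j => [[|[|[|]]] h]. Qed.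

Lemma coord3_basis j i : coord3 j (basis3 i) = (j == i)%:R :> R.
Proof. by case: j => [[|[|[|]]] h]; case: i => [[|[|[|]]] h']. Qed.

Lemma is_derive_coord3 i p v : is_derive p v (coord3 i) (coord3 i v).
Proof.
rewrite -[p]addr0 -(scale0r v); apply/is_derive_line.
rewrite (_ : (fun s => _) = (fun s => coord3 i p + s * coord3 i v)); last first.
  by apply/funext => s; rewrite coord3_line.
apply: (is_derive_eq (is_deriveDf (is_derive_cst _ _ _) (is_deriveMf (is_derive_id _ _) (is_derive_cst _ _ _)))).
by rewrite /= mulr0 addr0 mul1r add0r.
Qed.

Lemma coord3_continuous i : continuous (coord3 i).
Proof.
move=> p; case: i => [[|[|[|]]] h] //=; rewrite /coord3 /=.
- apply: (@cvg_comp _ _ _ fst fst _ (nbhs p.1)); exact: cvg_fst.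
- apply: (@cvg_comp _ _ _ fst snd _ (nbhs p.1)); [exact: cvg_fst|exact: cvg_snd].
- exact: cvg_snd.
Qed.

Lemma Ck_continuous k f : Ck k f -> continuous f.
Proof. by case: k => [|k] []. Qed.

Lemma Ck_is_derive k f i p : Ck k.+1 f -> is_derive p (basis3 i) f (partial i f p).
Proof. by move=> [_ /(_ i)[h _]]; apply: DeriveDef. Qed.

Lemma Ck_partial k f i : Ck k.+1 f -> Ck k (partial i f).
Proof. by move=> [_ /(_ i)[]]. Qed.

Lemma Ck_mono k f : Ck k.+1 f -> Ck k f.
Proof.
elim: k f => [|k IH] f [cf hf]; first by split.
by split=> // i; have [h1 h2] := hf i; split => //; exact: IH.
Qed.

Lemma Ck_le k m f : (k <= m)%N -> Ck m f -> Ck k f.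
Proof.
elim: m => [|m IH]; first by rewrite leqn0 => /eqP ->.
by rewrite leq_eqVlt => /orP[/eqP->//|] h /Ck_mono; exact: IH.
Qed.

Lemma is_derive_partial f i p a : is_derive p (basis3 i) f a -> partial i f p = a.
Proof. by move=> h; rewrite /partial derive_val. Qed.

Lemma CkS_intro k f (df : 'I_3 -> R3 R -> R) : continuous f ->
  (forall i p, is_derive p (basis3 i) f (df i p)) -> (forall i, Ck k (df i)) -> Ck k.+1 f.
Proof.
move=> cf hd hk; split => // i; split; first by move=> p; have [] := hd i p.
rewrite (_ : partial i f = df i) //.
by apply/funext => p; apply: is_derive_partial.
Qed.

Lemma Ck_cst k (c : R) : Ck k (fun=> c).
Proof.
elim: k c => [|k IH] c; first by split => // p; exact: cvg_cst.
apply: (@CkS_intro _ _ (fun _ _ => 0)) => //.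
  by move=> p; exact: cvg_cst.
Qed.

Lemma CkD k f g : Ck k f -> Ck k g -> Ck k (fun p => f p + g p).
Proof.
elim: k f g => [|k IH] f g hf hg.
  by split => //; apply: continuousDf; exact: (@Ck_continuous 0).
apply: (@CkS_intro _ _ (fun i p => partial i f p + partial i g p)).
- by apply: continuousDf; exact: (@Ck_continuous k.+1).
- by move=> i p; apply: is_deriveDf; [exact: (Ck_is_derive _ _ hf)|exact: (Ck_is_derive _ _ hg)].
- by move=> i; apply: IH; exact: Ck_partial.
Qed.

Lemma CkM k f g : Ck k f -> Ck k g -> Ck k (fun p => f p * g p).
Proof.
elim: k f g => [|k IH] f g hf hg.
  by split => //; apply: continuousMf; exact: (@Ck_continuous 0).
apply: (@CkS_intro _ _ (fun i p => partial i f p * g p + f p * partial i g p)).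
- by apply: continuousMf; exact: (@Ck_continuous k.+1).
- by move=> i p; apply: is_deriveMf; [exact: (Ck_is_derive _ _ hf)|exact: (Ck_is_derive _ _ hg)].
- by move=> i; apply: CkD; apply: IH; by [exact: Ck_partial|exact: Ck_mono].
Qed.

Lemma CkZ k (c : R) f : Ck k f -> Ck k (fun p => c * f p).
Proof. by apply: CkM; exact: Ck_cst. Qed.

Lemma CkN k f : Ck k f -> Ck k (fun p => - f p).
Proof.
move=> /(CkZ (-1)); rewrite (_ : (fun p => _) = (fun p => - f p)) //.
by apply/funext => p; rewrite mulN1r.
Qed.

Lemma CkX k f n : Ck k f -> Ck k (fun p => f p ^+ n).
Proof.
move=> hf; elim: n => [|n IH]; first exact: (Ck_cst k 1).
rewrite (_ : (fun p => _) = (fun p => f p * f p ^+ n)); first exact: CkM.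
by apply/funext => p; rewrite exprS.
Qed.

Lemma CkV k f : (forall p, f p != 0) -> Ck k f -> Ck k (fun p => (f p)^-1).
Proof.
move=> f0; elim: k => [|k IH] hf.
  by split => //; apply: continuousVf => //; exact: (@Ck_continuous 0).
apply: (@CkS_intro _ _ (fun i p => - (partial i f p * (f p)^-1 ^+ 2))).
- by apply: continuousVf => //; exact: (@Ck_continuous k.+1).
- by move=> i p; rewrite exprVn; apply: is_deriveVf => //; exact: (Ck_is_derive _ _ hf).
- move=> i; apply: CkN; apply: CkM; first exact: Ck_partial.
  by apply: CkX; apply: IH; exact: Ck_mono.
Qed.

Lemma Ck_sum k (I : Type) (r : seq I) (F : I -> R3 R -> R) :
  (forall x, Ck k (F x)) -> Ck k (fun p => \sum_(x <- r) F x p).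
Proof.
move=> hF; elim: r => [|x r IH].
  rewrite (_ : (fun p => _) = cst 0); first exact: Ck_cst.
  by apply/funext => p; rewrite big_nil.
rewrite (_ : (fun p => _) = (fun p => F x p + \sum_(y <- r) F y p)); last first.
  by apply/funext => p; rewrite big_cons.
exact: CkD.
Qed.

Lemma Ck_coord3 k i : Ck k (coord3 i).
Proof.
case: k => [|k]; first by split => //; exact: coord3_continuous.
apply: (@CkS_intro _ _ (fun j _ => (i == j)%:R)).
- exact: coord3_continuous.
- by move=> j p; rewrite -coord3_basis; exact: is_derive_coord3.
- by move=> j; exact: Ck_cst.
Qed.

Lemma is_derive_comp_coord3 (g : R -> R) i j p b : is_derive (coord3 i p) 1 g b ->
  is_derive p (basis3 j) (fun q => g (coord3 i q)) ((i == j)%:R * b).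
Proof.
move=> hg; rewrite mulrC -coord3_basis; apply: is_derive_compf => //.
exact: is_derive_coord3.
Qed.

Lemma axis0E (x : R) : (x, 0, 0) = (0 : R3 R) + x *: basis3 ord0.
Proof.
rewrite add0r; apply: injective_projections; [apply: injective_projections|] => /=.
- exact: (esym (mulr1 x)).
- exact: (esym (mulr0 x)).
- exact: (esym (mulr0 x)).
Qed.

Lemma continuous_line p (v : R3 R) : continuous (fun s : R => p + s *: v).
Proof. by move=> s; apply: cvgD; [exact: cvg_cst|apply: cvgZr_tmp; exact: cvg_id]. Qed.

Lemma continuous_axis0 : continuous (fun x : R => (x, 0, 0) : R3 R).
Proof.
rewrite (_ : (fun x => _) = (fun x : R => (0 : R3 R) + x *: basis3 ord0)).
  exact: continuous_line.
by apply/funext => x; exact: axis0E.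
Qed.

Lemma is_derive_axis0 (g : R -> R) (x : R) : Ck 1 (fun p => g (coord3 ord0 p)) ->
  is_derive x 1 g (partial ord0 (fun p => g (coord3 ord0 p)) (x, 0, 0)).
Proof.
move=> hg; have := Ck_is_derive ord0 (x, 0, 0) hg.
rewrite {1}axis0E => /(is_derive_line _ _ _ _ _).1.
rewrite (_ : (fun s => _) = g) //.
by apply/funext => s; rewrite coord3_line coord3_basis eqxx mulr1 /coord3 /= add0r.
Qed.

(** The regularity of the one-variable [g] is expressed through [g (coord3 ord0 p)], so the classes
    [Ck] of the space also serve on the line. The derivative of [g], read off on the first axis,
    satisfies the same hypothesis one order lower, which drives the induction. *)
Lemma Ck_comp k (g : R -> R) f : Ck k (fun p => g (coord3 ord0 p)) -> Ck k f ->
  Ck k (fun p => g (f p)).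
Proof.
elim: k g f => [|k IH] g f hg hf.
  split => //; have -> : (fun p => g (f p)) = (fun p => g (coord3 ord0 p)) \o (fun p => (f p, 0, 0)).
    by apply/funext.
  move=> p; apply: (@continuous_comp _ _ _ (fun p => (f p, 0, 0) : R3 R)); last exact: (Ck_continuous hg).
  apply: (@continuous_comp _ _ _ f (fun x => (x, 0, 0) : R3 R)); last exact: continuous_axis0.
  exact: (Ck_continuous hf).
have dg (x : R) : is_derive x 1 g (partial ord0 (fun p => g (coord3 ord0 p)) (x, 0, 0)).
  exact: is_derive_axis0 (Ck_le (ltn0Sn k) hg).
pose dg' (x : R) := partial ord0 (fun p => g (coord3 ord0 p)) (x, 0, 0).
apply: (@CkS_intro _ _ (fun i p => dg' (f p) * partial i f p)).
- apply: continuous_compf; first exact: (Ck_continuous hf).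
  by apply: derivable1_continuous => x; have [] := dg x.
- by move=> i p; exact: (is_derive_compf (Ck_is_derive i p hf) (dg (f p))).
- move=> i; apply: CkM; last exact: Ck_partial.
  apply: IH; last exact: Ck_mono.
  rewrite (_ : (fun p => _) = partial ord0 (fun p => g (coord3 ord0 p))); first exact: Ck_partial.
  apply/funext => p; rewrite /dg'; apply/esym/is_derive_partial.
  rewrite -[X in is_derive _ _ _ X]mul1r; exact: (is_derive_comp_coord3 (i := ord0) ord0 (dg _)).
Qed.

Lemma MVT_line f (df : R3 R -> R) v p (h : R) :
  (forall q, is_derive q v f (df q)) ->
  exists2 t, `|t| <= `|h| & f (p + h *: v) - f p = df (p + t *: v) * h.
Proof.
move=> hf.
have [] := @MVTr _ (fun s => f (p + s *: v)) (fun s => df (p + s *: v)) 0 h.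
  by move=> x; apply: (is_derive_line _ _ _ _ _).1; exact: hf.
move=> c; rewrite !subr0 scale0r addr0 => hc E; by exists c.
Qed.

(** The mixed second difference with step [h] does not depend on the order of its two increments.
    Two applications of the mean value theorem, in either order, turn it into [h^2] times one or the
    other mixed derivative at a point near [p]; continuity of both then gives equality up to any
    [e]. *)
Lemma partialC f i j p : Ck 2 f -> partial i (partial j f) p = partial j (partial i f) p.
Proof.
move=> hf.
suff H a b e : 0 < e -> `|partial a (partial b f) p - partial b (partial a f) p| <= e.
  apply/eqP; rewrite -subr_eq0 -normr_le0; apply/ler_addgt0Pr => e e0.
  by rewrite add0r; exact: H.
move=> e0.
have Cab c d : continuous (partial c (partial d f)).
  exact: (Ck_continuous (Ck_partial c (Ck_partial d hf))).
have near_c c d : \forall q \near p, `|partial c (partial d f) p - partial c (partial d f) q| <= e / 2.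
  by have /cvgrPdist_le /(_ (e/2)) := Cab c d p; apply; rewrite divr_gt0.
have /nbhs_ballP[d /= d0 hd] : \forall q \near p,
   `|partial a (partial b f) p - partial a (partial b f) q| <= e / 2 /\
   `|partial b (partial a f) p - partial b (partial a f) q| <= e / 2.
  by apply: filterI; exact: near_c.
have [h h0 hhd] : exists2 h : R, 0 < h & h + h < d.
  by exists (d / 4); [rewrite divr_gt0|clear -d0; lra].
have alg (x y z w : R) : x - y - (z - w) = x - z - (y - w) by ring.
have key (x y : 'I_3) : exists s t : R, [/\ `|s| <= `|h|, `|t| <= `|h| &
   f (p + h *: basis3 x + h *: basis3 y) - f (p + h *: basis3 x) - (f (p + h *: basis3 y) - f p)
   = partial y (partial x f) (p + s *: basis3 x + t *: basis3 y) * h * h].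
  have hD q : is_derive q (basis3 x) (fun q => f (q + h *: basis3 y) - f q)
      (partial x f (q + h *: basis3 y) - partial x f q).
    apply: is_deriveBf; last exact: (Ck_is_derive _ _ hf).
    exact/is_derive_shiftf/(Ck_is_derive _ _ hf).
  have [s hs E'] := MVT_line p h hD.
  have [t ht E] := @MVT_line (partial x f) (partial y (partial x f)) (basis3 y)
     (p + s *: basis3 x) h (fun q => Ck_is_derive _ _ (Ck_partial x hf)).
  exists s, t; by split => //; rewrite E' E.
have [s [t [hs ht Eab]]] := key b a.
have [s' [t' [hs' ht' Eba]]] := key a b.
have inball x y (s1 t1 : R) : `|s1| <= `|h| -> `|t1| <= `|h| ->
   ball p d (p + s1 *: basis3 x + t1 *: basis3 y).
  move=> h1 h2; rewrite -ball_normE /ball_ /= -addrA opprD addNKr normrN.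
  have nb z : `|basis3 z : R3 R| <= 1.
    rewrite /basis3 !prod_normE /= !ge_max.
    by case: z => [[|[|[|]]] hz] //=; rewrite ?normr1 ?normr0 ?lexx ?ler01.
  apply: (le_lt_trans (ler_normD _ _)); rewrite !normrZ.
  rewrite (gtr0_norm h0) in h1 h2.
  have k1 : `|s1| * `|basis3 x : R3 R| <= h.
    by rewrite -[h]mulr1; apply: ler_pM.
  have k2 : `|t1| * `|basis3 y : R3 R| <= h.
    by rewrite -[h]mulr1; apply: ler_pM.
  exact: (le_lt_trans (lerD k1 k2)).
have [A1 _] := hd _ (inball b a s t hs ht).
have [_ A2] := hd _ (inball a b s' t' hs' ht').
move: Eab A1; set X' := partial a (partial b f) (p + _ + _); clearbody X' => Eab A1.
move: Eba A2; set Y' := partial b (partial a f) (p + _ + _); clearbody Y' => Eba A2.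
have E : X' = Y'.
  have hh : h * h != 0 by rewrite mulf_neq0 // gt_eqF.
  apply: (mulIf hh); rewrite mulrA -Eab mulrA -Eba.
  by rewrite (addrAC p (h *: basis3 b)); exact: alg.
move: A1 A2; set X := partial a (partial b f) p; set Y := partial b (partial a f) p.
clearbody X Y; rewrite E => A1 A2.
have -> : X - Y = (X - Y') - (Y - Y') by rewrite opprB addrA subrK.
by apply: (le_trans (ler_normB _ _)); rewrite (splitr e) lerD.
Qed.

End Calculus.

(** * Integrals of compactly supported functions *)

Lemma integrable_bounded_support d (T : measurableType d) (R : realType)
    (mu : {measure set T -> \bar R}) (f : T -> R) (B : set T) (M : R) :
  measurable_fun [set: T] f -> measurable B -> (mu B < +oo)%E ->
  (forall x, `|f x| <= M) -> (forall x, ~ B x -> f x = 0) ->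
  mu.-integrable [set: T] (EFin \o f).
Proof.
move=> mf mB Bfin fM f0.
have h : mu.-integrable B (EFin \o f).
  apply: measurable_bounded_integrable => //; first exact: measurable_funS mf.
  exists M; split; first exact: num_real.
  by move=> y My x _ /=; exact: (le_trans (fM x) (ltW My)).
have := (integrable_mkcond _ mB).1 h; congr (integrable _ _ _).
apply/funext => x; rewrite patchE; case: ifPn => // /negP xB /=.
by rewrite f0 // => Bx; apply: xB; rewrite inE.
Qed.

Section Integral.
Context {R : realType}.
Local Notation mR := (measurableTypeR R).
Local Notation leb := (@lebesgue_measure R).
Implicit Types (f g : R3 R -> R) (p q : R3 R) (i j : 'I_3) (L M : R).

Definition vol : {measure set (mR * mR * mR) -> \bar R} :=
  ((leb \x leb) \x leb)%E.

(** Compact support in quantitative form. The norm is the maximum norm, so the support lies in a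
    cube, and sharing one [L] makes several functions integrable at once. *)
Definition vanish L f := forall p, L < `|p| -> f p = 0.

Definition brick (a b c a' b' c' : R) : set (R3 R) :=
  (`[a, a'] `*` `[b, b']) `*` `[c, c'].

Lemma measurable_brick a b c a' b' c' : measurable (brick a b c a' b' c' : set (mR * mR * mR)).
Proof. by apply: measurableX; [apply: measurableX|]; exact: measurable_itv. Qed.

Lemma vol_brick a b c a' b' c' : a <= a' -> b <= b' -> c <= c' ->
  vol (brick a b c a' b' c') = ((a' - a) * (b' - b) * (c' - c))%:E.
Proof.
move=> ha hb hc; rewrite /vol /=.
have E (x y : R) : x <= y -> leb `[x, y] = (y - x)%:E.
  move=> xy; rewrite lebesgue_measure_itv /= lte_fin.
  by have [lt_xy|] := ltP x y; rewrite -?EFinB // => yx; rewrite (le_anti (_ : x <= y <= x)) ?xy ?subrr.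
rewrite product_measure1E; [|by apply: measurableX; exact: measurable_itv|exact: measurable_itv].
rewrite [X in (X * _)%E](_ : _ = (leb \x leb)%E (`[a, a'] `*` `[b, b'])) //.
rewrite product_measure1E; [|exact: measurable_itv|exact: measurable_itv].
by rewrite !EFinM -!E.
Qed.

Lemma normR3 p : `|p| = Num.max (Num.max `|p.1.1| `|p.1.2|) `|p.2|.
Proof. by rewrite prod_normE /= prod_normE. Qed.

Lemma normR3_le p L : (`|p| <= L) = [&& `|p.1.1| <= L, `|p.1.2| <= L & `|p.2| <= L].
Proof. by rewrite normR3 !ge_max andbA. Qed.

Lemma coord3_le_norm i p : `|coord3 i p| <= `|p|.
Proof.
rewrite /coord3 normR3; case: i => [[|[|[|]]] h] //=; rewrite !le_max lexx ?orbT //.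
Qed.

Lemma brick_norm L : brick (- L) (- L) (- L) L L L = [set p | `|p| <= L].
Proof.
apply/seteqP; split=> p /=; rewrite normR3_le /brick /= !in_itv /= -!ler_norml.
  by move=> [[-> ->] ->].
by move/and3P => [].
Qed.

Lemma compact_norm_le L : compact [set p : R3 R | `|p| <= L].
Proof.
rewrite -brick_norm; apply: compact_setX; last exact: segment_compact.
by apply: compact_setX; exact: segment_compact.
Qed.

Lemma continuous_bounded_norm_le f L : continuous f -> exists M, forall p, `|p| <= L -> `|f p| <= M.
Proof.
move=> cf.
have : compact (f @` [set p | `|p| <= L]).
  by apply: continuous_compact; [exact: continuous_subspaceT|exact: compact_norm_le].
move=> /compact_bounded [M [_ hM]]; exists (M + 1) => p hp.
by apply: (hM (M + 1)); [rewrite ltrDl|exists p].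
Qed.

Lemma vanish_bounded f L : continuous f -> vanish L f -> exists M, forall p, `|f p| <= M.
Proof.
move=> cf f0; have [M hM] := continuous_bounded_norm_le L cf.
exists (Num.max M 0) => p; rewrite le_max.
by have [/hM->//|/f0->] := leP `|p| L; rewrite normr0 lexx orbT.
Qed.

(** The measurable sets are those of the product sigma-algebra. An open set is the countable union
    of the closed cubes with rational centre and rational half-side that it contains. *)
Lemma open_measurableR3 (U : set (R3 R)) : open U -> measurable (U : set (mR * mR * mR)).
Proof.
move=> oU.
pose bx (q : rat * rat * rat * rat) : set (R3 R) :=
  brick (ratr q.1.1.1 - ratr q.2) (ratr q.1.1.2 - ratr q.2) (ratr q.1.2 - ratr q.2)
    (ratr q.1.1.1 + ratr q.2) (ratr q.1.1.2 + ratr q.2) (ratr q.1.2 + ratr q.2).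
pose F (q : rat * rat * rat * rat) := if `[< bx q `<=` U >] then bx q else set0.
rewrite (_ : U = \bigcup_q F q).
  apply: countable_bigcupT_measurable => // q; rewrite /F; case: ifP => _ //.
  exact: measurable_brick.
apply/seteqP; split=> [p Up|p [q _]]; last first.
  by rewrite /F; case: ifPn => // /asboolP h /h.
have /nbhs_ballP[e /= e0 he] : nbhs p U by apply: open_nbhs_nbhs; split.
(* A cube of half-side [r] whose centre is within [r] of [p] stays within [2 r < e] of [p]. *)
have [r /andP[r0 re]] : exists r : rat, 0 < (ratr r : R) < e / 2.
  by have [r] := rat_in_itvoo (divr_gt0 e0 (ltr0n _ 2)); rewrite in_itv /=; exists r.
have near_rat (x : R) : exists a : rat, `|x - ratr a| < ratr r.
  have [a] : exists a : rat, (ratr a : R) \in `]x - ratr r, x + ratr r[.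
    by apply: rat_in_itvoo; rewrite ltrBlDr -addrA ltrDl addr_gt0.
  rewrite in_itv /= => /andP[h1 h2]; exists a.
  by rewrite ltr_norml; clear -h1 h2; apply/andP; split; lra.
have [a1 ha1] := near_rat p.1.1; have [a2 ha2] := near_rat p.1.2.
have [a3 ha3] := near_rat p.2.
exists (a1, a2, a3, r) => //; rewrite /F.
have bxP (q : R3 R) : bx (a1, a2, a3, r) q <-> [/\ `|q.1.1 - ratr a1| <= ratr r,
    `|q.1.2 - ratr a2| <= ratr r & `|q.2 - ratr a3| <= ratr r].
  rewrite /bx /brick /= !in_itv /= -!ler_distl.
  by split=> [[[]]|[]].
rewrite ifT; first by apply/bxP; split; exact: ltW.
apply/asboolP => q /bxP[h1 h2 h3]; apply: he.
have tri (x y a : R) : `|x - a| < ratr r -> `|y - a| <= ratr r -> `|x - y| < e.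
  move=> hx hy; rewrite -(subrKA a).
  apply: (le_lt_trans (ler_normD _ _)); rewrite (splitr e).
  by rewrite [`|a - y|]distrC ltrD // ?(lt_trans hx) // (le_lt_trans hy).
rewrite -ball_normE /ball_ /= normR3 !gt_max.
by rewrite (tri _ _ _ ha1 h1) (tri _ _ _ ha2 h2) (tri _ _ _ ha3 h3).
Qed.

Lemma continuous_measurableR3 f : continuous f ->
  measurable_fun [set: mR * mR * mR] (f : mR * mR * mR -> mR).
Proof.
move=> cf; apply: (measurability _ (measurable_realfun.RGenOInfty.measurableE R)).
move=> _ [_ [a ->] <-]; rewrite setTI.
by apply: open_measurableR3; apply: open_comp.
Qed.

Lemma integrable_vanish f L : continuous f -> vanish L f ->
  vol.-integrable [set: mR * mR * mR] (EFin \o f).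
Proof.
move=> cf f0; have [M hM] := vanish_bounded cf f0.
apply: (@integrable_bounded_support _ (mR * mR * mR)%type R vol f (brick (- `|L|) (- `|L|) (- `|L|) `|L| `|L| `|L|) M) => //.
- exact: continuous_measurableR3.
- exact: measurable_brick.
- by rewrite vol_brick ?ge0_cp // ?ltry.
- move=> p; rewrite brick_norm /= => /negP; rewrite -ltNge => h; apply: f0.
  exact: le_lt_trans (ler_norm _) h.
Qed.

Definition Int f : R := (\int[vol]_p f p)%R.

Lemma IntD f g L : continuous f -> continuous g -> vanish L f -> vanish L g ->
  Int (fun p => f p + g p) = Int f + Int g.
Proof. by move=> cf cg hf hg; apply: RintegralD => //; [exact: integrable_vanish cf hf|exact: integrable_vanish cg hg]. Qed.

Lemma IntB f g L : continuous f -> continuous g -> vanish L f -> vanish L g ->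
  Int (fun p => f p - g p) = Int f - Int g.
Proof. by move=> cf cg hf hg; apply: RintegralB => //; [exact: integrable_vanish cf hf|exact: integrable_vanish cg hg]. Qed.

Lemma IntZ (c : R) f L : continuous f -> vanish L f ->
  Int (fun p => c * f p) = c * Int f.
Proof. by move=> cf hf; apply: RintegralZl => //; exact: integrable_vanish cf hf. Qed.

Lemma le_Int f g L : continuous f -> continuous g -> vanish L f -> vanish L g ->
  (forall p, f p <= g p) -> Int f <= Int g.
Proof. by move=> cf cg hf hg fg; apply: le_Rintegral => //; [exact: integrable_vanish cf hf|exact: integrable_vanish cg hg]. Qed.

Lemma Int_brick_le f L a b c M : continuous f -> vanish L f -> 0 <= a -> 0 <= b -> 0 <= c ->
  0 <= M -> (forall p, f p <= M) -> (forall p, ~ brick (- a) (- b) (- c) a b c p -> f p = 0) ->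
  Int f <= M * (8 * a * b * c).
Proof.
move=> cf hf a0 b0 c0 M0 fM f0.
set B := brick _ _ _ _ _ _ in f0.
have vB : vol B = (8 * a * b * c)%:E.
  by rewrite vol_brick ?ge0_cp // !opprK; congr EFin; ring.
have if1 := integrable_vanish cf hf.
have ifB : vol.-integrable B (EFin \o f) by apply: integrableS if1 => //; exact: measurable_brick.
have -> : Int f = (\int[vol]_(p in B) f p)%R.
  rewrite Rintegral_mkcond; apply: eq_Rintegral => p _.
  by rewrite patchE; case: ifPn => // /negP pB; rewrite f0 // => Bp; apply: pB; rewrite inE.
have -> : M * (8 * a * b * c) = (\int[vol]_(p in B) M)%R.
  by rewrite Rintegral_cst ?vB //; exact: measurable_brick.
apply: le_Rintegral => //; first exact: measurable_brick.
apply: (@measurable_bounded_integrable _ (mR * mR * mR)%type R vol (fun=> M)) => //; try exact: measurable_brick.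
  by rewrite [X in (X < _)%E]vB ltry.
by exists M; split; [exact: num_real|move=> y My x _ /=; rewrite ger0_norm // ltW].
Qed.

Lemma Int_le0_eq0 f L : continuous f -> vanish L f -> (forall p, 0 <= f p) ->
  Int f <= 0 -> forall p, f p = 0.
Proof.
move=> cf hf f0 If p; apply/eqP; rewrite eq_le f0 andbT leNgt; apply/negP => fp.
have /nbhs_ballP[e /= e0 he] : \forall q \near p, f p / 2 < f q.
  have := cf p; move/cvgrPdist_lt => /(_ (f p / 2) (divr_gt0 fp (ltr0n _ 2))).
  apply: filterS => q; rewrite ltr_norml => /andP[_]; clear; lra.
set d := e / 2; have d0 : 0 < d by rewrite divr_gt0.
pose B := brick (p.1.1 - d) (p.1.2 - d) (p.2 - d) (p.1.1 + d) (p.1.2 + d) (p.2 + d).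
have mB : measurable (B : set (mR * mR * mR)) by exact: measurable_brick.
have vB : vol B = ((2 * d) ^+ 3)%:E.
  rewrite vol_brick; try by rewrite lerD2l ge0_cp // ltW.
  by congr EFin; rewrite !opprD !opprK !addrA ![_ + d + _]addrAC !addrN !add0r; ring.
have Bf q : B q -> f p / 2 <= f q.
  move=> [[]] /=; rewrite !in_itv /= -!ler_distlC => h1 h2 h3.
  apply/ltW/he; rewrite -ball_normE /ball_ /= normR3 !gt_max.
  have de : d < e by rewrite /d; clear -e0; lra.
  by rewrite !(le_lt_trans _ de).
have if1 := integrable_vanish cf hf.
have ifB : vol.-integrable B (EFin \o f) by apply: integrableS if1.
have : (\int[vol]_(q in B) (f p / 2))%R <= Int f.
  apply: (@le_trans _ _ (\int[vol]_(q in B) f q)%R).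
    apply: le_Rintegral => //.
    apply: measurable_bounded_integrable => //.
      by rewrite [X in (X < _)%E]vB ltry.
    exists (f p / 2); split; first exact: num_real.
    by move=> y My x _ /=; rewrite ger0_norm ?ltW // divr_gt0.
  rewrite Rintegral_mkcond; apply: le_Rintegral => //.
    have := (integrable_mkcond _ mB).1 ifB; congr (integrable _ _ _).
    by apply/funext => q /=; rewrite !patchE; case: ifP.
  by move=> q _; rewrite patchE; case: ifP.
rewrite Rintegral_cst // vB /= => h.
have : 0 < f p / 2 * (2 * d) ^+ 3 by rewrite mulr_gt0 // ?divr_gt0 // exprn_gt0 // mulr_gt0.
by rewrite ltNge (le_trans h).
Qed.

Lemma integral_derive_vanish (g dg : R -> R) L : (forall x : R, is_derive x 1 g (dg x)) ->
  continuous dg -> (forall x, L < `|x| -> g x = 0) -> (forall x, L < `|x| -> dg x = 0) ->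
  (\int[leb]_x (dg x)%:E = 0)%E.
Proof.
move=> hg cdg g0 dg0.
have cg : continuous g by apply: derivable1_continuous => x; have [] := hg x.
(* [K] exceeds [L] and is positive even when [L] is negative, so [g] vanishes at both ends of
   [[- K, K]]. *)
pose K := `|L| + 1.
have K0 : 0 < K by rewrite ltr_pwDr.
have LK : L < K by rewrite /K (le_lt_trans (ler_norm L)) // ltrDl.
rewrite (_ : (fun x => (dg x)%:E) = ((fun x => (dg x)%:E) \_ `[- K, K])); last first.
  apply/funext => x; rewrite patchE; case: ifPn => // /negP h.
  rewrite dg0 // ltNge; apply/negP => hx; apply: h.
  by rewrite inE /= in_itv /= -ler_norml (le_trans hx) // ltW.
rewrite -integral_mkcond (@continuous_FTC2 _ dg g (- K) K).
- by rewrite !g0 ?normrN ?(gtr0_norm K0) // sube0.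
- by rewrite gt0_cp.
- exact: continuous_subspaceT.
- split.
  + by move=> x _; have [] := hg x.
  + exact/cvg_at_right_filter/cg.
  + exact/cvg_at_left_filter/cg.
- by move=> x _; rewrite derive1E derive_val.
Qed.

Lemma vanish_partial f i L : vanish L f -> vanish L (partial i f).
Proof.
move=> hf p Lp; rewrite /partial.
rewrite (near_eq_derive (g := cst 0)) ?derive_cst //.
have : \forall q \near p, L < `|q|.
  apply/nbhs_ballP; exists (`|p| - L); first by rewrite /= subr_gt0.
  move=> q; rewrite -ball_normE /ball_ /= => h.
  have := ler_normD (p - q) q; rewrite subrK => h'.
  by rewrite -(ltrD2l (`|p - q|)) (lt_le_trans _ h') // -ltrBrDr.
by apply: filterS => q Lq; rewrite hf.
Qed.

(** A named copy of the planar measure, which receives its own sigma-finite structure so that Fubini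
    applies to its product with [leb]. *)
Definition leb2 : set (mR * mR) -> \bar R := (leb \x leb)%E.
HB.instance Definition _ := Measure.copy leb2 (leb \x leb)%E.
Lemma leb_itv_lty (a b : R) : (leb `[a, b] < +oo)%E.
Proof. by rewrite lebesgue_measure_itv /=; case: ifP; rewrite -?EFinB ltry. Qed.

Lemma leb2_box_lty (a b c d : R) : (leb2 (`[a, b] `*` `[c, d]) < +oo)%E.
Proof.
rewrite /leb2 product_measure1E; try exact: measurable_itv.
by apply: lte_mul_pinfty; rewrite ?ge0_fin_numE // leb_itv_lty.
Qed.

Lemma leb2_sigma_finite : sigma_finite [set: (mR * mR)%type] leb2.
Proof.
exists (fun n : nat => `[- n%:R, n%:R] `*` `[- n%:R, n%:R]).
  apply/seteqP; split => // -[x y] _; exists (Num.trunc (Num.max `|x| `|y|)).+1 => //=.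
  have h := ltW (truncnS_gt (Num.max `|x| `|y|)); rewrite ge_max in h.
  by case/andP: h => h1 h2; rewrite !in_itv /= -!ler_norml.
move=> n; split; first by apply: measurableX; exact: measurable_itv.
exact: leb2_box_lty.
Qed.

HB.instance Definition _ := Measure_isSigmaFinite.Build _ _ _ leb2 leb2_sigma_finite.
Lemma Fubini_vol12 (g : mR * mR * mR -> R) : vol.-integrable [set: mR * mR * mR] (EFin \o g) ->
  (\int[leb2]_q \int[leb]_z (g (q, z))%:E = \int[vol]_p (g p)%:E)%E.
Proof.
move=> ig.
have ig' : (leb2 \x leb)%E.-integrable [set: (mR * mR) * mR] (EFin \o g).
  exact: ig.
exact: (@integral12_prod_meas1 _ _ (mR * mR)%type mR R leb2 leb (EFin \o g) ig').
Qed.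

Lemma Fubini_vol21 (g : mR * mR * mR -> R) : vol.-integrable [set: mR * mR * mR] (EFin \o g) ->
  (\int[leb]_z \int[leb2]_q (g (q, z))%:E = \int[vol]_p (g p)%:E)%E.
Proof.
move=> ig.
have ig' : (leb2 \x leb)%E.-integrable [set: (mR * mR) * mR] (EFin \o g).
  exact: ig.
exact: (@integral21_prod_meas1 _ _ (mR * mR)%type mR R leb2 leb (EFin \o g) ig').
Qed.

Lemma Fubini_leb2_12 (g : mR * mR -> R) : leb2.-integrable [set: mR * mR] (EFin \o g) ->
  (\int[leb]_x \int[leb]_y (g (x, y))%:E = \int[leb2]_p (g p)%:E)%E.
Proof.
move=> ig.
exact: (@integral12_prod_meas1 _ _ mR mR R leb leb (EFin \o g) ig).
Qed.

Lemma Fubini_leb2_21 (g : mR * mR -> R) : leb2.-integrable [set: mR * mR] (EFin \o g) ->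
  (\int[leb]_y \int[leb]_x (g (x, y))%:E = \int[leb2]_p (g p)%:E)%E.
Proof.
move=> ig.
exact: (@integral21_prod_meas1 _ _ mR mR R leb leb (EFin \o g) ig).
Qed.

Lemma integrable_slice (g : mR * mR * mR -> R) L (z : R) : continuous (g : R3 R -> R) -> vanish L (g : R3 R -> R) ->
  leb2.-integrable [set: mR * mR] (EFin \o (fun q : (mR * mR)%type => g (q, z))).
Proof.
move=> cg g0; have [M hM] := vanish_bounded cg g0.
apply: (@integrable_bounded_support _ (mR * mR)%type R leb2
   (fun q : (mR * mR)%type => g (q, z)) (`[- `|L|, `|L|] `*` `[- `|L|, `|L|]) M) => //.
- apply: (@measurable_fun_pair1 _ _ _ (mR * mR)%type mR mR g z).
  exact: continuous_measurableR3 cg.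
- by apply: measurableX; exact: measurable_itv.
- exact: leb2_box_lty.
- move=> q qL; apply: g0; rewrite ltNge; apply/negP.
  rewrite normR3_le /= => /and3P[h1 h2 _]; apply: qL.
  by split; rewrite /= in_itv /= -ler_norml (le_trans _ (ler_norm L)).
Qed.
Lemma Int_slice2_eq0 g L : continuous g -> vanish L g ->
  (forall q : R * R, (\int[leb]_z (g (q, z))%:E = 0)%E) -> Int g = 0.
Proof.
move=> cg g0 h; rewrite /Int /Rintegral -Fubini_vol12; last exact: integrable_vanish cg g0.
by rewrite integral0_eq.
Qed.

Lemma Int_slice1_eq0 g L : continuous g -> vanish L g ->
  (forall x z : R, (\int[leb]_y (g (x, y, z))%:E = 0)%E) -> Int g = 0.
Proof.
move=> cg g0 h; rewrite /Int /Rintegral -Fubini_vol21; last exact: integrable_vanish cg g0.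
rewrite integral0_eq // => z _.
rewrite -(Fubini_leb2_12 (integrable_slice z cg g0)).
by rewrite integral0_eq.
Qed.

Lemma Int_slice0_eq0 g L : continuous g -> vanish L g ->
  (forall y z : R, (\int[leb]_x (g (x, y, z))%:E = 0)%E) -> Int g = 0.
Proof.
move=> cg g0 h; rewrite /Int /Rintegral -Fubini_vol21; last exact: integrable_vanish cg g0.
rewrite integral0_eq // => z _.
rewrite -(Fubini_leb2_21 (integrable_slice z cg g0)).
by rewrite integral0_eq.
Qed.

Lemma basis3_shift0 (x y z t : R) :
  (x, y, z) + t *: basis3 (@Ordinal 3 0 isT) = (x + t, y, z).
Proof.
apply: injective_projections; [apply: injective_projections|]; rewrite /=.
- exact: (congr1 (fun u => x + u) (mulr1 t)).
- exact: (etrans (congr1 (fun u => y + u) (mulr0 t)) (addr0 y)).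
- exact: (etrans (congr1 (fun u => z + u) (mulr0 t)) (addr0 z)).
Qed.

Lemma basis3_shift1 (x y z t : R) :
  (x, y, z) + t *: basis3 (@Ordinal 3 1 isT) = (x, y + t, z).
Proof.
apply: injective_projections; [apply: injective_projections|]; rewrite /=.
- exact: (etrans (congr1 (fun u => x + u) (mulr0 t)) (addr0 x)).
- exact: (congr1 (fun u => y + u) (mulr1 t)).
- exact: (etrans (congr1 (fun u => z + u) (mulr0 t)) (addr0 z)).
Qed.

Lemma basis3_shift2 (x y z t : R) :
  (x, y, z) + t *: basis3 (@Ordinal 3 2 isT) = (x, y, z + t).
Proof.
apply: injective_projections; [apply: injective_projections|]; rewrite /=.
- exact: (etrans (congr1 (fun u => x + u) (mulr0 t)) (addr0 x)).
- exact: (etrans (congr1 (fun u => y + u) (mulr0 t)) (addr0 y)).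
- exact: (congr1 (fun u => z + u) (mulr1 t)).
Qed.

Lemma integral_line_partial f i L p : Ck 1 f -> vanish L f -> coord3 i p = 0 ->
  (\int[leb]_t (partial i f (p + t *: basis3 i))%:E = 0)%E.
Proof.
move=> hf f0 p0.
have cdf : continuous (partial i f) := Ck_continuous (Ck_partial i hf).
have Lt t : L < `|t| -> L < `|p + t *: basis3 i|.
  move=> Lt; apply: (lt_le_trans Lt).
  have E : coord3 i (p + t *: basis3 i) = t.
    by rewrite coord3_line coord3_basis eqxx mulr1 p0 add0r.
  by have := coord3_le_norm i (p + t *: basis3 i); rewrite E.
apply: (integral_derive_vanish (g := fun t => f (p + t *: basis3 i)) (L := L)) => //.
- by move=> t; apply: (is_derive_line _ _ _ _ _).1; exact: (Ck_is_derive _ _ hf).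
- move=> s; apply: continuous_comp; last exact: cdf.
  exact: continuous_line.
- by move=> x /Lt; exact: f0.
- by move=> x /Lt; exact: vanish_partial.
Qed.

(** Fubini makes the variable of index [i] the innermost one, where the fundamental theorem of
    calculus applies. Every integration by parts below rests on this fact. *)
Lemma Int_partial f i L : Ck 1 f -> vanish L f -> Int (partial i f) = 0.
Proof.
move=> hf f0.
have cdf : continuous (partial i f) := Ck_continuous (Ck_partial i hf).
have df0 := vanish_partial i f0.
case: i cdf df0 => [[|[|[|//]]] h] cdf df0.
- apply: (Int_slice0_eq0 cdf df0) => y z.
  have E := integral_line_partial hf f0 (p := (0, y, z)) (erefl : coord3 (Ordinal h) (0, y, z) = 0).
  rewrite -[RHS]E.
  apply: eq_integral => t _; congr (EFin (partial _ f _)).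
  by rewrite (bool_irrelevance h isT) basis3_shift0 add0r.
- apply: (Int_slice1_eq0 cdf df0) => x z.
  have E := integral_line_partial hf f0 (p := (x, 0, z)) (erefl : coord3 (Ordinal h) (x, 0, z) = 0).
  rewrite -[RHS]E.
  apply: eq_integral => t _; congr (EFin (partial _ f _)).
  by rewrite (bool_irrelevance h isT) basis3_shift1 add0r.
- apply: (Int_slice2_eq0 cdf df0) => -[x y].
  have E := integral_line_partial hf f0 (p := (x, y, 0)) (erefl : coord3 (Ordinal h) (x, y, 0) = 0).
  rewrite -[RHS]E.
  apply: eq_integral => t _; congr (EFin (partial _ f _)).
  by rewrite (bool_irrelevance h isT) basis3_shift2 add0r.
Qed.

End Integral.

(** * A smooth step function *)

Section SmoothStep.
Context {R : realType}.

(* A function of one variable is smooth when it is smooth as a function of the first coordinate. *)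
Definition smooth1 (g : R -> R) := smooth (fun p => g (coord3 ord0 p)).

(** The functions [P(1/y) e^(-1/y)], extended by zero, form a family closed under differentiation:
    the derivative replaces [P] by [X^2 (P - P')]. Hence smoothness follows by one induction over
    all [P]. *)
Definition flat (P : {poly R}) (y : R) : R :=
  if 0 < y then P.[y^-1] * expR (- y^-1) else 0.

(** Each monomial satisfies [t^n <= n! e^t], a term of the exponential series, so [K] is the sum of
    the absolute coefficients weighted by factorials. *)
Lemma horner_expRN_bounded (P : {poly R}) : exists2 K, 0 <= K & forall t, 0 <= t -> `|P.[t] * expR (- t)| <= K.
Proof.
have mono n (t : R) : 0 <= t -> t ^+ n * expR (- t) <= n`!%:R.
  move=> t0; rewrite expRN ler_pdivrMr ?expR_gt0 // mulrC -ler_pdivrMr ?ltr0n ?fact_gt0 //.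
  case: n => [|n]; first by rewrite expr0 fact0 divr1 -expR0 ler_expR.
  by have := @expR_ge1Dxn _ t n t0; apply: le_trans; rewrite lerDr.
exists (\sum_(i < size P) `|P`_i| * i`!%:R).
  by apply: sumr_ge0 => i _; rewrite mulr_ge0.
move=> t t0; rewrite horner_coef mulr_suml.
apply: (le_trans (ler_norm_sum _ _ _)); apply: ler_sum => i _.
rewrite -mulrA normrM ler_wpM2l // ger0_norm; first exact: mono.
by rewrite mulr_ge0 ?exprn_ge0 // expR_ge0.
Qed.

Lemma is_derive_flat P (y : R) : is_derive y 1 (flat P) (flat ('X ^+ 2 * (P - P^`())) y).
Proof.
have [y0|y0|y0] := ltgtP 0 y.
- have h1 : is_derive y 1 (fun y => y^-1) (- (1 / y ^+ 2)).
    by apply: (@is_deriveVf _ _ (fun y : R => y)); rewrite ?gt_eqF //; exact: is_derive_id.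
  have h2 : is_derive y 1 (fun y => P.[y^-1]) (P^`().[y^-1] * - (1 / y ^+ 2)).
    exact: (is_derive_compf h1 (is_derive_poly P y^-1)).
  have h3 : is_derive y 1 (fun y => expR (- y^-1)) (expR (- y^-1) * - - (1 / y ^+ 2)).
    by apply: is_derive_compf; apply: is_deriveN.
  have h4 := is_deriveMf h2 h3.
  have h5 : is_derive y 1 (fun y => P.[y^-1] * expR (- y^-1)) (flat ('X ^+ 2 * (P - P^`())) y).
    apply: (is_derive_eq h4); rewrite /flat y0 hornerM hornerXn hornerD hornerN.
    move: (P.[_]) (P^`().[_]) (expR _) => a b c.
    by rewrite exprVn; field; rewrite gt_eqF.
  apply: near_eq_is_derive h5.
  by near=> z; rewrite /flat ifT //; near: z; exact: lt_nbhsr.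
- rewrite /(flat _ y) ltNge (ltW y0) /=.
  have h : is_derive y 1 (cst 0 : R -> R) (0 : R) by exact: is_derive_cst.
  apply: near_eq_is_derive h.
  near=> z; rewrite /flat ifN // -leNgt; apply/ltW; near: z; exact: lt_nbhsl.
- rewrite -y0 /flat ltxx.
  (* At the origin the difference quotient [P(1/h) e^(-1/h) / h] equals [h] times
     [(X^2 P)(1/h) e^(-1/h)], hence is at most [K h]. Below, [K + 1] replaces [K] as a denominator
     because [K] may be zero. *)
  have [K K0 hK] := horner_expRN_bounded ('X ^+ 2 * P).
  have cv : (fun h => h^-1 *: ((flat P \o shift 0) (h *: (1 : R)) - flat P 0)) @ 0^' --> (0 : R).
    apply/cvgrPdist_le => e e0.
    have : \forall h \near (0 : R)^', `|h| <= e / (K + 1).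
      apply: cvg_within; apply/nbhs_ballP; exists (e / (K + 1)) => /=; first by rewrite divr_gt0 // ltr_wpDl.
      by move=> h; rewrite -ball_normE /ball_ /= sub0r normrN => /ltW.
    apply: filterS => h hh; rewrite sub0r normrN /=.
    have -> : h *: (1 : R) = h by exact: mulr1.
    rewrite addr0 /flat ltxx subr0.
    case: ifPn => [h0|_]; last by rewrite scaler0 normr0 ltW.
    have -> : h^-1 *: (P.[h^-1] * expR (- h^-1)) = h * (('X ^+ 2 * P).[h^-1] * expR (- h^-1)).
      rewrite hornerM hornerXn exprVn; move: (P.[_]) (expR _) => a b.
      change (h^-1 * (a * b) = h * (h ^- 2 * a * b)).
      by field; rewrite gt_eqF.
    rewrite normrM; apply: (@le_trans _ _ (e / (K + 1) * K)).
      by apply: ler_pM => //; apply: hK; rewrite invr_ge0 ltW.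
    rewrite mulrAC ler_pdivrMr ?ltr_wpDl // ler_pM2l // lerDl //.
  split; first by apply/cvg_ex; exists 0.
  by apply/cvg_lim => //; exact: norm_hausdorff.
Unshelve. all: by end_near. Qed.

Lemma smooth1_flat P : smooth1 (flat P).
Proof.
move=> k; elim: k P => [|k IH] P.
  split => //; apply: continuous_compf; first exact: coord3_continuous.
  by apply: derivable1_continuous => x; have [] := is_derive_flat P x.
apply: (@CkS_intro _ _ _ (fun i p => (ord0 == i)%:R * flat ('X ^+ 2 * (P - P^`())) (coord3 ord0 p))).
- apply: continuous_compf; first exact: coord3_continuous.
  by apply: derivable1_continuous => x; have [] := is_derive_flat P x.
- by move=> i p; apply: is_derive_comp_coord3; exact: is_derive_flat.
- by move=> i; apply: CkZ; exact: IH.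
Qed.

Definition sstep (y : R) : R := flat 1 y / (flat 1 y + flat 1 (1 - y)).

Lemma flat1_gt0 y : 0 < y -> 0 < flat 1 y.
Proof. by move=> y0; rewrite /flat y0 hornerC mul1r expR_gt0. Qed.

Lemma flat1_le0 y : y <= 0 -> flat 1 y = 0.
Proof. by move=> y0; rewrite /flat ltNge y0. Qed.

Lemma flat1_ge0 y : 0 <= flat 1 y.
Proof. by have [/flat1_gt0/ltW|/flat1_le0->] := ltP 0 y. Qed.

Lemma flat1_homo x y : x <= y -> flat 1 x <= flat 1 y.
Proof.
move=> xy; have [x0|/flat1_le0->] := ltP 0 x; last exact: flat1_ge0.
have y0 := lt_le_trans x0 xy.
by rewrite /flat x0 y0 !hornerC !mul1r ler_expR lerN2 lef_pV2.
Qed.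

Lemma sstep_den y : 0 < flat 1 y + flat 1 (1 - y).
Proof.
have [y0|y0] := ltP 0 y; first by rewrite ltr_pwDl ?flat1_gt0 ?flat1_ge0.
by rewrite ltr_wpDl ?flat1_ge0 // flat1_gt0 // subr_gt0 (le_lt_trans y0).
Qed.

Lemma sstep_ge0 y : 0 <= sstep y.
Proof. by rewrite divr_ge0 ?flat1_ge0 // ltW // sstep_den. Qed.

Lemma sstep_le1 y : sstep y <= 1.
Proof. by rewrite ler_pdivrMr ?sstep_den // mul1r lerDl flat1_ge0. Qed.

Lemma sstep_le0 y : y <= 0 -> sstep y = 0.
Proof. by move=> y0; rewrite /sstep flat1_le0 // mul0r. Qed.

Lemma sstep_ge1 y : 1 <= y -> sstep y = 1.
Proof.
move=> y1; have := sstep_den y; rewrite /sstep (@flat1_le0 (1 - y)) ?subr_le0 // addr0.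
by move=> h; rewrite divff // gt_eqF.
Qed.

Lemma sstep_homo x y : x <= y -> sstep x <= sstep y.
Proof.
move=> xy; rewrite /sstep ler_pdivrMr ?sstep_den // mulrAC ler_pdivlMr ?sstep_den //.
rewrite !mulrDr [flat 1 y * flat 1 x]mulrC lerD2l ler_pM ?flat1_ge0 ?flat1_homo //.
by rewrite lerD2l lerN2.
Qed.

Lemma smooth1_sstep : smooth1 sstep.
Proof.
move=> k; apply: CkM; first exact: smooth1_flat.
apply: CkV; first by move=> p; rewrite gt_eqF // sstep_den.
apply: CkD; first exact: smooth1_flat.
apply: Ck_comp; first exact: smooth1_flat.
by apply: CkD; [exact: Ck_cst|apply: CkN; exact: Ck_coord3].
Qed.

Lemma smooth1_derive (g : R -> R) : smooth1 g ->
  exists2 dg, (forall x : R, is_derive x 1 g (dg x)) & continuous dg.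
Proof.
move=> hg; exists (fun x => partial ord0 (fun p => g (coord3 ord0 p)) (x, 0, 0)).
  by move=> x; exact: is_derive_axis0.
move=> x; apply: (@continuous_comp _ _ _ (fun x : R => (x, 0, 0) : R3 R)).
  exact: continuous_axis0.
exact: (Ck_continuous (Ck_partial ord0 (hg 1%N))).
Qed.

Lemma smooth1_continuous (g : R -> R) : smooth1 g -> continuous g.
Proof.
by move=> /smooth1_derive[dg hg _]; apply: derivable1_continuous => x; have [] := hg x.
Qed.

(** The primitive of [sstep] that vanishes on the left. Since [sstep] is zero for [t <= 0], any
    negative lower limit gives the same function; with [-1] every [x >= 0] is an interior point of
    [[-1, x + 1]], as the fundamental theorem requires. *)
Definition istep (x : R) : R := (\int[@lebesgue_measure R]_(t in `[(-1)%R, x]) sstep t)%R.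

Lemma istep_lt0 x : x < 0 -> istep x = 0.
Proof.
move=> x0; rewrite /istep; under eq_Rintegral => t.
  rewrite inE /= in_itv /= => /andP[_ tx].
  rewrite sstep_le0; last by rewrite (le_trans tx) // ltW.
  over.
by rewrite /Rintegral integral0.
Qed.

Lemma is_derive_istep (x : R) : is_derive x 1 istep (sstep x).
Proof.
have [x0|x0] := ltP x 0.
  rewrite sstep_le0 ?ltW //.
  have h : is_derive x 1 (cst 0 : R -> R) (0 : R) by exact: is_derive_cst.
  apply: near_eq_is_derive h.
  by near=> z; rewrite istep_lt0 //; near: z; exact: lt_nbhsl.
have cs : continuous sstep by apply: smooth1_continuous; exact: smooth1_sstep.
have xx1 : x < x + 1 by rewrite ltrDl.
have int_s : (@lebesgue_measure R).-integrable `[(-1)%R, (x + 1)%R] (EFin \o sstep).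
  apply: continuous_compact_integrable; first exact: segment_compact.
  exact: continuous_subspaceT.
have x_gtN1 : -1 < x by rewrite (lt_le_trans _ x0).
have [d1 d2] := continuous_FTC1_closed xx1 int_s x_gtN1 (cs x).
by apply: DeriveDef; [exact: d1|rewrite -d2 derive1E].
Unshelve. all: by end_near. Qed.

Lemma smooth1_istep : smooth1 istep.
Proof.
have ci : continuous istep by apply: derivable1_continuous => x; have [] := is_derive_istep x.
case=> [|k]; first by split => //; apply: continuous_compf => //; exact: coord3_continuous.
apply: (@CkS_intro _ _ _ (fun i p => (ord0 == i)%:R * sstep (coord3 ord0 p))).
- by apply: continuous_compf => //; exact: coord3_continuous.
- by move=> i p; apply: is_derive_comp_coord3; exact: is_derive_istep.
- by move=> i; apply: CkZ; exact: smooth1_sstep.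
Qed.

End SmoothStep.

(** * Approximation of C^1 functions by smooth ones *)

Section Kernel.
Context {R : realType}.

(** Two smooth bumps whose integer translates sum to 1. [hat2] is the integral of [hat1] over
    [[y, y + 1]], so its derivative is a difference of two neighbouring translates of [hat1]; this
    is what permits summation by parts below. *)
Definition hat1 (y : R) : R := sstep (y + 1) - sstep y.
Definition hat2 (y : R) : R := istep (y + 2) - istep (y + 1) - (istep (y + 1) - istep y).

Lemma is_derive_istep_shift (a x : R) : is_derive x 1 (fun y => istep (y + a)) (sstep (x + a)).
Proof. by apply: is_derive_shiftf; exact: is_derive_istep. Qed.

Lemma is_derive_hat2 (x : R) : is_derive x 1 hat2 (hat1 (x + 1) - hat1 x).
Proof.
have -> : hat1 (x + 1) - hat1 x = sstep (x + 2) - sstep (x + 1) - (sstep (x + 1) - sstep x).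
  have E : x + 1 + 1 = x + 2 by ring.
  by rewrite /hat1 E.
apply: is_deriveBf; apply: is_deriveBf.
- exact: is_derive_istep_shift.
- exact: is_derive_istep_shift.
- exact: is_derive_istep_shift.
- exact: is_derive_istep.
Qed.

Lemma hat1_ge0 y : 0 <= hat1 y.
Proof. by rewrite subr_ge0 sstep_homo // lerDl. Qed.

Lemma hat1_eq0 y : 1 < `|y| -> hat1 y = 0.
Proof.
rewrite /hat1 ltr_normr => /orP[y1|y1].
  by rewrite !sstep_ge1 ?subrr // ?(ltW y1) // (le_trans (ltW y1)) // lerDl.
by rewrite !sstep_le0 ?subrr //; move: y1; clear; lra.
Qed.

Lemma istepD1_le (y : R) : y <= -2 -> istep (y + 1) - istep y = 0.
Proof. by move=> h; rewrite !istep_lt0 ?subrr //; move: h; clear; lra. Qed.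

Lemma istepD1_ge (y : R) : 2 <= y -> istep (y + 1) - istep y = 1.
Proof.
move=> h; have [c hc ->] := MVTr y (y + 1) (fun x => is_derive_istep x).
rewrite addrAC subrr add0r normr1 ler_norml in hc *.
by rewrite sstep_ge1 ?mul1r //; move: hc h; clear => /andP[]; lra.
Qed.

Lemma hat2_ge0 y : 0 <= hat2 y.
Proof.
rewrite /hat2 -[2]/(1 + 1) addrA.
have hD (x : R) : is_derive x 1 (fun y => istep (y + 1) - istep y) (hat1 x).
  by apply: is_deriveBf; [exact: is_derive_istep_shift|exact: is_derive_istep].
have [c _ ->] := MVTr y (y + 1) hD.
by rewrite addrAC subrr add0r mulr1 hat1_ge0.
Qed.

Lemma hat2_eq0 y : 3 < `|y| -> hat2 y = 0.
Proof.
rewrite /hat2 -[2]/(1 + 1) addrA ltr_normr => /orP[y1|y1].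
  by rewrite !istepD1_ge ?subrr //; move: y1; clear; lra.
by rewrite !istepD1_le ?subrr //; move: y1; clear; lra.
Qed.

Definition node (N k : nat) : R := k%:R - N%:R.

Lemma nodeS N k : node N k.+1 = node N k + 1.
Proof. by rewrite /node -natr1 addrAC. Qed.

(** The sum telescopes, and the bound on [y] puts the two end arguments at [y + N + 1 >= 1] and
    [y - N <= 0], where [sstep] is 1 and 0. *)
Lemma sum_hat1 N (y : R) : `|y| <= N%:R -> \sum_(0 <= k < N.*2.+1) hat1 (y - node N k) = 1.
Proof.
move=> hy.
rewrite (telescope_sumr_eq (fun k => - sstep (y - node N k + 1))) //; last first.
  move=> k _; have -> : y - node N k.+1 + 1 = y - node N k by rewrite nodeS; ring.
  by rewrite /hat1 opprK addrC.
move: hy; rewrite /node ler_norml => /andP[h1 h2].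
rewrite opprK sstep_le0 ?oppr0 ?add0r ?sstep_ge1 //.
  by move: h1; clear; lra.
by rewrite -natr1 -addnn natrD; move: h2; clear; lra.
Qed.

(** Telescoping again. The margin 2 is the distance beyond which the unit increments of [istep] have
    reached their limits 0 and 1. *)
Lemma sum_hat2 N (y : R) : `|y| + 2 <= N%:R -> \sum_(0 <= k < N.*2.+1) hat2 (y - node N k) = 1.
Proof.
move=> hy.
rewrite (telescope_sumr_eq (fun k => - (istep (y - node N k + 2) - istep (y - node N k + 1)))) //; last first.
  move=> k _; have -> : y - node N k.+1 + 2 = y - node N k + 1 by rewrite nodeS; ring.
  have -> : y - node N k.+1 + 1 = y - node N k by rewrite nodeS; ring.
  by rewrite /hat2 opprK addrC.
have {hy} [h1 h2] : 2 <= y + N%:R /\ y <= N%:R - 2.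
  by move: hy (ler_norm y) (ler_norm (- y)); rewrite normrN; clear; split; lra.
have E2 (z : R) : z + 2 = z + 1 + 1 by ring.
rewrite /node !E2 opprK istepD1_le ?oppr0 ?add0r ?istepD1_ge //.
  by move: h1; clear; lra.
by rewrite -natr1 -addnn natrD; move: h2; clear; lra.
Qed.

Lemma sum_by_parts_hat1 (w B : nat -> R) n :
  \sum_(0 <= k < n.+1) w k * (B k - B k.+1) =
  w 0%N * B 0%N + \sum_(0 <= k < n) (w k.+1 - w k) * B k.+1 - w n * B n.+1.
Proof.
elim: n => [|n IH].
  by rewrite big_nat1 big_geq // addr0 mulrBr.
rewrite big_nat_recr //= IH [in RHS]big_nat_recr //=; ring.
Qed.

Lemma average_near (n : nat) (a w : nat -> R) (c e : R) :
  \sum_(0 <= k < n) w k = 1 -> (forall k, 0 <= w k) ->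
  (forall k, w k != 0 -> `|a k - c| <= e) -> `|\sum_(0 <= k < n) a k * w k - c| <= e.
Proof.
move=> w1 w0 ha.
have -> : \sum_(0 <= k < n) a k * w k - c = \sum_(0 <= k < n) (a k - c) * w k.
  under [in RHS]eq_bigr do rewrite mulrBl.
  by rewrite sumrB -mulr_sumr w1 mulr1.
apply: (le_trans (ler_norm_sum _ _ _)).
rewrite -[leRHS]mulr1 -w1 mulr_sumr; apply: ler_sum => k _.
rewrite normrM (ger0_norm (w0 k)).
by have [->|wk] := eqVneq (w k) 0; [rewrite !mulr0|rewrite ler_wpM2r // ha].
Qed.

Lemma average_hat2 N (m x c e : R) (a : nat -> R) : 0 < m -> `|m * x| + 2 <= N%:R ->
  (forall k, `|x - node N k / m| <= 3 / m -> `|a k - c| <= e) ->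
  `|\sum_(0 <= k < N.*2.+1) a k * hat2 (m * x - node N k) - c| <= e.
Proof.
move=> m0 hx ha; apply: average_near; [exact: sum_hat2|by move=> k; exact: hat2_ge0|].
move=> k hk; apply: ha; rewrite -(ler_pM2l m0) mulrCA divff ?gt_eqF // mulr1.
rewrite -{1}(gtr0_norm m0) -normrM mulrBr mulrCA divff ?gt_eqF // mulr1 leNgt.
by apply: contraNN hk => /hat2_eq0 ->.
Qed.

(* Summation by parts turns differences of [hat1] into difference quotients of [f],
   which the mean value theorem identifies with values of [df] near [x]. *)
Lemma average_hat2_derive N (m x c e : R) (f df : R -> R) : 0 < m -> `|m * x| + 2 <= N%:R ->
  (forall y : R, is_derive y 1 f (df y)) ->
  (forall y, `|x - y| <= 3 / m -> `|df y - c| <= e) ->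
  `|\sum_(0 <= k < N.*2.+1) f (node N k / m) * (m * (hat1 (m * x - node N k + 1) - hat1 (m * x - node N k))) - c| <= e.
Proof.
move=> m0 hx hf hdf.
pose B k := hat1 (m * x - node N k + 1).
have BS k : B k.+1 = hat1 (m * x - node N k) by rewrite /B nodeS opprD addrA subrK.
have [xi hxi] : exists xi : nat -> R, forall k, `|xi k - node N k / m| <= 1 / m /\
    f (node N k.+1 / m) - f (node N k / m) = df (xi k) / m.
  suff [xi hxi] : {xi : nat -> R & forall k, `|xi k - node N k / m| <= 1 / m /\
      f (node N k.+1 / m) - f (node N k / m) = df (xi k) / m} by exists xi.
  apply: (choice (P := fun k y => `|y - node N k / m| <= 1 / m /\
    f (node N k.+1 / m) - f (node N k / m) = df y / m)) => k.
  have [y hy1 hy2] := MVTr (node N k / m) (node N k.+1 / m) hf.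
  have E : node N k.+1 / m - node N k / m = 1 / m by rewrite -mulrBl nodeS addrAC subrr add0r.
  exists y; rewrite hy2; move: hy1; rewrite E [`|1 / m|]gtr0_norm ?divr_gt0 //.
  by move=> hy1; split => //; rewrite div1r.
have hx' : `|m * x| <= N%:R by rewrite (le_trans _ hx) // lerDl.
have -> : \sum_(0 <= k < N.*2.+1) f (node N k / m) * (m * (hat1 (m * x - node N k + 1) - hat1 (m * x - node N k)))
   = \sum_(0 <= k < N.*2.+1) df (xi k) * hat1 (m * x - node N k).
  transitivity (\sum_(0 <= k < N.*2.+1) (m * f (node N k / m)) * (B k - B k.+1)).
    by apply: eq_bigr => k _; rewrite BS mulrA [f _ * m]mulrC.
  rewrite sum_by_parts_hat1.
  (* The boundary terms of the summation by parts vanish because the margin in [hx] puts the extreme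
     nodes outside the support of [hat1]. *)
  have B0 : B 0%N = 0.
    rewrite /B hat1_eq0 // /node sub0r opprK ger0_norm; move: hx (ler_norm (- (m * x))); rewrite normrN; clear; lra.
  have BN : B (N.*2).+1 = 0.
    rewrite BS hat1_eq0 // /node -addnn natrD addrK ltr_normr; move: hx (ler_norm (m * x)); clear; lra.
  rewrite B0 BN !mulr0 add0r subr0 [in RHS]big_nat_recr //= -BS BN mulr0 addr0.
  apply: eq_bigr => k _; rewrite -mulrBr (hxi k).2 BS.
  by rewrite mulrCA divff ?gt_eqF // mulr1.
apply: average_near; [exact: sum_hat1|by move=> k; exact: hat1_ge0|].
move=> k hk; apply: hdf.
have h1 : `|x - node N k / m| <= 1 / m.
  rewrite -(ler_pM2l m0) mulrCA divff ?gt_eqF // mulr1.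
  rewrite -{1}(gtr0_norm m0) -normrM mulrBr mulrCA divff ?gt_eqF // mulr1 leNgt.
  by apply: contraNN hk => /hat1_eq0 ->.
have := ler_normD (x - node N k / m) (node N k / m - xi k); rewrite subrKA => h.
apply: (le_trans h); rewrite [`|node N k / m - _|]distrC.
have [h2 _] := hxi k.
have m1 : 0 < 1 / m by rewrite divr_gt0.
apply: (le_trans (lerD h1 h2)); rewrite -mulrDl ler_pM2r ?invr_gt0 //; clear; lra.
Qed.

Lemma smooth1_hat2 : smooth1 hat2.
Proof.
have h (a : R) k : Ck k (fun p : R3 R => istep (coord3 ord0 p + a)).
  apply: Ck_comp; first exact: smooth1_istep.
  by apply: CkD; [exact: Ck_coord3|exact: Ck_cst].
have hB k (f g : R3 R -> R) : Ck k f -> Ck k g -> Ck k (fun p => f p - g p).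
  by move=> hf hg; apply: CkD => //; exact: CkN.
move=> k; apply: (hB); apply: (hB); [exact: h|exact: h|exact: h|exact: smooth1_istep].
Qed.

End Kernel.

Section Density.
Context {R : realType}.

Lemma is_derive_sumf (V : normedModType R) (I : Type) (r : seq I) (F : I -> V -> R) (p v : V) (dF : I -> R) :
  (forall x, is_derive p v (F x) (dF x)) ->
  is_derive p v (fun q => \sum_(x <- r) F x q) (\sum_(x <- r) dF x).
Proof.
move=> hF; elim: r => [|x r IH].
  rewrite big_nil (_ : (fun q => _) = cst 0); first exact: is_derive_cst.
  by apply/funext => q; rewrite big_nil.
rewrite big_cons (_ : (fun q => _) = (fun q => F x q + \sum_(y <- r) F y q)).
  exact: is_deriveDf.
by apply/funext => q; rewrite big_cons.
Qed.

Implicit Types (f g : R3 R -> R) (p q : R3 R).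

(** Only [p] is confined to the cube: the grid points compared with [p] below may lie outside it. *)
Lemma uniform_continuity_norm_le f (L e : R) : continuous f -> 0 < e ->
  exists2 d, 0 < d & forall p q, `|p| <= L -> `|p - q| <= d -> `|f p - f q| <= e.
Proof.
move=> cf e0.
have /compact_near_coveringP/(_ R (0 : R)^'+ (fun d p => forall q, `|p - q| <= d -> `|f p - f q| <= e) _) :=
  @compact_norm_le R L.
have H : forall x, [set p : R3 R | `|p| <= L] x ->
   \forall x' \near x & i \near (0 : R)^'+, forall q, `|x' - q| <= i -> `|f x' - f q| <= e.
  move=> x _; have /cvgrPdist_le/(_ (e / 2) (divr_gt0 e0 (ltr0n _ 2))) := cf x.
  move=> /nbhs_ballP[d /= d0 hd].
  near=> x' i => q hq.
  have hx' : `|x - x'| < d / 2.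
    by near: x'; apply/nbhs_ballP; exists (d / 2) => /=; [rewrite divr_gt0|move=> y; rewrite -ball_normE].
  have hi : i < d / 2 by near: i; apply: nbhs_right_lt; rewrite divr_gt0.
  have h1 : `|f x - f x'| <= e / 2.
    by apply: hd; rewrite -ball_normE /ball_ /= (lt_le_trans hx') // ler_pdivrMr // ler_peMr // ?ltW //; clear; lra.
  have h2 : `|f x - f q| <= e / 2.
    apply: hd; rewrite -ball_normE /ball_ /= -(subrKA x') (le_lt_trans (ler_normD _ _)) //.
    by rewrite (splitr d) ltrD // (le_lt_trans hq).
  rewrite -(subrKA (f x)) (le_trans (ler_normD _ _)) // (splitr e) lerD //.
  by rewrite distrC.
move=> /(_ H) [d /= d0 hd].
exists (d / 2); first by rewrite divr_gt0.
move=> p q hp; apply: (hd (d / 2)) => //=; last by rewrite divr_gt0.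
rewrite sub0r normrN gtr0_norm ?divr_gt0 // ltr_pdivrMr // ltr_pMr //; clear; lra.
Unshelve. all: by end_near. Qed.

Section Smoothing.
Variables (f : R3 R -> R) (N : nat) (m : R).

Definition weight (k : nat) (x : R) : R := hat2 (m * x - node N k).

Definition dweight (k : nat) (x : R) : R :=
  m * (hat1 (m * x - node N k + 1) - hat1 (m * x - node N k)).

Definition grid (k : nat) : R := node N k / m.

(** A discrete mollification at scale [1 / m]: the values of [f] on a grid are averaged with
    products of translated bumps. As a finite sum it is smooth whatever [f] is. *)
Definition smoothing p : R :=
  \sum_(0 <= k < N.*2.+1) \sum_(0 <= l < N.*2.+1) \sum_(0 <= n < N.*2.+1)
    f (grid k, grid l, grid n) * weight k p.1.1 * weight l p.1.2 * weight n p.2.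

Lemma is_derive_weight k (x : R) : is_derive x 1 (weight k) (dweight k x).
Proof.
rewrite /dweight mulrC.
have h : is_derive x 1 (fun x => m * x - node N k) m.
  apply: (is_derive_eq (is_deriveBf (is_deriveMf (is_derive_cst m x 1) (is_derive_id x 1))
    (is_derive_cst (node N k) x 1))).
  by rewrite mul0r add0r mulr1 subr0.
exact: (is_derive_compf h (is_derive_hat2 _)).
Qed.

Lemma smooth_weight k i : smooth (fun p => weight k (coord3 i p)).
Proof.
move=> j; apply: (@Ck_comp _ _ hat2 (fun p => m * coord3 i p - node N k)); first exact: smooth1_hat2.
by apply: CkD; [apply: CkZ; exact: Ck_coord3|apply: CkN; exact: Ck_cst].
Qed.

Let i0 : 'I_3 := @Ordinal 3 0 isT.
Let i1 : 'I_3 := @Ordinal 3 1 isT.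
Let i2 : 'I_3 := @Ordinal 3 2 isT.

Lemma smooth_smoothing : smooth smoothing.
Proof.
move=> j; rewrite /smoothing; do 3 (apply: Ck_sum => ?).
apply: CkM; [apply: CkM; [apply: CkM; [exact: Ck_cst|]|]|].
- exact: (smooth_weight _ i0).
- exact: (smooth_weight _ i1).
- exact: (smooth_weight _ i2).
Qed.

Lemma partial_smoothing0 p : partial i0 smoothing p =
  \sum_(0 <= k < N.*2.+1) \sum_(0 <= l < N.*2.+1) \sum_(0 <= n < N.*2.+1)
    f (grid k, grid l, grid n) * dweight k p.1.1 * weight l p.1.2 * weight n p.2.
Proof.
apply: is_derive_partial; do 3 (apply: is_derive_sumf => ?).
have h0 := is_derive_comp_coord3 i0 (is_derive_weight _ (coord3 i0 p)).
have h1 := is_derive_comp_coord3 i0 (is_derive_weight _ (coord3 i1 p)).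
have h2 := is_derive_comp_coord3 i0 (is_derive_weight _ (coord3 i2 p)).
apply: (is_derive_eq (is_deriveMf (is_deriveMf (is_deriveMf (is_derive_cst _ _ _) (h0 _)) (h1 _)) (h2 _))).
by rewrite /= !mul0r !mulr0 !addr0 mul1r add0r.
Qed.

Lemma partial_smoothing1 p : partial i1 smoothing p =
  \sum_(0 <= k < N.*2.+1) \sum_(0 <= l < N.*2.+1) \sum_(0 <= n < N.*2.+1)
    f (grid k, grid l, grid n) * weight k p.1.1 * dweight l p.1.2 * weight n p.2.
Proof.
apply: is_derive_partial; do 3 (apply: is_derive_sumf => ?).
have h0 := is_derive_comp_coord3 i1 (is_derive_weight _ (coord3 i0 p)).
have h1 := is_derive_comp_coord3 i1 (is_derive_weight _ (coord3 i1 p)).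
have h2 := is_derive_comp_coord3 i1 (is_derive_weight _ (coord3 i2 p)).
apply: (is_derive_eq (is_deriveMf (is_deriveMf (is_deriveMf (is_derive_cst _ _ _) (h0 _)) (h1 _)) (h2 _))).
by rewrite /= !mul0r !mulr0 !add0r !mul0r !addr0 add0r mul1r.
Qed.

Lemma partial_smoothing2 p : partial i2 smoothing p =
  \sum_(0 <= k < N.*2.+1) \sum_(0 <= l < N.*2.+1) \sum_(0 <= n < N.*2.+1)
    f (grid k, grid l, grid n) * weight k p.1.1 * weight l p.1.2 * dweight n p.2.
Proof.
apply: is_derive_partial; do 3 (apply: is_derive_sumf => ?).
have h0 := is_derive_comp_coord3 i2 (is_derive_weight _ (coord3 i0 p)).
have h1 := is_derive_comp_coord3 i2 (is_derive_weight _ (coord3 i1 p)).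
have h2 := is_derive_comp_coord3 i2 (is_derive_weight _ (coord3 i2 p)).
apply: (is_derive_eq (is_deriveMf (is_deriveMf (is_deriveMf (is_derive_cst _ _ _) (h0 _)) (h1 _)) (h2 _))).
by rewrite /= !mul0r !mulr0 !add0r !mul0r !addr0 !mul0r add0r mul1r.
Qed.

End Smoothing.

(** The three nestings make the sum over any chosen coordinate the innermost. For a partial
    derivative this is the sum with the differentiated weight, which the mean value argument treats
    first; the two outer sums are plain averages. *)
Lemma sum3_nest2 (M : nat) (a : nat -> nat -> nat -> R) (u v w : nat -> R) :
  \sum_(0 <= k < M) \sum_(0 <= l < M) \sum_(0 <= n < M) a k l n * u k * v l * w n =
  \sum_(0 <= k < M) (\sum_(0 <= l < M) (\sum_(0 <= n < M) a k l n * w n) * v l) * u k.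
Proof.
apply: eq_bigr => k _; rewrite mulr_suml; apply: eq_bigr => l _.
by rewrite !mulr_suml; apply: eq_bigr => n _; ring.
Qed.

Lemma sum3_nest1 (M : nat) (a : nat -> nat -> nat -> R) (u v w : nat -> R) :
  \sum_(0 <= k < M) \sum_(0 <= l < M) \sum_(0 <= n < M) a k l n * u k * v l * w n =
  \sum_(0 <= k < M) (\sum_(0 <= n < M) (\sum_(0 <= l < M) a k l n * v l) * w n) * u k.
Proof.
apply: eq_bigr => k _; rewrite exchange_big mulr_suml; apply: eq_bigr => n _.
by rewrite !mulr_suml; apply: eq_bigr => l _; ring.
Qed.

Lemma sum3_nest0 (M : nat) (a : nat -> nat -> nat -> R) (u v w : nat -> R) :
  \sum_(0 <= k < M) \sum_(0 <= l < M) \sum_(0 <= n < M) a k l n * u k * v l * w n =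
  \sum_(0 <= l < M) (\sum_(0 <= n < M) (\sum_(0 <= k < M) a k l n * u k) * w n) * v l.
Proof.
rewrite exchange_big; apply: eq_bigr => l _; rewrite exchange_big mulr_suml; apply: eq_bigr => n _.
by rewrite !mulr_suml; apply: eq_bigr => k _; ring.
Qed.

Lemma is_derive_slice0 f (x y z : R) : Ck 1 f ->
  is_derive x 1 (fun x => f (x, y, z)) (partial (@Ordinal 3 0 isT) f (x, y, z)).
Proof.
move=> hf.
have E (s : R) : (s, y, z) = (0, y, z) + s *: basis3 (@Ordinal 3 0 isT) by rewrite basis3_shift0 add0r.
have := Ck_is_derive (@Ordinal 3 0 isT) (x, y, z) hf.
rewrite {1}E => /(is_derive_line _ _ _ _ _).1.
by rewrite (_ : (fun s => _) = (fun x => f (x, y, z))) //; apply/funext => s; rewrite -E.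
Qed.

Lemma is_derive_slice1 f (x y z : R) : Ck 1 f ->
  is_derive y 1 (fun y => f (x, y, z)) (partial (@Ordinal 3 1 isT) f (x, y, z)).
Proof.
move=> hf.
have E (s : R) : (x, s, z) = (x, 0, z) + s *: basis3 (@Ordinal 3 1 isT) by rewrite basis3_shift1 add0r.
have := Ck_is_derive (@Ordinal 3 1 isT) (x, y, z) hf.
rewrite {1}E => /(is_derive_line _ _ _ _ _).1.
by rewrite (_ : (fun s => _) = (fun y => f (x, y, z))) //; apply/funext => s; rewrite -E.
Qed.

Lemma is_derive_slice2 f (x y z : R) : Ck 1 f ->
  is_derive z 1 (fun z => f (x, y, z)) (partial (@Ordinal 3 2 isT) f (x, y, z)).
Proof.
move=> hf.
have E (s : R) : (x, y, s) = (x, y, 0) + s *: basis3 (@Ordinal 3 2 isT) by rewrite basis3_shift2 add0r.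
have := Ck_is_derive (@Ordinal 3 2 isT) (x, y, z) hf.
rewrite {1}E => /(is_derive_line _ _ _ _ _).1.
by rewrite (_ : (fun s => _) = (fun z => f (x, y, z))) //; apply/funext => s; rewrite -E.
Qed.

Lemma density_C1 f (L e : R) : Ck 1 f -> 0 < e -> exists g, [/\ smooth g,
  forall p, `|p| <= L -> `|g p - f p| <= e &
  forall i p, `|p| <= L -> `|partial i g p - partial i f p| <= e].
Proof.
move=> hf e0.
pose i0 : 'I_3 := @Ordinal 3 0 isT; pose i1 : 'I_3 := @Ordinal 3 1 isT; pose i2 : 'I_3 := @Ordinal 3 2 isT.
have [d d0 hd] := uniform_continuity_norm_le L (Ck_continuous hf) e0.
have hdp i := uniform_continuity_norm_le L (Ck_continuous (Ck_partial i hf)) e0.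
have [d' d'0 hd'] : exists2 d', 0 < d' & forall i p q, `|p| <= L -> `|p - q| <= d' -> `|partial i f p - partial i f q| <= e.
  have [a a0 ha] := hdp i0; have [b b0 hb] := hdp i1; have [c c0 hc] := hdp i2.
  exists (Num.min a (Num.min b c)); first by rewrite !lt_min a0 b0 c0.
  move=> i p q hp; rewrite !le_min => /and3P[h1 h2 h3].
  by case: i => [[|[|[|//]]] h]; rewrite (bool_irrelevance h isT); [exact: ha|exact: hb|exact: hc].
(* The bumps have radius at most [3 / m], which is thus exactly the distance allowed by the uniform
   continuity of [f] and its derivatives. *)
pose m := 3 / Num.min d d'.
have dd0 : 0 < Num.min d d' by rewrite lt_min d0 d'0.
have m0 : 0 < m by rewrite divr_gt0.
have m3 : 3 / m = Num.min d d' by rewrite /m invf_div mulrC divfK.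
(* The grid covers the cube of radius [L] with the margin needed for the weights to sum to 1. *)
have [N hN] : exists N : nat, m * `|L| + 2 <= N%:R.
  by exists (Num.trunc (m * `|L| + 2)).+1; apply/ltW/truncnS_gt.
have bnd x : `|x| <= L -> `|m * x| + 2 <= N%:R.
  move=> hx; apply: le_trans hN; rewrite lerD2r normrM (gtr0_norm m0) ler_pM2l //.
  exact: le_trans (ler_norm L).
have near3 p (x y z c : R) : c <= Num.min d d' -> `|p.1.1 - x| <= 3 / m -> `|p.1.2 - y| <= 3 / m -> `|p.2 - z| <= 3 / m ->
   `|p - (x, y, z)| <= Num.min d d'.
  by move=> _ h1 h2 h3; rewrite -m3 normR3_le /= h1 h2 h3.
have nearf p (x y z : R) : `|p| <= L -> `|p.1.1 - x| <= 3 / m -> `|p.1.2 - y| <= 3 / m ->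
    `|p.2 - z| <= 3 / m -> `|f (x, y, z) - f p| <= e.
  move=> hp h1 h2 h3; rewrite distrC; apply: hd => //.
  by rewrite (le_trans (near3 _ _ _ _ _ (lexx _) h1 h2 h3)) // ge_min lexx.
have neardf i p (x y z : R) : `|p| <= L -> `|p.1.1 - x| <= 3 / m -> `|p.1.2 - y| <= 3 / m ->
    `|p.2 - z| <= 3 / m -> `|partial i f (x, y, z) - partial i f p| <= e.
  move=> hp h1 h2 h3; rewrite distrC; apply: hd' => //.
  by rewrite (le_trans (near3 _ _ _ _ _ (lexx _) h1 h2 h3)) // ge_min lexx orbT.
exists (smoothing f N m); split; first exact: smooth_smoothing.
  move=> p hp; have := hp; rewrite normR3_le => /and3P[/bnd b1 /bnd b2 /bnd b3].
  rewrite /smoothing sum3_nest2; apply: average_hat2 => // k hk.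
  apply: average_hat2 => // l hl; apply: average_hat2 => // n hn.
  exact: nearf.
move=> i p hp; have := hp; rewrite normR3_le => /and3P[/bnd b1 /bnd b2 /bnd b3].
case: i => [[|[|[|//]]] h]; rewrite (bool_irrelevance h isT).
- rewrite partial_smoothing0 sum3_nest0; apply: average_hat2 => // l hl.
  apply: average_hat2 => // n hn.
  apply: (average_hat2_derive (f := fun x => f (x, grid N m l, grid N m n))) => //.
    by move=> y; exact: is_derive_slice0.
  by move=> y hy; exact: neardf.
- rewrite partial_smoothing1 sum3_nest1; apply: average_hat2 => // k hk.
  apply: average_hat2 => // n hn.
  apply: (average_hat2_derive (f := fun y => f (grid N m k, y, grid N m n))) => //.
    by move=> y; exact: is_derive_slice1.
  by move=> y hy; exact: neardf.
- rewrite partial_smoothing2 sum3_nest2; apply: average_hat2 => // k hk.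
  apply: average_hat2 => // l hl.
  apply: (average_hat2_derive (f := fun z => f (grid N m k, grid N m l, z))) => //.
    by move=> y; exact: is_derive_slice2.
  by move=> y hy; exact: neardf.
Qed.

End Density.

(** * The stability inequality for axially symmetric solutions *)

(* [partial] unfolds to a limit, which slows unification down; [pd] is a locked copy. *)
HB.lock Definition pd (R : realType) (i : 'I_3) (f : R3 R -> R) : R3 R -> R := partial i f.
Arguments pd {R}.

Section LockedPartial.
Context {R : realType}.
Implicit Types (f g : R3 R -> R) (p q : R3 R) (i j : 'I_3).

Lemma pdE i f : pd i f = partial i f.
Proof. by rewrite pd.unlock. Qed.

Lemma Ck_pd k i f : Ck k.+1 f -> Ck k (pd i f).
Proof. by rewrite pdE; exact: Ck_partial. Qed.

Lemma Ck_is_derive_pd k f i p : Ck k.+1 f -> is_derive p (basis3 i) f (pd i f p).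
Proof. by rewrite pdE; exact: Ck_is_derive. Qed.

Lemma is_derive_pd f i p a : is_derive p (basis3 i) f a -> pd i f p = a.
Proof. by rewrite pdE; exact: is_derive_partial. Qed.

Lemma pdC f i j p : Ck 2 f -> pd i (pd j f) p = pd j (pd i f) p.
Proof. by rewrite !pdE; exact: partialC. Qed.

Lemma vanish_pd L f i : vanish L f -> vanish L (pd i f).
Proof. by rewrite pdE; exact: vanish_partial. Qed.

Lemma Int_pd f i L : Ck 1 f -> vanish L f -> Int (pd i f) = 0.
Proof. by rewrite pdE; exact: Int_partial. Qed.

Lemma density_pd f (L e : R) : Ck 1 f -> 0 < e -> exists g, [/\ smooth g,
  forall p, `|p| <= L -> `|g p - f p| <= e &
  forall i p, `|p| <= L -> `|pd i g p - pd i f p| <= e].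
Proof.
move=> hf e0; have [g [h1 h2 h3]] := density_C1 L hf e0.
by exists g; split => // i p; rewrite !pdE; exact: h3.
Qed.

End LockedPartial.

Ltac ck :=
  match goal with
  | H : Ck ?k ?f |- Ck ?k ?f => exact: H
  | |- Ck _ (fun p => @?f p + @?g p) => apply: (@CkD _ _ f g); ck
  | |- Ck _ (fun p => - @?f p) => apply: (@CkN _ _ f); ck
  | |- Ck _ (fun p => @?f p ^+ _) => apply: (@CkX _ _ f); ck
  | |- Ck _ (fun p => @?f p * @?g p) => apply: (@CkM _ _ f g); ck
  | |- Ck _ (fun _ => _) => exact: Ck_cst
  | |- Ck _ (coord3 _) => exact: Ck_coord3
  | |- Ck _ (fun p => coord3 _ p) => exact: Ck_coord3
  | |- Ck ?k (pd _ _) => apply: Ck_pd; ck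
  | |- Ck ?k (fun p => pd ?i ?f p) => apply: (@Ck_pd _ k i f); ck
  | H : Ck _ ?f |- Ck _ ?f => apply: Ck_le H; done
  | H : Ck _ ?f |- Ck _ (fun p => ?f p) => apply: Ck_le H; done
  | H : smooth ?f |- Ck _ ?f => exact: H
  | H : smooth ?f |- Ck _ (fun p => ?f p) => exact: H
  | |- _ => exact: Ck_coord3
  end.

Ltac cont :=
  match goal with
  | H : continuous ?f |- continuous ?f => exact: H
  | H : continuous ?f |- continuous (fun p => ?f p) => exact: H
  | |- continuous (fun p => @?f p + @?g p) => apply: (@continuousDf _ _ f g); cont
  | |- continuous (fun p => - @?f p) => apply: (@continuousNf _ _ f); cont
  | |- continuous (fun p => `|@?f p|) => apply: (@continuous_absf _ _ f); cont
  | |- continuous (fun p => @?f p ^+ _) => apply: (@continuousXf _ _ f); cont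
  | |- continuous (fun p => @?f p * @?g p) => apply: (@continuousMf _ _ f g); cont
  | |- continuous ?f => apply: (@Ck_continuous _ 0); ck
  end.

Section Space3.
Context {R : realType}.
Implicit Types (f g : R3 R -> R) (p q : R3 R) (i j : 'I_3).

Lemma pdM i f g p : Ck 1 f -> Ck 1 g ->
  pd i (fun q => f q * g q) p = pd i f p * g p + f p * pd i g p.
Proof.
move=> hf hg; apply: is_derive_pd.
exact: (is_deriveMf (Ck_is_derive_pd i p hf) (Ck_is_derive_pd i p hg)).
Qed.

Lemma pd_coord3 i j p : pd i (coord3 j) p = (j == i)%:R.
Proof. by apply: is_derive_pd; rewrite -coord3_basis; exact: is_derive_coord3. Qed.

Lemma sum_ord3 (F : 'I_3 -> R) : \sum_(i < 3) F i =
  F (@Ordinal 3 0 isT) + F (@Ordinal 3 1 isT) + F (@Ordinal 3 2 isT).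
Proof.
rewrite !big_ord_recl big_ord0 addr0 addrA.
by congr (F _ + F _ + F _); apply: val_inj.
Qed.

Lemma laplacianE f p : laplacian f p =
  pd (@Ordinal 3 0 isT) (pd (@Ordinal 3 0 isT) f) p + pd (@Ordinal 3 1 isT) (pd (@Ordinal 3 1 isT) f) p
  + pd (@Ordinal 3 2 isT) (pd (@Ordinal 3 2 isT) f) p.
Proof. by rewrite /laplacian sum_ord3 !pdE. Qed.

Lemma grad_sqE f p : grad_sq f p = pd (@Ordinal 3 0 isT) f p ^+ 2
  + pd (@Ordinal 3 1 isT) f p ^+ 2 + pd (@Ordinal 3 2 isT) f p ^+ 2.
Proof. by rewrite /grad_sq sum_ord3 !pdE. Qed.

Lemma le_limit0 (a b : R) : (forall e : R, 0 < e -> e <= 1 -> 0 <= a + e * b) -> 0 <= a.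
Proof.
move=> h; rewrite leNgt; apply/negP => a0.
have b1 : 0 < `|b| + 1 by rewrite ltr_wpDl.
have e0 : 0 < - a / (`|b| + 1) by rewrite divr_gt0 // oppr_gt0.
pose e := Num.min 1 (- a / (`|b| + 1) / 2).
have e_gt0 : 0 < e by rewrite lt_min ltr01 divr_gt0.
have he : e * b <= - a / 2.
  apply: (@le_trans _ _ (e * (`|b| + 1))).
    by rewrite ler_pM2l // (le_trans (ler_norm b)) // lerDl.
  rewrite -ler_pdivlMr // mulrAC /e ge_min; apply/orP; right.
  by rewrite mulrAC.
have := h e e_gt0; rewrite ge_min lexx => /(_ isT).
by move: he a0; clear; lra.
Qed.

(** The limit passage needs no convergence theorem: one fixed compactly supported [k] controls the
    error at every precision [e], so [Int f + e * Int k] is nonnegative for all small [e]. *)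
Lemma Int_ge0_approx f (k : R3 R -> R) L : continuous f -> vanish L f -> continuous k -> vanish L k ->
  (forall e : R, 0 < e -> e <= 1 -> exists h, [/\ continuous h, vanish L h, 0 <= Int h &
     forall p, h p <= f p + e * k p]) -> 0 <= Int f.
Proof.
move=> cf f0 ck0 k0 H; apply: (@le_limit0 _ (Int k)) => e e0 e1.
have [h [ch h0 Ih hf]] := H e e0 e1.
have cek : continuous (fun p => e * k p) by apply: continuousMf => // p; exact: cvg_cst.
have vek : vanish L (fun p => e * k p) by move=> p hp; rewrite k0 // mulr0.
rewrite -(IntZ e ck0 k0) -(IntD cf cek f0 vek); apply: (le_trans Ih).
apply: (le_Int ch _ h0) => //; first exact: continuousDf.
by move=> p hp; rewrite f0 // vek // addr0.
Qed.

End Space3.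

(** * The linearised equation with C^1 test functions and the geometric form of stability *)

Section WeakEquation.
Context {R : realType}.
(** [F] and [c] stand for [W'(u)] and [W''(u)]. They are linked only by the chain rule [dF], which
    keeps the one-sided derivatives of [W] at the ends of its domain out of the argument. *)
Variables (u F c : R3 R -> R).
Hypothesis hu : Ck 2 u.
Hypothesis hF : forall p, laplacian u p = F p.
Hypothesis dF : forall i p, is_derive p (basis3 i) F (c p * pd i u p).
Hypothesis cc : continuous c.

Local Notation e0 := (@Ordinal 3 0 isT).
Local Notation e1 := (@Ordinal 3 1 isT).
Local Notation e2 := (@Ordinal 3 2 isT).

Lemma Ck_source : Ck 1 F.
Proof.
have cF : continuous F.
  have -> : F = (fun p => pd e0 (pd e0 u) p + pd e1 (pd e1 u) p + pd e2 (pd e2 u) p).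
    by apply/funext => p; rewrite -hF laplacianE.
  by cont.
apply: (@CkS_intro _ _ _ (fun i p => c p * pd i u p)) => // i.
by split => //; cont.
Qed.

Definition weak_form j (psi : R3 R -> R) p : R :=
  pd e0 (pd j u) p * pd e0 psi p + pd e1 (pd j u) p * pd e1 psi p
  + pd e2 (pd j u) p * pd e2 psi p + c p * pd j u p * psi p.

Lemma vanish_weak_form j psi L : vanish L psi -> vanish L (weak_form j psi).
Proof.
move=> h p hp; by rewrite /weak_form (h p hp) !(vanish_pd _ h hp) !mulr0 !addr0.
Qed.

Lemma continuous_weak_form j psi : Ck 1 psi -> continuous (weak_form j psi).
Proof. by move=> h; rewrite /weak_form; cont. Qed.

(** The weak form is an exact divergence: the derivative of [H] in direction [j] minus the sum over
    [i] of the derivatives of [u_i psi_j]. The terms [u_i psi_ij] cancel by symmetry of second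
    derivatives and [F psi_j] cancels by the equation, so no third derivative of [u] ever
    appears. *)
Lemma weak_equation_smooth j psi L : Ck 2 psi -> vanish L psi -> Int (weak_form j psi) = 0.
Proof.
move=> hpsi psi0; have hF1 := Ck_source.
pose H p := pd e0 u p * pd e0 psi p + pd e1 u p * pd e1 psi p
  + pd e2 u p * pd e2 psi p + F p * psi p.
pose B i p := pd i u p * pd j psi p.
have hH : Ck 1 H by rewrite /H; ck.
have hB i : Ck 1 (B i) by rewrite /B; ck.
have H0 : vanish L H.
  by move=> p hp; rewrite /H (psi0 p hp) !(vanish_pd _ psi0 hp) !mulr0 !addr0.
have B0 i : vanish L (B i) by move=> p hp; rewrite /B !(vanish_pd _ psi0 hp) mulr0.
have E : weak_form j psi = (fun p => pd j H p - (pd e0 (B e0) p + (pd e1 (B e1) p + pd e2 (B e2) p))).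
  apply/funext => p.
  have dH : pd j H p = pd j (pd e0 u) p * pd e0 psi p + pd e0 u p * pd j (pd e0 psi) p
    + (pd j (pd e1 u) p * pd e1 psi p + pd e1 u p * pd j (pd e1 psi) p)
    + (pd j (pd e2 u) p * pd e2 psi p + pd e2 u p * pd j (pd e2 psi) p)
    + (c p * pd j u p * psi p + F p * pd j psi p).
    apply: is_derive_pd.
    have D i := is_deriveMf (Ck_is_derive_pd j p (Ck_pd i hu)) (Ck_is_derive_pd j p (Ck_pd i hpsi)).
    have hpsi1 : Ck 1 psi := Ck_mono hpsi.
    exact: (is_deriveDf (is_deriveDf (is_deriveDf (D e0) (D e1)) (D e2))
      (is_deriveMf (dF j p) (Ck_is_derive_pd j p hpsi1))).
  have dB i : pd i (B i) p = pd i (pd i u) p * pd j psi p + pd i u p * pd i (pd j psi) p.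
    by rewrite /B pdM //; ck.
  rewrite dH !dB -hF laplacianE /weak_form.
  rewrite !(pdC e0 j _ hu) !(pdC e1 j _ hu) !(pdC e2 j _ hu).
  rewrite !(pdC e0 j _ hpsi) !(pdC e1 j _ hpsi) !(pdC e2 j _ hpsi).
  move: (pd j (pd e0 u) p) (pd j (pd e1 u) p) (pd j (pd e2 u) p) => a0 a1 a2.
  move: (pd j (pd e0 psi) p) (pd j (pd e1 psi) p) (pd j (pd e2 psi) p) => b0 b1 b2.
  move: (pd e0 (pd e0 u) p) (pd e1 (pd e1 u) p) (pd e2 (pd e2 u) p) => d0 d1 d2.
  move: (pd e0 u p) (pd e1 u p) (pd e2 u p) (pd j u p) (psi p) (c p) => u0 u1 u2 uj ps cp.
  move: (pd e0 psi p) (pd e1 psi p) (pd e2 psi p) (pd j psi p) => p0 p1 p2 pj.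
  by ring.
have cd i f : Ck 1 f -> continuous (pd i f) by move=> h; exact: (Ck_continuous (Ck_pd i h)).
have vd i f : vanish L f -> vanish L (pd i f) by exact: vanish_pd.
rewrite E (IntB (L := L)); [|exact: cd| |exact: vd|]; last 2 first.
- by apply: continuousDf; [exact: cd|apply: continuousDf; exact: cd].
- by move=> p hp; rewrite !(vd _ _ (B0 _) p hp) !addr0.
rewrite (IntD (L := L)); [|exact: cd| |exact: vd|]; last 2 first.
- by apply: continuousDf; exact: cd.
- by move=> p hp; rewrite !(vd _ _ (B0 _) p hp) !addr0.
rewrite (IntD (L := L)); [|exact: cd|exact: cd|exact: vd|exact: vd].
by rewrite !(Int_pd _ (hB _) (B0 _)) (Int_pd _ hH H0) !addr0 subr0.
Qed.

Lemma weak_form_pert_le (a0 a1 a2 b x0 x1 x2 z0 z1 z2 z d0 d1 d2 d e : R) :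
  0 <= e -> `|d| <= e -> `|d0| <= e -> `|d1| <= e -> `|d2| <= e ->
  `|a0 * (d0 * z + d * z0) + a1 * (d1 * z + d * z1) + a2 * (d2 * z + d * z2) + b * (d * z)| <=
  e * (`|a0| * (`|z| + `|z0|) + `|a1| * (`|z| + `|z1|) + `|a2| * (`|z| + `|z2|) + `|b| * `|z|).
Proof.
move=> e_ge0 hd h0 h1 h2.
have one a dd zz : `|dd| <= e -> `|a * (dd * z + d * zz)| <= e * (`|a| * (`|z| + `|zz|)).
  move=> hdd; rewrite normrM mulrCA ler_wpM2l // mulrDr.
  by apply: (le_trans (ler_normD _ _)); rewrite !normrM lerD // ler_wpM2r.
apply: (le_trans (ler_normD _ _)); rewrite [leRHS]mulrDr lerD //; last first.
  by rewrite !normrM [leRHS]mulrCA ler_wpM2l // ler_wpM2r.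
apply: (le_trans (ler_normD _ _)); rewrite [leRHS]mulrDr lerD ?one //.
by apply: (le_trans (ler_normD _ _)); rewrite [leRHS]mulrDr lerD ?one.
Qed.

(** Only the factor [g] is approximated. The factor [zeta] keeps all approximants supported in one
    cube, and a C^1 error [e] in [g] changes the integrand by at most [e * k], with [k] depending on
    [u], [c] and [zeta] alone. *)
Lemma weak_equation j g zeta L : Ck 1 g -> smooth zeta -> vanish L zeta ->
  Int (weak_form j (fun p => g p * zeta p)) = 0.
Proof.
move=> hg hz z0.
pose k p := `|pd e0 (pd j u) p| * (`|zeta p| + `|pd e0 zeta p|)
  + `|pd e1 (pd j u) p| * (`|zeta p| + `|pd e1 zeta p|)
  + `|pd e2 (pd j u) p| * (`|zeta p| + `|pd e2 zeta p|)
  + `|c p * pd j u p| * `|zeta p|.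
have ck0 : continuous k by rewrite /k; cont.
have k0 : vanish L k.
  by move=> p hp; rewrite /k (z0 p hp) !(vanish_pd _ z0 hp) !normr0 !addr0 !mulr0 !addr0.
have hgz (f : R3 R -> R) : Ck 1 f -> Ck 1 (fun p => f p * zeta p) by move=> h; ck.
have vgz (f : R3 R -> R) : vanish L (fun p => f p * zeta p) by move=> p hp; rewrite z0 // mulr0.
have cw f : Ck 1 f -> continuous (weak_form j (fun p => f p * zeta p)).
  by move=> h; apply: continuous_weak_form; exact: hgz.
have vw f : vanish L (weak_form j (fun p => f p * zeta p)) by apply: vanish_weak_form; exact: vgz.
have key e : 0 < e -> exists h, [/\ continuous h, vanish L h, Int h = 0 &
   forall p, `|h p - weak_form j (fun p => g p * zeta p) p| <= e * k p].
  move=> e_gt0; have [ge [sge ge1 ge2]] := density_pd L hg e_gt0.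
  exists (weak_form j (fun p => ge p * zeta p)); split.
  - by apply: cw; exact: sge.
  - exact: vw.
  - exact: (weak_equation_smooth j (CkM (sge 2%N) (hz 2%N)) (vgz ge)).
  - move=> p; have [hp|hp] := leP `|p| L; last by rewrite (vw _ p hp) (vw _ p hp) subrr normr0 k0 // mulr0.
    have h1 := ge1 p hp; have h2 i := ge2 i p hp.
    have dz f i : Ck 1 f -> pd i (fun q => f q * zeta q) p = pd i f p * zeta p + f p * pd i zeta p.
      by move=> h; rewrite pdM //; exact: hz.
    rewrite /weak_form !(dz ge) ?(dz g); try exact: hg; try exact: sge.
    have := @weak_form_pert_le (pd e0 (pd j u) p) (pd e1 (pd j u) p) (pd e2 (pd j u) p)
      (c p * pd j u p) 0 0 0 (pd e0 zeta p) (pd e1 zeta p) (pd e2 zeta p) (zeta p)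
      (pd e0 ge p - pd e0 g p) (pd e1 ge p - pd e1 g p) (pd e2 ge p - pd e2 g p)
      (ge p - g p) e (ltW e_gt0) h1 (h2 e0) (h2 e1) (h2 e2).
    rewrite /k; congr (`|_| <= _).
    move: (pd e0 (pd j u) p) (pd e1 (pd j u) p) (pd e2 (pd j u) p) => a0 a1 a2.
    move: (pd e0 zeta p) (pd e1 zeta p) (pd e2 zeta p) (zeta p) => s0 s1 s2 s.
    move: (pd e0 ge p) (pd e1 ge p) (pd e2 ge p) (ge p) => t0 t1 t2 t.
    move: (pd e0 g p) (pd e1 g p) (pd e2 g p) (g p) (c p * pd j u p) => g0 g1 g2 gg b.
    by ring.
have cg := cw g hg; have vg := vw g.
(* The approximation lemma yields nonnegativity only, so it is used for the form and for its
   negative. *)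
apply/eqP; rewrite eq_le; apply/andP; split.
- rewrite -oppr_ge0 -mulN1r -(IntZ _ cg vg).
  apply: (@Int_ge0_approx _ _ k L) => //.
  + by apply: continuousMf => // p; exact: cvg_cst.
  + by move=> p hp; rewrite vg // mulr0.
  + move=> e e_gt0 _; have [h [ch vh Ih hh]] := key e e_gt0.
    exists (fun p => -1 * h p); split.
    * by apply: continuousMf => // p; exact: cvg_cst.
    * by move=> p hp; rewrite vh // mulr0.
    * by rewrite (IntZ _ ch vh) Ih mulr0.
    * by move=> p; have := hh p; rewrite ler_norml => /andP[]; clear; lra.
- apply: (@Int_ge0_approx _ _ k L) => //.
  move=> e e_gt0 _; have [h [ch vh Ih hh]] := key e e_gt0.
  exists h; split => //; first by rewrite Ih.
  by move=> p; have := hh p; rewrite ler_norml => /andP[]; clear; lra.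
Qed.

Hypothesis hstab : forall phi L, smooth phi -> vanish L phi ->
  0 <= Int (fun p => grad_sq phi p + c p * phi p ^+ 2).

(** The restriction [e <= 1] lets the quadratic part of the perturbation be absorbed by a term
    linear in [e]. *)
Lemma sqr_pert_le (a d s e : R) : 0 <= e -> e <= 1 -> 0 <= s -> `|d| <= e * s ->
  (a + d) ^+ 2 <= a ^+ 2 + e * (2 * `|a| * s + s ^+ 2).
Proof.
move=> e_ge0 e_le1 s0 hd.
have h1 : a * d <= `|a| * (e * s).
  by apply: (le_trans (ler_norm _)); rewrite normrM ler_wpM2l.
have h2 : d ^+ 2 <= e * s ^+ 2.
  rewrite -(real_normK (num_real d)) (@le_trans _ _ ((e * s) ^+ 2)) // ?lerXn2r ?nnegrE //.
    by rewrite mulr_ge0.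
  by rewrite exprMn ler_wpM2r ?sqr_ge0 // expr2 ler_piMl.
have -> : (a + d) ^+ 2 = a ^+ 2 + (a * d *+ 2 + d ^+ 2) by ring.
rewrite lerD2l mulrDr lerD // (_ : e * (2 * `|a| * s) = (`|a| * (e * s)) *+ 2); last by ring.
by rewrite lerMn2r.
Qed.

Lemma potential_pert_le (b f d z e : R) : 0 <= e -> e <= 1 -> `|d| <= e ->
  b * ((f + d) * z) ^+ 2 <= b * (f * z) ^+ 2 + e * (`|b| * (2 * `|f| + 1) * z ^+ 2).
Proof.
move=> e_ge0 e_le1 hd.
have -> : b * ((f + d) * z) ^+ 2 = b * (f * z) ^+ 2 + (b * (2 * f * d + d ^+ 2)) * z ^+ 2 by ring.
rewrite lerD2l [leRHS]mulrA ler_wpM2r ?sqr_ge0 //.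
apply: (le_trans (ler_norm _)); rewrite normrM mulrCA ler_wpM2l //.
apply: (le_trans (ler_normD _ _)); rewrite mulrDr mulr1 lerD //.
  by rewrite !normrM [leRHS]mulrC ger0_norm // ler_wpM2l // mulr_ge0.
by rewrite normrX (le_trans _ hd) // expr2 ler_piMl // (le_trans hd).
Qed.

(** The device of [weak_equation] again, now for the quadratic form: stability holds at the smooth
    approximants, and an upper bound of their integrand by that of [f xi] plus [e * k] suffices. *)
Lemma stable_C1 f xi L : Ck 1 f -> smooth xi -> vanish L xi ->
  0 <= Int (fun p => grad_sq (fun q => f q * xi q) p + c p * (f p * xi p) ^+ 2).
Proof.
move=> hf hx x0.
pose a i p := pd i f p * xi p + f p * pd i xi p.
pose s i p := `|xi p| + `|pd i xi p|.
have gradE (g : R3 R -> R) p : Ck 1 g -> grad_sq (fun q => g q * xi q) p =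
   (pd e0 g p * xi p + g p * pd e0 xi p) ^+ 2 +
   (pd e1 g p * xi p + g p * pd e1 xi p) ^+ 2 +
   (pd e2 g p * xi p + g p * pd e2 xi p) ^+ 2.
  by move=> hg; rewrite grad_sqE !pdM //; exact: hx.
pose E (g : R3 R -> R) p := (pd e0 g p * xi p + g p * pd e0 xi p) ^+ 2 +
   (pd e1 g p * xi p + g p * pd e1 xi p) ^+ 2 +
   (pd e2 g p * xi p + g p * pd e2 xi p) ^+ 2 + c p * (g p * xi p) ^+ 2.
have gradE' (g : R3 R -> R) : Ck 1 g -> (fun p => grad_sq (fun q => g q * xi q) p + c p * (g p * xi p) ^+ 2) = E g.
  by move=> hg; apply/funext => p; rewrite gradE.
have cE g : Ck 1 g -> continuous (E g) by move=> hg; rewrite /E; cont.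
have vE g : vanish L (E g).
  by move=> p hp; rewrite /E (x0 p hp) !(vanish_pd _ x0 hp) !mulr0 !addr0 !expr0n /= mulr0 !addr0.
pose k p := 2 * `|a e0 p| * s e0 p + s e0 p ^+ 2 + (2 * `|a e1 p| * s e1 p + s e1 p ^+ 2)
  + (2 * `|a e2 p| * s e2 p + s e2 p ^+ 2) + `|c p| * (2 * `|f p| + 1) * xi p ^+ 2.
have ck0 : continuous k by rewrite /k /a /s; cont.
have k0 : vanish L k.
  move=> p hp.
  have az i : a i p = 0 by rewrite /a (x0 p hp) (vanish_pd _ x0 hp) !mulr0 addr0.
  have sz i : s i p = 0 by rewrite /s (x0 p hp) (vanish_pd _ x0 hp) !normr0 addr0.
  by rewrite /k !az !sz (x0 p hp) !expr0n /= !mulr0 !addr0.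
rewrite gradE' //; apply: (@Int_ge0_approx _ _ k L) => //; first exact: cE.
move=> e e_gt0 e_le1; have [ge [sge ge1 ge2]] := density_pd L hf e_gt0.
exists (E ge); split.
- by apply: cE; exact: sge.
- exact: vE.
- rewrite -gradE'; last exact: sge.
  have sgx : smooth (fun q => ge q * xi q) by move=> n; exact: (CkM (sge n) (hx n)).
  have vgx : vanish L (fun q => ge q * xi q) by move=> p hp; rewrite x0 // mulr0.
  exact: (hstab sgx vgx).
move=> p; have [hp|hp] := leP `|p| L; last by rewrite (vE _ p hp) (vE _ p hp) k0 // mulr0 addr0.
have h1 := ge1 p hp; have h2 i := ge2 i p hp.
have hs i : 0 <= s i p by rewrite /s addr_ge0.
have grad i : (pd i ge p * xi p + ge p * pd i xi p) ^+ 2 <=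
    a i p ^+ 2 + e * (2 * `|a i p| * s i p + s i p ^+ 2).
  have -> : pd i ge p * xi p + ge p * pd i xi p = a i p +
      ((pd i ge p - pd i f p) * xi p + (ge p - f p) * pd i xi p).
    rewrite /a; move: (pd i ge p) (pd i f p) (pd i xi p) (ge p) (f p) (xi p) => b1 b2 b3 b4 b5 b6.
    by ring.
  apply: sqr_pert_le => //; first exact: ltW.
  rewrite /s mulrDr; apply: (le_trans (ler_normD _ _)).
  by rewrite !normrM lerD // ler_wpM2r.
have pot : c p * (ge p * xi p) ^+ 2 <= c p * (f p * xi p) ^+ 2 + e * (`|c p| * (2 * `|f p| + 1) * xi p ^+ 2).
  by have := potential_pert_le (c p) (f p) (xi p) (ltW e_gt0) e_le1 h1; rewrite addrC subrK.
rewrite /E /k; have := lerD (lerD (lerD (grad e0) (grad e1)) (grad e2)) pot.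
move/le_trans; apply; rewrite -/(a e0 p) -/(a e1 p) -/(a e2 p).
rewrite le_eqVlt; apply/orP; left; apply/eqP.
move: (a e0 p) (a e1 p) (a e2 p) (s e0 p) (s e1 p) (s e2 p) (c p) (f p) (xi p) => a0 a1 a2 s0 s1 s2 cp fp xp.
by ring.
Qed.

Hypothesis hrot : forall p, coord3 e0 p * pd e1 u p = coord3 e1 p * pd e0 u p.

(** Differentiating [hrot] in the three directions gives the relations between second derivatives
    that [geom_identity] takes as hypotheses. *)
Lemma rotation_derivative i p :
  (e0 == i)%:R * pd e1 u p + coord3 e0 p * pd i (pd e1 u) p =
  (e1 == i)%:R * pd e0 u p + coord3 e1 p * pd i (pd e0 u) p.
Proof.
have h j k := is_deriveMf (is_derive_coord3 j p (basis3 i)) (Ck_is_derive_pd i p (Ck_pd k hu)).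
have h01 := is_derive_pd (h e0 e1); have h10 := is_derive_pd (h e1 e0).
rewrite !coord3_basis in h01 h10; rewrite -h01 -h10.
by congr (pd i _ p); apply/funext => q; rewrite hrot.
Qed.

Definition radial p := coord3 e0 p * pd e0 u p + coord3 e1 p * pd e1 u p.

Definition hgrad p := pd e0 u p ^+ 2 + pd e1 u p ^+ 2.

Definition geom (xi : R3 R -> R) p :=
  2 * xi p * (coord3 e0 p * pd e0 xi p + coord3 e1 p * pd e1 xi p) +
  (coord3 e0 p ^+ 2 + coord3 e1 p ^+ 2) *
  (pd e0 xi p ^+ 2 + pd e1 xi p ^+ 2 + pd e2 xi p ^+ 2).

(** The terms with [c0] cancel by the definition of [v], and the mixed vertical derivatives by that
    of [v2]. The surviving second derivatives form [xi^2 (v0 u0 + v1 u1 - v (u00 + u11))], which is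
    zero by the rotation relations ([A3]). The same symmetry makes the horizontal gradient parallel
    to [(x, y)], which is the content of [A0], [A1] and [A2]. *)
Lemma geom_identity (x y u0 u1 u00 u01 u11 u02 u12 xi x0 x1 x2 c0 : R) :
  x * u1 = y * u0 -> u1 + x * u01 = y * u00 -> x * u11 = u0 + y * u01 -> x * u12 = y * u02 ->
  let v := x * u0 + y * u1 in
  let v0 := u0 + x * u00 + y * u01 in
  let v1 := u1 + x * u01 + y * u11 in
  let v2 := x * u02 + y * u12 in
  (v0 * xi + v * x0) ^+ 2 + (v1 * xi + v * x1) ^+ 2 + (v2 * xi + v * x2) ^+ 2 + c0 * (v * xi) ^+ 2
  - (u00 * (v0 * (x * xi ^+ 2) + v * (xi ^+ 2 + x * (2 * xi * x0)))
     + u01 * (v1 * (x * xi ^+ 2) + v * (x * (2 * xi * x1)))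
     + u02 * (v2 * (x * xi ^+ 2) + v * (x * (2 * xi * x2))) + c0 * u0 * (v * (x * xi ^+ 2)))
  - (u01 * (v0 * (y * xi ^+ 2) + v * (y * (2 * xi * x0)))
     + u11 * (v1 * (y * xi ^+ 2) + v * (xi ^+ 2 + y * (2 * xi * x1)))
     + u12 * (v2 * (y * xi ^+ 2) + v * (y * (2 * xi * x2))) + c0 * u1 * (v * (y * xi ^+ 2)))
  = (u0 ^+ 2 + u1 ^+ 2) * (2 * xi * (x * x0 + y * x1) + (x ^+ 2 + y ^+ 2) * (x0 ^+ 2 + x1 ^+ 2 + x2 ^+ 2)).
Proof.
move=> h0 h1 h2 h3 v v0 v1 v2.
have A0 : v * u0 = x * (u0 ^+ 2 + u1 ^+ 2).
  by rewrite /v mulrDl -[y * u1 * u0]mulrAC -h0; ring.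
have A1 : v * u1 = y * (u0 ^+ 2 + u1 ^+ 2).
  by rewrite /v mulrDl [x * u0 * u1]mulrAC h0; ring.
have A2 : v ^+ 2 = (x ^+ 2 + y ^+ 2) * (u0 ^+ 2 + u1 ^+ 2).
  have -> : v ^+ 2 = x * (v * u0) + y * (v * u1) by rewrite /v; ring.
  by rewrite A0 A1; ring.
have A3 : v0 * u0 + v1 * u1 = v * (u00 + u11).
  have E : v0 * u0 + v1 * u1 - v * (u00 + u11) = u0 * (u0 + y * u01 - x * u11) + u1 * (u1 + x * u01 - y * u00).
    by rewrite /v0 /v1 /v; ring.
  by apply/eqP; rewrite -subr_eq0 E h1 h2 !subrr !mulr0 addr0.
have E : forall a b d : R, (v0 * xi + v * x0) ^+ 2 + (v1 * xi + v * x1) ^+ 2 + (v2 * xi + v * x2) ^+ 2 + c0 * (v * xi) ^+ 2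
  - (u00 * (v0 * (x * xi ^+ 2) + v * (xi ^+ 2 + x * (2 * xi * x0)))
     + u01 * (v1 * (x * xi ^+ 2) + v * (x * (2 * xi * x1)))
     + u02 * (v2 * (x * xi ^+ 2) + v * (x * (2 * xi * x2))) + c0 * u0 * (v * (x * xi ^+ 2)))
  - (u01 * (v0 * (y * xi ^+ 2) + v * (y * (2 * xi * x0)))
     + u11 * (v1 * (y * xi ^+ 2) + v * (xi ^+ 2 + y * (2 * xi * x1)))
     + u12 * (v2 * (y * xi ^+ 2) + v * (y * (2 * xi * x2))) + c0 * u1 * (v * (y * xi ^+ 2)))
  = xi ^+ 2 * (v0 * u0 + v1 * u1 - v * (u00 + u11)) + 2 * xi * (v * u0 * x0 + v * u1 * x1)
    + v ^+ 2 * (x0 ^+ 2 + x1 ^+ 2 + x2 ^+ 2).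
  by move=> _ _ _; rewrite /v0 /v1 /v2 /v; ring.
rewrite (E 0 0 0) A3 A0 A1 A2; ring.
Qed.

Lemma Ck_radial : Ck 1 radial.
Proof.
rewrite /radial; apply: CkD; apply: CkM.
- exact: Ck_coord3.
- exact: (Ck_pd e0 hu).
- exact: Ck_coord3.
- exact: (Ck_pd e1 hu).
Qed.

Lemma pd_radial i p : pd i radial p =
  (e0 == i)%:R * pd e0 u p + coord3 e0 p * pd i (pd e0 u) p +
  ((e1 == i)%:R * pd e1 u p + coord3 e1 p * pd i (pd e1 u) p).
Proof.
apply: is_derive_pd; rewrite -!coord3_basis; apply: is_deriveDf.
  exact: (is_deriveMf (is_derive_coord3 e0 p (basis3 i)) (Ck_is_derive_pd i p (Ck_pd e0 hu))).
exact: (is_deriveMf (is_derive_coord3 e1 p (basis3 i)) (Ck_is_derive_pd i p (Ck_pd e1 hu))).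
Qed.

Lemma pd_coord_sqr i j (xi : R3 R -> R) p : Ck 1 xi ->
  pd i (fun q => coord3 j q * xi q ^+ 2) p =
  (j == i)%:R * xi p ^+ 2 + coord3 j p * (2 * xi p * pd i xi p).
Proof.
move=> hx; have -> : (fun q => coord3 j q * xi q ^+ 2) = (fun q => coord3 j q * (xi q * xi q)).
  by apply/funext => q; rewrite expr2.
rewrite pdM; try by ck.
rewrite pdM // pd_coord3; move: (pd i xi p) (xi p) (coord3 j p) => a b d; ring.
Qed.

Lemma stable_geometric xi L : smooth xi -> vanish L xi ->
  0 <= Int (fun p => hgrad p * geom xi p).
Proof.
move=> hx x0.
have hv := Ck_radial; have hx1 : Ck 1 xi := hx 1%N.
have hz j : smooth (fun q => coord3 j q * xi q ^+ 2).
  by move=> n; apply: CkM; [exact: Ck_coord3|apply: CkX; exact: hx].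
have z0 j : vanish L (fun q => coord3 j q * xi q ^+ 2).
  by move=> p hp; rewrite x0 // expr0n /= mulr0.
pose psi j q := radial q * (coord3 j q * xi q ^+ 2).
have hpsi j : Ck 1 (psi j) by apply: CkM => //; exact: (hz j).
have psi0 j : vanish L (psi j) by move=> p hp; rewrite /psi (z0 j) // mulr0.
have W j : Int (weak_form j (psi j)) = 0 by exact: (weak_equation j hv (hz j) (z0 j)).
pose Q p := grad_sq (fun q => radial q * xi q) p + c p * (radial p * xi p) ^+ 2.
have hvx : Ck 1 (fun q => radial q * xi q) by ck.
have gE p : grad_sq (fun q => radial q * xi q) p =
   (pd e0 radial p * xi p + radial p * pd e0 xi p) ^+ 2 +
   (pd e1 radial p * xi p + radial p * pd e1 xi p) ^+ 2 +
   (pd e2 radial p * xi p + radial p * pd e2 xi p) ^+ 2.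
  by rewrite grad_sqE !pdM.
have QE : Q = (fun p => (pd e0 radial p * xi p + radial p * pd e0 xi p) ^+ 2 +
   (pd e1 radial p * xi p + radial p * pd e1 xi p) ^+ 2 +
   (pd e2 radial p * xi p + radial p * pd e2 xi p) ^+ 2 + c p * (radial p * xi p) ^+ 2).
  by apply/funext => p; rewrite /Q gE.
have cQ : continuous Q by rewrite QE; cont.
have vQ : vanish L Q.
  by move=> p hp; rewrite QE (x0 p hp) !(vanish_pd _ x0 hp) !mulr0 !addr0 !expr0n /= mulr0 !addr0.
have cW j : continuous (weak_form j (psi j)) by exact: continuous_weak_form.
have vW j : vanish L (weak_form j (psi j)) by exact: vanish_weak_form.
have -> : (fun p => hgrad p * geom xi p) = (fun p => Q p - weak_form e0 (psi e0) p - weak_form e1 (psi e1) p).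
  apply/funext => p; rewrite QE /weak_form /psi.
  have dpsi i j : pd i (fun q => radial q * (coord3 j q * xi q ^+ 2)) p =
      pd i radial p * (coord3 j p * xi p ^+ 2) +
      radial p * ((j == i)%:R * xi p ^+ 2 + coord3 j p * (2 * xi p * pd i xi p)).
    by rewrite pdM ?pd_coord_sqr //; exact: (hz j).
  rewrite !dpsi !pd_radial /= !(pdC e1 e0 _ hu) !(pdC e2 e0 _ hu) !(pdC e2 e1 _ hu).
  have r0 := rotation_derivative e0 p; have r1 := rotation_derivative e1 p.
  have r2 := rotation_derivative e2 p; have rr := hrot p.
  rewrite /= !mul1r !mul0r !add0r in r0 r1 r2.
  rewrite (pdC e1 e0 _ hu) in r1; rewrite (pdC e2 e0 _ hu) (pdC e2 e1 _ hu) in r2.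
  have GI := @geom_identity (coord3 e0 p) (coord3 e1 p) (pd e0 u p) (pd e1 u p)
    (pd e0 (pd e0 u) p) (pd e0 (pd e1 u) p) (pd e1 (pd e1 u) p) (pd e0 (pd e2 u) p) (pd e1 (pd e2 u) p)
    (xi p) (pd e0 xi p) (pd e1 xi p) (pd e2 xi p) (c p) rr r0 r1 r2.
  rewrite /hgrad /geom -GI /radial.
  move: (pd e0 (pd e0 u) p) (pd e0 (pd e1 u) p) (pd e1 (pd e1 u) p) (pd e0 (pd e2 u) p) (pd e1 (pd e2 u) p).
  move: (coord3 e0 p) (coord3 e1 p) (pd e0 u p) (pd e1 u p) (xi p) (pd e0 xi p) (pd e1 xi p) (pd e2 xi p) (c p).
  move=> {GI r0 r1 r2 rr} x y u0 u1 s s0 s1 s2 cp u00 u01 u11 u02 u12 /=; ring.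
rewrite (IntB (L := L)) ?W ?subr0 //; last 2 first.
- by apply: continuousBf.
- by move=> p hp; rewrite vQ // vW // subrr.
rewrite (IntB (L := L)) ?W ?subr0 //.
exact: (stable_C1 hv hx x0).
Qed.

End WeakEquation.

(** * Cutoff functions *)

Section Plateau.
Context {R : realType}.
Implicit Types (t : R) (p q : R3 R).

Local Notation e0 := (@Ordinal 3 0 isT).
Local Notation e1 := (@Ordinal 3 1 isT).
Local Notation e2 := (@Ordinal 3 2 isT).

Definition plateau t : R := sstep (2 - t) * sstep (2 + t).

Lemma smooth1_plateau : smooth1 plateau.
Proof.
have h (g : R3 R -> R) k : Ck k g -> Ck k (fun p => sstep (g p)).
  by move=> hg; apply: Ck_comp => //; exact: smooth1_sstep.
move=> k; apply: CkM; apply: h; apply: CkD; try exact: Ck_cst; last exact: Ck_coord3.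
by apply: CkN; exact: Ck_coord3.
Qed.

Lemma plateau_ge0 t : 0 <= plateau t.
Proof. by rewrite mulr_ge0 ?sstep_ge0. Qed.

Lemma plateau_le1 t : plateau t <= 1.
Proof. by rewrite -[leRHS]mulr1 ler_pM ?sstep_ge0 ?sstep_le1. Qed.

Lemma plateau1 t : `|t| <= 1 -> plateau t = 1.
Proof.
by rewrite ler_norml => /andP[h1 h2]; rewrite /plateau !sstep_ge1 ?mulr1 //; move: h1 h2; clear; lra.
Qed.

Lemma plateau0 t : 2 <= `|t| -> plateau t = 0.
Proof.
rewrite ler_normr /plateau => /orP[h|h].
  by rewrite [sstep (2 - t)]sstep_le0 ?mul0r //; move: h; clear; lra.
by rewrite [sstep (2 + t)]sstep_le0 ?mulr0 //; move: h; clear; lra.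
Qed.

Lemma plateau_derive : exists dX : R -> R, exists2 C, 0 < C &
  [/\ forall t : R, is_derive t 1 plateau (dX t), forall t, `|dX t| <= C,
     forall t, `|t| < 1 -> dX t = 0 & forall t, 2 < `|t| -> dX t = 0].
Proof.
have [dX hX cX] := smooth1_derive smooth1_plateau.
have X1 t : `|t| < 1 -> dX t = 0.
  move=> ht; have [_ <-] := hX t.
  rewrite (near_eq_derive (g := cst 1 : R -> R)) ?derive_cst //.
  apply/nbhs_ballP; exists (1 - `|t|); first by rewrite /= subr_gt0.
  move=> y; rewrite -ball_normE /ball_ /= => hy; rewrite plateau1 //.
  by rewrite -[y](subrKC t) (le_trans (ler_normD _ _)) // distrC addrC -lerBrDr ltW.
have X2 t : 2 < `|t| -> dX t = 0.
  move=> ht; have [_ <-] := hX t.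
  rewrite (near_eq_derive (g := cst 0 : R -> R)) ?derive_cst //.
  apply/nbhs_ballP; exists (`|t| - 2); first by rewrite /= subr_gt0.
  move=> y; rewrite -ball_normE /ball_ /= => hy; rewrite plateau0 //.
  have := ler_normD (t - y) y; rewrite subrK => h.
  by move: hy h; clear; lra.
have : compact (dX @` `[-2, 2]).
  by apply: continuous_compact; [exact: continuous_subspaceT|exact: segment_compact].
move=> /compact_bounded [M [_ hM]]; exists dX, (`|M| + 1); first by rewrite ltr_wpDl.
split => // t; have [ht|ht] := leP `|t| 2; last by rewrite X2 // normr0 addr_ge0.
apply: (hM (`|M| + 1)); first by rewrite (le_lt_trans (ler_norm M)) // ltrDl.
by exists t => //; rewrite /= in_itv /= -ler_norml.
Qed.

Definition cutoff (a b : R) p : R :=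
  plateau (a^-1 * coord3 e0 p) * plateau (a^-1 * coord3 e1 p) * plateau (b^-1 * coord3 e2 p).

Lemma smooth_cutoff a b : smooth (cutoff a b).
Proof.
have h d i k : Ck k (fun p => plateau (d * coord3 i p)).
  by apply: (@Ck_comp _ _ plateau (fun p => d * coord3 i p)); [exact: smooth1_plateau|apply: CkZ; exact: Ck_coord3].
by move=> k; apply: CkM; [apply: CkM|]; exact: h.
Qed.

Lemma cutoff_ge0 a b p : 0 <= cutoff a b p.
Proof. by apply: mulr_ge0; [apply: mulr_ge0|]; exact: plateau_ge0. Qed.

Lemma cutoff_le1 a b p : cutoff a b p <= 1.
Proof.
rewrite /cutoff; move: (plateau_ge0 (a^-1 * coord3 e0 p)) (plateau_le1 (a^-1 * coord3 e0 p)).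
move: (plateau_ge0 (a^-1 * coord3 e1 p)) (plateau_le1 (a^-1 * coord3 e1 p)).
move: (plateau_ge0 (b^-1 * coord3 e2 p)) (plateau_le1 (b^-1 * coord3 e2 p)).
move: (plateau _) (plateau _) (plateau _) => x y z x0 x1 y0 y1 z0 z1.
by rewrite -[leRHS]mulr1 ler_pM ?mulr_ge0 // -[leRHS]mulr1 ler_pM.
Qed.

Definition inbox (a b : R) p : bool :=
  [&& `|coord3 e0 p| <= a, `|coord3 e1 p| <= a & `|coord3 e2 p| <= b].

Lemma normV_le (a x : R) (c : R) : 0 < a -> (`|a^-1 * x| <= c) = (`|x| <= c * a).
Proof. by move=> a0; rewrite normrM gtr0_norm ?invr_gt0 // mulrC ler_pdivrMr. Qed.

Lemma cutoff1 a b p : 0 < a -> 0 < b -> inbox a b p -> cutoff a b p = 1.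
Proof.
move=> a0 b0 /and3P[h1 h2 h3].
by rewrite /cutoff !plateau1 ?mulr1 // normV_le ?mul1r.
Qed.

Lemma vanish_inbox a b p L : 2 * a <= L -> 2 * b <= L -> L < `|p| -> ~~ inbox (2 * a) (2 * b) p.
Proof.
move=> ha hb; apply: contraTN => /and3P[h1 h2 h3]; rewrite -leNgt normR3_le.
by rewrite (le_trans h1 ha) (le_trans h2 ha) (le_trans h3 hb).
Qed.

Lemma cutoff0 a b p : 0 < a -> 0 < b -> ~~ inbox (2 * a) (2 * b) p -> cutoff a b p = 0.
Proof.
move=> a0 b0; rewrite /inbox /cutoff -!normV_le // !negb_and -!ltNge => /or3P[] /ltW/plateau0 ->.
- by rewrite !mul0r.
- by rewrite mulr0 mul0r.
- by rewrite mulr0.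
Qed.

(** The last clause holds because [r < a] forces both horizontal coordinates into the region where
    the plateau is flat. Horizontal derivatives of the cutoff thus occur only for [r >= a], where
    [omega <= a^-2]. *)
Lemma cutoff_derive : exists2 C, 0 < C & forall a b, 0 < a -> 0 < b ->
  [/\ forall p, `|pd e0 (cutoff a b) p| <= C / a, forall p, `|pd e1 (cutoff a b) p| <= C / a,
    forall p, `|pd e2 (cutoff a b) p| <= C / b,
    forall i p, ~~ inbox (2 * a) (2 * b) p -> pd i (cutoff a b) p = 0 &
    forall p, coord3 e0 p ^+ 2 + coord3 e1 p ^+ 2 < a ^+ 2 ->
      pd e0 (cutoff a b) p = 0 /\ pd e1 (cutoff a b) p = 0].
Proof.
have [dX [C C0 [hX XC X1 X2]]] := plateau_derive.
exists C => // a b a0 b0.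
have d i j d p : is_derive p (basis3 i) (fun q => plateau (d * coord3 j q)) ((j == i)%:R * (d * dX (d * coord3 j p))).
  have h0 : is_derive p (basis3 i) (fun q => d * coord3 j q) (0 * coord3 j p + d * coord3 j (basis3 i)).
    exact: (is_deriveMf (is_derive_cst d p (basis3 i)) (is_derive_coord3 j p (basis3 i))).
  apply: (is_derive_eq (is_derive_compf h0 (hX _))).
  by rewrite coord3_basis mul0r add0r mulrCA mulrA mulrC mulrA.
have D i p : pd i (cutoff a b) p =
   (e0 == i)%:R * (a^-1 * dX (a^-1 * coord3 e0 p)) * plateau (a^-1 * coord3 e1 p) * plateau (b^-1 * coord3 e2 p)
   + plateau (a^-1 * coord3 e0 p) * ((e1 == i)%:R * (a^-1 * dX (a^-1 * coord3 e1 p))) * plateau (b^-1 * coord3 e2 p)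
   + plateau (a^-1 * coord3 e0 p) * plateau (a^-1 * coord3 e1 p) * ((e2 == i)%:R * (b^-1 * dX (b^-1 * coord3 e2 p))).
  apply: is_derive_pd.
  apply: (is_derive_eq (is_deriveMf (is_deriveMf (d i e0 a^-1 p) (d i e1 a^-1 p)) (d i e2 b^-1 p))).
  by rewrite mulrDl.
have D0 p : pd e0 (cutoff a b) p = a^-1 * dX (a^-1 * coord3 e0 p) * plateau (a^-1 * coord3 e1 p) * plateau (b^-1 * coord3 e2 p).
  by rewrite D /= !mul1r !mul0r !mulr0 !mul0r !addr0.
have D1 p : pd e1 (cutoff a b) p = plateau (a^-1 * coord3 e0 p) * (a^-1 * dX (a^-1 * coord3 e1 p)) * plateau (b^-1 * coord3 e2 p).
  by rewrite D /= !mul1r !mul0r !mulr0 ?mul0r ?addr0 ?add0r.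
have D2 p : pd e2 (cutoff a b) p = plateau (a^-1 * coord3 e0 p) * plateau (a^-1 * coord3 e1 p) * (b^-1 * dX (b^-1 * coord3 e2 p)).
  by rewrite D /= !mul1r !mul0r !mulr0 ?mul0r ?addr0 ?add0r.
have Xa t : `|plateau t| <= 1 by rewrite ger0_norm ?plateau_ge0 ?plateau_le1.
have XCa e t : 0 < e -> `|e^-1 * dX t| <= C / e.
  by move=> h0; rewrite normrM gtr0_norm ?invr_gt0 // mulrC ler_wpM2r // invr_ge0 ltW.
have prod3 (x y z K : R) : 0 <= K -> `|x| <= K -> `|y| <= 1 -> `|z| <= 1 -> `|x * y * z| <= K.
  by move=> K0 h1 h2 h3; rewrite !normrM -[leRHS]mulr1 ler_pM ?mulr_ge0 // -[leRHS]mulr1 ler_pM.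
have Ca : 0 <= C / a by rewrite divr_ge0 // ltW.
have Cb : 0 <= C / b by rewrite divr_ge0 // ltW.
split.
- by move=> p; rewrite D0; apply: prod3 => //; exact: XCa.
- by move=> p; rewrite D1 (mulrC (plateau (a^-1 * coord3 e0 p))); apply: prod3 => //; exact: XCa.
- by move=> p; rewrite D2 mulrC mulrA; apply: prod3 => //; exact: XCa.
- move=> i p; rewrite /inbox -!normV_le // !negb_and -!ltNge.
  by case/or3P => h; have x0 := plateau0 (ltW h); have dx0 := X2 _ h;
    rewrite D x0 dx0 !(mulr0, mul0r) ?addr0.
- move=> p hp.
  have lt1 (x y : R) : x ^+ 2 + y ^+ 2 < a ^+ 2 -> `|a^-1 * x| < 1.
    move=> h; rewrite normrM gtr0_norm ?invr_gt0 // mulrC ltr_pdivrMr // mul1r.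
    rewrite -(ltr_pXn2r (n := 2)) ?nnegrE ?(ltW a0) // real_normK ?num_real //.
    by rewrite (le_lt_trans _ h) // lerDl sqr_ge0.
  by rewrite D0 D1 !X1 ?mulr0 ?mul0r //; [rewrite addrC in hp|]; apply: lt1 hp.
Qed.

End Plateau.

(** * Energy growth and the decay of the error terms *)

Section Weights.
Context {R : realType}.
Implicit Types (p q : R3 R) (i j : 'I_3).

Local Notation e0 := (@Ordinal 3 0 isT).
Local Notation e1 := (@Ordinal 3 1 isT).
Local Notation e2 := (@Ordinal 3 2 isT).

Lemma onep_sqr_gt0 (x : R) : 0 < 1 + x ^+ 2.
Proof. by rewrite ltr_pwDl // sqr_ge0. Qed.

Definition rsq p : R := coord3 e0 p ^+ 2 + coord3 e1 p ^+ 2.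

Lemma rsq_ge0 p : 0 <= rsq p.
Proof. by rewrite /rsq addr_ge0 // sqr_ge0. Qed.

Lemma onep_rsq_gt0 p : 0 < 1 + rsq p.
Proof. by rewrite ltr_pwDl // rsq_ge0. Qed.

Definition omega p : R := (1 + rsq p)^-1.

Lemma smooth_omega : smooth omega.
Proof.
move=> k; apply: CkV; first by move=> p; rewrite gt_eqF // onep_rsq_gt0.
by apply: CkD; [exact: Ck_cst|apply: CkD; apply: CkX; exact: Ck_coord3].
Qed.

Lemma is_derive_coord3_sqr i j p : is_derive p (basis3 i) (fun q => coord3 j q ^+ 2) (2 * coord3 j p * (j == i)%:R).
Proof.
have h := is_derive_coord3 j p (basis3 i).
have -> : (fun q => coord3 j q ^+ 2) = (fun q => coord3 j q * coord3 j q) by apply/funext => q; rewrite expr2.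
apply: (is_derive_eq (is_deriveMf h h)); rewrite coord3_basis; ring.
Qed.

Lemma pd_omega i p : pd i omega p =
  - (2 * (coord3 e0 p * (e0 == i)%:R + coord3 e1 p * (e1 == i)%:R) * omega p ^+ 2).
Proof.
apply: is_derive_pd; rewrite /omega exprVn mulrDr !mulrA.
apply: is_deriveVf; first by rewrite gt_eqF // onep_rsq_gt0.
have h := is_deriveDf (is_derive_cst (1 : R) p (basis3 i))
  (is_deriveDf (is_derive_coord3_sqr i e0 p) (is_derive_coord3_sqr i e1 p)).
by rewrite add0r in h.
Qed.

(* A majorant of [omega] that is a derivative (of [atan x1]), so that its integral
   against a cutoff can be estimated by parts. *)
Definition invx p : R := (1 + coord3 e0 p ^+ 2)^-1.

Lemma smooth_invx : smooth invx.
Proof.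
move=> k; apply: CkV; first by move=> p; rewrite gt_eqF // onep_sqr_gt0.
by apply: CkD; [exact: Ck_cst|apply: CkX; exact: Ck_coord3].
Qed.

Lemma pd_invx i p : pd i invx p = - (2 * coord3 e0 p * (e0 == i)%:R * invx p ^+ 2).
Proof.
apply: is_derive_pd; rewrite /invx exprVn.
apply: is_deriveVf; first by rewrite gt_eqF // onep_sqr_gt0.
have h := is_deriveDf (is_derive_cst (1 : R) p (basis3 i)) (is_derive_coord3_sqr i e0 p).
by rewrite add0r in h.
Qed.

Lemma invx_gt0 p : 0 < invx p.
Proof. by rewrite invr_gt0 onep_sqr_gt0. Qed.

Lemma omega_gt0 p : 0 < omega p.
Proof. by rewrite invr_gt0 onep_rsq_gt0. Qed.

Lemma omega_le_invx p : omega p <= invx p.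
Proof.
rewrite /omega /invx lef_pV2 ?posrE ?onep_rsq_gt0 ?onep_sqr_gt0 //.
by rewrite lerD2l /rsq lerDl sqr_ge0.
Qed.

Lemma omega_rsq p : omega p * (1 + rsq p) = 1.
Proof. by rewrite mulVf // gt_eqF // onep_rsq_gt0. Qed.

(** This is [2 |x| <= 1 + x^2]. A weight whose derivatives it dominates itself can be inserted in a
    Caccioppoli estimate at the cost of a constant. *)
Lemma pd_invx_le i p : `|pd i invx p| <= invx p.
Proof.
rewrite pd_invx normrN expr2 mulrA normrM (gtr0_norm (invx_gt0 p)) -[leRHS]mul1r.
apply: ler_wpM2r; first exact: ltW (invx_gt0 p).
have h : `|2 * coord3 e0 p * (e0 == i)%:R| <= 1 + coord3 e0 p ^+ 2.
  apply: (@le_trans _ _ `|2 * coord3 e0 p|).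
    by rewrite normrM ler_piMr //; case: (e0 == i); rewrite ?normr0 ?normr1.
  rewrite normrM (@ger0_norm _ 2) // -[_ ^+ 2]real_normK ?num_real //.
  by have := sqr_ge0 (1 - `|coord3 e0 p|); rewrite sqrrB expr1n mul1r; clear; lra.
by rewrite normrM (gtr0_norm (invx_gt0 p)) /invx ler_pdivrMr ?onep_sqr_gt0 // mul1r.
Qed.

Lemma normr_atan_le2 (x : R) : `|atan x| <= 2.
Proof.
rewrite ler_norml; have := atan_gtNpi2 x; have := atan_ltpi2 x.
by have := @pihalf_lt2 R; move: (pi / 2) (atan _) => y z; clear; lra.
Qed.

Lemma geom_omega chi p : Ck 1 chi ->
  geom (fun q => omega q * chi q) p = - (4 * rsq p * omega p ^+ 4 * chi p ^+ 2)
  + (2 * omega p ^+ 3 * (1 - rsq p) * chi p * (coord3 e0 p * pd e0 chi p + coord3 e1 p * pd e1 chi p)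
  + rsq p * omega p ^+ 2 * (pd e0 chi p ^+ 2 + pd e1 chi p ^+ 2 + pd e2 chi p ^+ 2)).
Proof.
move=> hc; have ho : Ck 1 omega := smooth_omega 1.
rewrite /geom !pdM // !pd_omega /=.
have : omega p * (1 + rsq p) = 1 := omega_rsq p.
rewrite /rsq; move: (omega p) (coord3 e0 p) (coord3 e1 p) (chi p) => w x y c.
move: (pd e0 chi p) (pd e1 chi p) (pd e2 chi p) => c0 c1 c2 hw.
rewrite !(mulr0, mulr1, mul0r, oppr0, addr0, add0r).
(* With [w (1 + r^2) = 1] one has [w - w^2 r^2 = w^2] and [w - 2 w^2 r^2 = w^2 (1 - r^2)]; [E1]
   groups the terms so that exactly these two factors appear. *)
have hw' : w = w * w * (1 + (x ^+ 2 + y ^+ 2)) by rewrite -mulrA hw mulr1.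
have E1 : 2 * (w * c) * (x * (- (2 * x * w ^+ 2) * c + w * c0) + y * (- (2 * y * w ^+ 2) * c + w * c1))
  + (x ^+ 2 + y ^+ 2) * ((- (2 * x * w ^+ 2) * c + w * c0) ^+ 2 + (- (2 * y * w ^+ 2) * c + w * c1) ^+ 2 + (w * c2) ^+ 2)
  = - 4 * (x ^+ 2 + y ^+ 2) * c ^+ 2 * w ^+ 2 * (w - w ^+ 2 * (x ^+ 2 + y ^+ 2))
    + 2 * w * c * (x * c0 + y * c1) * (w - 2 * w ^+ 2 * (x ^+ 2 + y ^+ 2))
    + (x ^+ 2 + y ^+ 2) * w ^+ 2 * (c0 ^+ 2 + c1 ^+ 2 + c2 ^+ 2) by ring.
rewrite E1.
have -> : w - w ^+ 2 * (x ^+ 2 + y ^+ 2) = w ^+ 2 by rewrite {1}hw'; ring.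
have -> : w - 2 * w ^+ 2 * (x ^+ 2 + y ^+ 2) = w ^+ 2 * (1 - (x ^+ 2 + y ^+ 2)) by rewrite {1}hw'; ring.
by ring.
Qed.

End Weights.

(** * Weighted Caccioppoli estimate and energy growth *)

Section Estimates.
Context {R : realType}.
Variables (u F c : R3 R -> R) (M : R).
Hypothesis hu : Ck 2 u.
Hypothesis hF : forall p, laplacian u p = F p.
Hypothesis dF : forall i p, is_derive p (basis3 i) F (c p * pd i u p).
Hypothesis u_le1 : forall p, `|u p| <= 1.
Hypothesis F_leM : forall p, `|F p| <= M.

Local Notation e0 := (@Ordinal 3 0 isT).
Local Notation e1 := (@Ordinal 3 1 isT).
Local Notation e2 := (@Ordinal 3 2 isT).

(** The integrand is the divergence of [u w grad u], with the Laplacian replaced by [F]. *)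
Lemma caccioppoli_identity w L : Ck 1 w -> vanish L w -> continuous F ->
  Int (fun p => grad_sq u p * w p + (u p * F p * w p
    + u p * (pd e0 u p * pd e0 w p + pd e1 u p * pd e1 w p + pd e2 u p * pd e2 w p))) = 0.
Proof.
move=> hw w0 cF; have hu1 : Ck 1 u := Ck_mono hu.
pose B i p := u p * (pd i u p * w p).
have hB i : Ck 1 (B i) by apply: CkM => //; apply: CkM => //; exact: Ck_pd.
have B0 i : vanish L (B i) by move=> p hp; rewrite /B w0 // !mulr0.
have dB i p : pd i (B i) p = pd i u p * (pd i u p * w p) + u p * (pd i (pd i u) p * w p + pd i u p * pd i w p).
  apply: is_derive_pd.
  exact: (is_deriveMf (Ck_is_derive_pd i p hu1) (is_deriveMf (Ck_is_derive_pd i p (Ck_pd i hu)) (Ck_is_derive_pd i p hw))).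
have -> : (fun p => grad_sq u p * w p + (u p * F p * w p
    + u p * (pd e0 u p * pd e0 w p + pd e1 u p * pd e1 w p + pd e2 u p * pd e2 w p)))
   = (fun p => pd e0 (B e0) p + (pd e1 (B e1) p + pd e2 (B e2) p)).
  apply/funext => p; rewrite !dB -hF laplacianE grad_sqE.
  move: (pd e0 (pd e0 u) p) (pd e1 (pd e1 u) p) (pd e2 (pd e2 u) p) (pd e0 u p) (pd e1 u p) (pd e2 u p).
  move: (pd e0 w p) (pd e1 w p) (pd e2 w p) (u p) (w p) => w0' w1 w2 up wp a0 a1 a2 u0 u1 u2.
  by ring.
have cd i : continuous (pd i (B i)) by exact: (Ck_continuous (Ck_pd i (hB i))).
have vd i : vanish L (pd i (B i)) by exact: vanish_pd.
rewrite (IntD (L := L)) //; last 2 first.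
- exact: continuousDf.
- by move=> p hp; rewrite !vd // addr0.
by rewrite (IntD (L := L)) // !(Int_pd _ (hB _) (B0 _)) !addr0.
Qed.

(** Here [g] is the weight, varying in the first direction only, and [t] the cutoff. Each derivative
    of [g t^2] is at most [g t (1 + 2 K)], and the perfect square [g (|u_i| t - (1 + 2 K))^2 >= 0]
    absorbs half of the gradient term. The three directions give [3 (1 + 2 K)^2], and the source
    gives [2 M]. *)
Lemma caccioppoli_pointwise (up Fp g t K u0 u1 u2 g0 t0 t1 t2 : R) :
  `|up| <= 1 -> `|Fp| <= M -> 0 <= g -> `|g0| <= g -> 0 <= t -> t <= 1 -> 0 <= K ->
  `|t0| <= K -> `|t1| <= K -> `|t2| <= K ->
  (u0 ^+ 2 + u1 ^+ 2 + u2 ^+ 2) * (g * t ^+ 2) <=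
  2 * ((u0 ^+ 2 + u1 ^+ 2 + u2 ^+ 2) * (g * t ^+ 2) + (up * Fp * (g * t ^+ 2)
    + up * (u0 * (g0 * t ^+ 2 + g * (2 * t * t0)) + u1 * (g * (2 * t * t1)) + u2 * (g * (2 * t * t2)))))
  + (2 * M + 3 * (1 + 2 * K) ^+ 2) * g.
Proof.
move=> hup hFp g_ge0 hg0 t_ge0 t_le1 K0 ht0 ht1 ht2.
have h1 : - (up * Fp * (g * t ^+ 2)) <= M * g.
  apply: (le_trans (ler_norm _)); rewrite normrN 3!normrM (ger0_norm g_ge0) normrX (ger0_norm t_ge0).
  rewrite -[M]mul1r ler_pM ?mulr_ge0 ?exprn_ge0 //.
    by rewrite ler_pM.
  by rewrite ler_piMr // exprn_ile1.
have h2 (a s : R) : `|s| <= g * t * (1 + 2 * K) -> - (2 * (up * (a * s))) <= a ^+ 2 * (g * t ^+ 2) + (1 + 2 * K) ^+ 2 * g.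
  move=> hs; apply: (le_trans (ler_norm _)); rewrite normrN 3!normrM (@ger0_norm _ 2) //.
  apply: (@le_trans _ _ (2 * (1 * (`|a| * (g * t * (1 + 2 * K)))))).
    by rewrite ler_wpM2l // ler_pM ?mulr_ge0 // ler_wpM2l.
  rewrite -[a ^+ 2]real_normK ?num_real // -subr_ge0.
  have -> : `|a| ^+ 2 * (g * t ^+ 2) + (1 + 2 * K) ^+ 2 * g - 2 * (1 * (`|a| * (g * t * (1 + 2 * K)))) =
     g * (`|a| * t - (1 + 2 * K)) ^+ 2 by ring.
  by rewrite mulr_ge0 // sqr_ge0.
have tK (x : R) : `|x| <= K -> `|g * (2 * t * x)| <= g * t * (2 * K).
  move=> hx; rewrite 3!normrM (ger0_norm g_ge0) (ger0_norm t_ge0) (@ger0_norm _ 2) //.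
  by rewrite -!mulrA ler_wpM2l // mulrCA ler_wpM2l // ler_wpM2l.
have gt0 : 0 <= g * t by rewrite mulr_ge0.
have s1 : `|g * (2 * t * t1)| <= g * t * (1 + 2 * K).
  by apply: (le_trans (tK _ ht1)); rewrite ler_wpM2l // lerDr.
have s2 : `|g * (2 * t * t2)| <= g * t * (1 + 2 * K).
  by apply: (le_trans (tK _ ht2)); rewrite ler_wpM2l // lerDr.
have s0 : `|g0 * t ^+ 2 + g * (2 * t * t0)| <= g * t * (1 + 2 * K).
  apply: (le_trans (ler_normD _ _)); rewrite [leRHS]mulrDr mulr1 lerD ?tK //.
  rewrite normrM normrX (ger0_norm t_ge0) ler_pM ?exprn_ge0 // expr2 ler_piMr //.
have := h2 u0 _ s0; have := h2 u1 _ s1; have := h2 u2 _ s2; move: h1; clear.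
set a := up * Fp * _; set b0 := g0 * _ + _; set b1 := g * (2 * t * t1); set b2 := g * (2 * t * t2).
set gt := g * t ^+ 2; set k := (1 + 2 * K) ^+ 2.
have -> : up * (u0 * b0 + u1 * b1 + u2 * b2) = up * (u0 * b0) + up * (u1 * b1) + up * (u2 * b2) by ring.
have -> : (2 * M + 3 * k) * g = 2 * (M * g) + 3 * (k * g) by ring.
have -> : (u0 ^+ 2 + u1 ^+ 2 + u2 ^+ 2) * gt = u0 ^+ 2 * gt + u1 ^+ 2 * gt + u2 ^+ 2 * gt by ring.
move: (up * (u0 * b0)) (up * (u1 * b1)) (up * (u2 * b2)) (u0 ^+ 2 * gt) (u1 ^+ 2 * gt) (u2 ^+ 2 * gt) (k * g) (M * g).
by move=> x0 x1 x2 y0 y1 y2 kg Mg; lra.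
Qed.

Hypothesis cF : continuous F.

Lemma M_ge0 : 0 <= M.
Proof. exact: le_trans (F_leM 0). Qed.

Lemma Int_cutoff_le a b (f : R3 R -> R) K : 0 < a -> 0 < b -> 0 <= K -> continuous f ->
  (forall p, f p <= K) -> (forall p, ~~ inbox (2 * a) (2 * b) p -> f p = 0) ->
  Int f <= K * (64 * a ^+ 2 * b).
Proof.
move=> a0 b0 K0 cf fK f0.
pose L := Num.max (2 * a) (2 * b).
have vf : vanish L f.
  by move=> p hp; apply: f0; apply: vanish_inbox hp; rewrite /L le_max lexx ?orbT.
have -> : 64 * a ^+ 2 * b = 8 * (2 * a) * (2 * a) * (2 * b) by ring.
apply: (Int_brick_le cf vf) => //; try by rewrite mulr_ge0 // ltW.
move=> p hp; apply: f0; apply/negP => /and3P[h1 h2 h3]; apply: hp.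
by rewrite /brick; split; [split|]; rewrite /= in_itv /= -ler_norml.
Qed.

(** Since [invx] is the derivative of [atan x1], integration by parts moves the derivative to the
    cutoff. The bounds 2 for [atan], [C / a] for the derivative and [64 a^2 b] for the volume
    multiply to [128 C a b]. *)
Lemma Int_invx_cutoff_le : exists2 K : R, 0 <= K & forall a b : R, 0 < a -> 0 < b ->
  Int (fun p => invx p * cutoff a b p) <= K * (a * b).
Proof.
have [C C0 hC] := @cutoff_derive R.
exists (128 * C); first by rewrite mulr_ge0 // ltW.
move=> a b a0 b0; have [h0 _ _ hi _] := hC a b a0 b0.
pose At (p : R3 R) : R := atan (coord3 e0 p).
have dAt i p : is_derive p (basis3 i) At ((e0 == i)%:R * invx p).
  by apply: is_derive_comp_coord3; exact: is_derive1_atan.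
have cAt : continuous At.
  by apply: continuous_compf; [exact: coord3_continuous|move=> x; exact: continuous_atan].
have hAt : Ck 1 At.
  apply: (@CkS_intro _ _ _ (fun i p => (e0 == i)%:R * invx p)) => // i.
  by apply: CkZ; exact: (smooth_invx 0).
have hY : Ck 1 (cutoff a b) := smooth_cutoff a b 1.
have hH : Ck 1 (fun p => At p * cutoff a b p) by exact: CkM.
pose L := Num.max (2 * a) (2 * b).
have out p : L < `|p| -> ~~ inbox (2 * a) (2 * b) p.
  by move=> hp; apply: vanish_inbox hp; rewrite /L le_max lexx ?orbT.
have vY : vanish L (cutoff a b) by move=> p /out; exact: cutoff0.
have vdY : vanish L (pd e0 (cutoff a b)) by move=> p /out; exact: hi.
have vH : vanish L (fun p => At p * cutoff a b p) by move=> p hp; rewrite vY // mulr0.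
have cY : continuous (cutoff a b) := Ck_continuous hY.
have cdY : continuous (pd e0 (cutoff a b)) := Ck_continuous (Ck_pd e0 hY).
have cinv : continuous (@invx R) := Ck_continuous (smooth_invx 0).
have := Int_pd e0 hH vH.
have -> : pd e0 (fun p => At p * cutoff a b p) = (fun p => invx p * cutoff a b p - (- (At p * pd e0 (cutoff a b) p))).
  apply/funext => p; rewrite opprK; apply: is_derive_pd.
  have h := is_deriveMf (dAt e0 p) (Ck_is_derive_pd e0 p hY).
  by rewrite /= mul1r in h.
have cX : continuous (fun p => invx p * cutoff a b p) by exact: continuousMf.
have cZ : continuous (fun p => - (At p * pd e0 (cutoff a b) p)).
  by apply: continuousNf; exact: continuousMf.
rewrite (IntB (L := L)) //; last 2 first.
- by move=> p hp; rewrite vY // mulr0.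
- by move=> p hp; rewrite vdY // mulr0 oppr0.
move/eqP; rewrite subr_eq0 => /eqP ->.
have -> : 128 * C * (a * b) = (2 * (C / a)) * (64 * a ^+ 2 * b).
  by field; rewrite gt_eqF.
apply: Int_cutoff_le => //.
- by rewrite mulr_ge0 // divr_ge0 // ltW.
- move=> p; apply: (le_trans (ler_norm _)); rewrite normrN normrM ler_pM //.
  exact: normr_atan_le2.
- by move=> p hp; rewrite hi // mulr0 oppr0.
Qed.

(** Majorant of [r^2 omega^2 |grad chi|^2] up to a constant. Horizontally, [omega] and the squared
    derivative contribute [a^-2] each; vertically, the squared derivative gives [b^-2] and [omega]
    is replaced by [invx]. *)
Definition error_weight (a b : R) (p : R3 R) : R := a ^- 4 + b ^- 2 * invx p.

Lemma error_weight_gt0 a b p : 0 < a -> 0 < b -> 0 < error_weight a b p.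
Proof.
move=> a0 b0; rewrite /error_weight addr_gt0 ?mulr_gt0 ?invx_gt0 ?invr_gt0 ?exprn_gt0 //.
Qed.

Lemma pd_error_weight_le a b i p : 0 < a -> 0 < b -> `|pd i (error_weight a b) p| <= error_weight a b p.
Proof.
move=> a0 b0.
have -> : pd i (error_weight a b) p = b ^- 2 * pd i (@invx R) p.
  apply: is_derive_pd.
  have h := is_deriveDf (is_derive_cst (a ^- 4) p (basis3 i))
     (is_deriveMf (is_derive_cst (b ^- 2) p (basis3 i)) (Ck_is_derive_pd i p (smooth_invx 1))).
  by rewrite add0r mul0r add0r in h.
have b2 : 0 <= b ^- 2 by rewrite invr_ge0 exprn_ge0 // ltW.
rewrite normrM (ger0_norm b2) (le_trans (ler_wpM2l b2 (pd_invx_le i p))) // /error_weight lerDr.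
by rewrite invr_ge0 exprn_ge0 // ltW.
Qed.

Lemma pd_error_weight_eq0 a b i p : e0 != i -> pd i (error_weight a b) p = 0.
Proof.
move=> hi; apply: is_derive_pd.
have h := is_deriveDf (is_derive_cst (a ^- 4) p (basis3 i))
   (is_deriveMf (is_derive_cst (b ^- 2) p (basis3 i)) (Ck_is_derive_pd i p (smooth_invx 1))).
by rewrite add0r mul0r add0r pd_invx (negPf hi) !mulr0 mul0r oppr0 mulr0 in h.
Qed.

Lemma smooth_error_weight a b : smooth (error_weight a b).
Proof. by move=> k; apply: CkD; [exact: Ck_cst|apply: CkZ; exact: smooth_invx]. Qed.

(** The weighted energy is bounded by the integral of the weight itself over a comparable box:
    [a^-4] times the volume [a^2 b], plus [b^-2] times the bound [a b] for [invx]. *)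
Lemma energy_growth : exists2 K : R, 0 <= K & forall a b : R, 1 <= a -> 1 <= b ->
  Int (fun p => grad_sq u p * (error_weight a b p * cutoff a b p ^+ 2)) <= K * (b / a ^+ 2 + a / b).
Proof.
have [C C0 hC] := @cutoff_derive R; have [K1 K10 hK1] := Int_invx_cutoff_le.
pose D := 2 * M + 3 * (1 + 2 * C) ^+ 2.
have D0 : 0 <= D by exact: (addr_ge0 (mulr_ge0 (ler0n _ 2) M_ge0) (mulr_ge0 (ler0n _ 3) (sqr_ge0 _))).
exists (D * (512 + 4 * K1)).
  exact: (mulr_ge0 D0 (addr_ge0 (ler0n _ 512) (mulr_ge0 (ler0n _ 4) K10))).
move=> a b a1 b1; have a0 : 0 < a by rewrite (lt_le_trans _ a1). have b0 : 0 < b by rewrite (lt_le_trans _ b1).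
have [h0 h1 h2 hi _] := hC a b a0 b0.
pose w p := error_weight a b p * cutoff a b p ^+ 2.
(* The cutoff at the doubled scales equals 1 on the support of the first one and serves as a smooth
   substitute for its indicator. *)
pose A := 2 * a; pose B := 2 * b.
have A0 : 0 < A by rewrite mulr_gt0. have B0 : 0 < B by rewrite mulr_gt0.
pose L := Num.max (2 * A) (2 * B).
have outL p : L < `|p| -> ~~ inbox (2 * A) (2 * B) p.
  by move=> hp; apply: vanish_inbox hp; rewrite /L le_max lexx ?orbT.
have dbl (x : R) : 0 < x -> 2 * x <= 2 * (2 * x).
  by move=> x0; rewrite ler_pM2l // ler_peMl ?ler1n // ltW.
have out p : L < `|p| -> ~~ inbox (2 * a) (2 * b) p.
  move=> hp; apply: vanish_inbox hp; rewrite /L /A /B le_max; apply/orP; [left|right].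
    exact: dbl.
  exact: dbl.
have hw : Ck 1 w by apply: CkM; [exact: smooth_error_weight|apply: CkX; exact: smooth_cutoff].
have vY : vanish L (cutoff a b) by move=> p /out; exact: cutoff0.
have w0 : vanish L w by move=> p hp; rewrite /w vY // expr0n /= mulr0.
have vY4 : vanish L (cutoff A B) by move=> p /outL; exact: cutoff0.
have Q0 := caccioppoli_identity hw w0 cF.
set Q := (fun p => _) in Q0.
have cu : continuous u := Ck_continuous hu.
have cdu i : continuous (pd i u) := Ck_continuous (Ck_pd i hu).
have cdw i : continuous (pd i w) := Ck_continuous (Ck_pd i hw).
have cw : continuous w := Ck_continuous hw.
have cgrad : continuous (grad_sq u).
  rewrite (_ : grad_sq u = (fun p => pd e0 u p ^+ 2 + pd e1 u p ^+ 2 + pd e2 u p ^+ 2)).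
    by cont.
  by apply/funext => p; rewrite grad_sqE.
have cQ : continuous Q by rewrite /Q; cont.
have vQ : vanish L Q.
  by move=> p hp; rewrite /Q !(vanish_pd _ w0 hp) (w0 p hp) !mulr0 !addr0 mulr0 !addr0.
have cW : continuous (error_weight a b) := Ck_continuous (smooth_error_weight a b 0).
have cY : continuous (cutoff A B) := Ck_continuous (smooth_cutoff A B 0).
pose Z p := D * (error_weight a b p * cutoff A B p).
have cWY : continuous (fun p => error_weight a b p * cutoff A B p) by exact: continuousMf.
have vWY : vanish L (fun p => error_weight a b p * cutoff A B p) by move=> p hp; rewrite vY4 // mulr0.
have cZ : continuous Z by apply: continuousMf => // p; exact: cvg_cst.
have vZ : vanish L Z by move=> p hp; rewrite /Z vY4 // !mulr0.
have c2Q : continuous (fun p => 2 * Q p) by apply: continuousMf => // p; exact: cvg_cst.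
have v2Q : vanish L (fun p => 2 * Q p) by move=> p hp; rewrite vQ // mulr0.
have step1 : Int (fun p => grad_sq u p * w p) <= Int (fun p => 2 * Q p + Z p).
  apply: (le_Int (L := L)).
  - exact: continuousMf.
  - exact: continuousDf.
  - by move=> p hp; rewrite w0 // mulr0.
  - by move=> p hp; rewrite v2Q // vZ // addr0.
  move=> p.
  have hY : Ck 1 (cutoff a b) := smooth_cutoff a b 1.
  have dw i : pd i w p = pd i (error_weight a b) p * cutoff a b p ^+ 2 + error_weight a b p * (2 * cutoff a b p * pd i (cutoff a b) p).
    rewrite /w pdM; [|exact: smooth_error_weight|exact: CkX].
    rewrite (_ : (fun q => cutoff a b q ^+ 2) = (fun q => cutoff a b q * cutoff a b q)); last by apply/funext => q; rewrite expr2.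
    rewrite (pdM i p hY hY).
    move: (pd i (error_weight a b) p) (error_weight a b p) (cutoff a b p) (pd i (cutoff a b) p) => x y z t; ring.
  have [pin|pout] := boolP (inbox (2 * a) (2 * b) p); last first.
    have c0 := cutoff0 a0 b0 pout.
    have wp0 : w p = 0 by rewrite /w c0 expr0n /= mulr0.
    have dw0 i : pd i w p = 0 by rewrite dw c0 expr0n /= !(mulr0, mul0r) addr0.
    rewrite /Q wp0 !dw0 !(mulr0, addr0, add0r) /Z.
    exact: (mulr_ge0 D0 (mulr_ge0 (ltW (error_weight_gt0 p a0 b0)) (cutoff_ge0 A B p))).
  have cp1 : cutoff A B p = 1 by apply: cutoff1.
  have Ca : C / a <= C by rewrite ler_pdivrMr // ler_peMr // ltW.
  have Cb : C / b <= C by rewrite ler_pdivrMr // ler_peMr // ltW.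
  have := @caccioppoli_pointwise (u p) (F p) (error_weight a b p) (cutoff a b p) C (pd e0 u p) (pd e1 u p) (pd e2 u p)
    (pd e0 (error_weight a b) p) (pd e0 (cutoff a b) p) (pd e1 (cutoff a b) p) (pd e2 (cutoff a b) p)
    (u_le1 p) (F_leM p) (ltW (error_weight_gt0 p a0 b0)) (pd_error_weight_le e0 p a0 b0) (cutoff_ge0 a b p) (cutoff_le1 a b p)
    (ltW C0) (le_trans (h0 p) Ca) (le_trans (h1 p) Ca) (le_trans (h2 p) Cb).
  rewrite /Q /Z cp1 mulr1 !dw (@pd_error_weight_eq0 a b e1) // (@pd_error_weight_eq0 a b e2) // !mul0r !add0r.
  by rewrite grad_sqE.
apply: (le_trans step1).
rewrite (IntD (L := L)) // (IntZ 2 cQ vQ) Q0 mulr0 add0r /Z (IntZ D cWY vWY) -mulrA ler_wpM2l //.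
have cI : continuous (fun p => b ^- 2 * (invx p * cutoff A B p)).
  apply: continuousMf; first by move=> p; exact: cvg_cst.
  by apply: continuousMf => //; exact: (Ck_continuous (smooth_invx 0)).
have vI : vanish L (fun p => b ^- 2 * (invx p * cutoff A B p)).
  by move=> p hp; rewrite vY4 // !mulr0.
have -> : (fun p => error_weight a b p * cutoff A B p) =
   (fun p => a ^- 4 * cutoff A B p + b ^- 2 * (invx p * cutoff A B p)).
  by apply/funext => p; rewrite /error_weight; move: (a ^- 4) (b ^- 2) (invx p) (cutoff A B p) => x y z t; ring.
have cA : continuous (fun p => a ^- 4 * cutoff A B p) by apply: continuousMf => // p; exact: cvg_cst.
have vA : vanish L (fun p => a ^- 4 * cutoff A B p) by move=> p hp; rewrite vY4 // mulr0.
rewrite (IntD (L := L)) // (IntZ _ cY vY4).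
rewrite (IntZ (b ^- 2) (L := L)); [| |by move=> p hp; rewrite vY4 // mulr0]; last first.
  by apply: continuousMf => //; exact: (Ck_continuous (smooth_invx 0)).
have i1 : Int (cutoff A B) <= 1 * (64 * A ^+ 2 * B).
  apply: Int_cutoff_le => //; [exact: cutoff_le1|move=> p; exact: cutoff0].
have i2 := hK1 A B A0 B0.
have a4 : 0 <= a ^- 4 by rewrite invr_ge0 exprn_ge0 // ltW.
have b2 : 0 <= b ^- 2 by rewrite invr_ge0 exprn_ge0 // ltW.
apply: (le_trans (lerD (ler_wpM2l a4 i1) (ler_wpM2l b2 i2))).
have -> : a ^- 4 * (1 * (64 * A ^+ 2 * B)) = 512 * (b / a ^+ 2).
  by rewrite /A /B; field; rewrite gt_eqF.
have -> : b ^- 2 * (K1 * (A * B)) = 4 * K1 * (a / b).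
  by rewrite /A /B; field; rewrite gt_eqF.
have x0 : 0 <= b / a ^+ 2 by rewrite divr_ge0 ?exprn_ge0 // ltW.
have y0 : 0 <= a / b by rewrite divr_ge0 // ltW.
have k1 : 0 <= 4 * K1 by rewrite mulr_ge0.
have s1 : 512 <= 512 + 4 * K1 by rewrite lerDl.
have s2 : 4 * K1 <= 512 + 4 * K1 by rewrite lerDr ler0n.
rewrite [leRHS]mulrDr; exact: (lerD (ler_wpM2r x0 s1) (ler_wpM2r y0 s2)).
Qed.

End Estimates.

(** * Pointwise bound of the errors caused by the cutoff *)

Section ErrorTerm.
Context {R : realType}.

Local Notation e0 := (@Ordinal 3 0 isT).
Local Notation e1 := (@Ordinal 3 1 isT).
Local Notation e2 := (@Ordinal 3 2 isT).

Definition geom_error (chi : R3 R -> R) p :=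
  2 * omega p ^+ 3 * (1 - rsq p) * chi p * (coord3 e0 p * pd e0 chi p + coord3 e1 p * pd e1 chi p)
  + rsq p * omega p ^+ 2 * (pd e0 chi p ^+ 2 + pd e1 chi p ^+ 2 + pd e2 chi p ^+ 2).

Lemma normr_divX_le (C a x : R) n : 0 < a -> `|x| <= C / a -> `|x| ^+ n <= C ^+ n * a ^- n.
Proof.
move=> a0 h; rewrite -exprVn -exprMn.
have Ca : 0 <= C / a := le_trans (normr_ge0 x) h.
by apply: lerXn2r; rewrite ?nnegrE.
Qed.

(** The three powers of [w] are shared out: two give [a^-4], the third bounds [w (1 - r)] by 1. The
    coordinates, of size [2 a], compensate the decay [C / a] of the derivatives. *)
Lemma mixed_error_le (w r x y s c0 c1 C a : R) : 0 < a -> 0 <= w -> 0 <= r -> w * (1 + r) = 1 ->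
  w <= a ^- 2 -> 0 <= s -> s <= 1 ->
  `|x| <= 2 * a -> `|y| <= 2 * a -> `|c0| <= C / a -> `|c1| <= C / a -> 0 <= C ->
  2 * w ^+ 3 * (1 - r) * s * (x * c0 + y * c1) <= 8 * C * a ^- 4.
Proof.
move=> a0 w0 r0 wr wa s0 s1 hx hy h0 h1 C0.
have wr1 : `|w * (1 - r)| <= 1.
  have wrr : 0 <= w * r by exact: mulr_ge0.
  move: wr; rewrite mulrDr mulr1 => wr.
  by rewrite mulrBr mulr1 ler_norml; move: w0 wr wrr; clear; lra.
have prod (t d : R) : `|t| <= 2 * a -> `|d| <= C / a -> `|t * d| <= 2 * C.
  move=> ht hd; rewrite normrM; apply: (le_trans (ler_pM _ _ ht hd)); rewrite ?normr_ge0 //.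
  by rewrite mulrA -[2 * a * C]mulrA (mulrC a) mulrA mulfK // gt_eqF.
have sum4 : `|x * c0 + y * c1| <= 4 * C.
  by apply: (le_trans (ler_normD _ _)); have := prod _ _ hx h0; have := prod _ _ hy h1; clear; lra.
have w2 : w ^+ 2 <= a ^- 4.
  rewrite (_ : a ^- 4 = (a ^- 2) ^+ 2); last by rewrite exprVn -exprM.
  by apply: lerXn2r; rewrite ?nnegrE // invr_ge0 exprn_ge0 // ltW.
rewrite (_ : 2 * w ^+ 3 * (1 - r) * s * (x * c0 + y * c1) =
  2 * (w ^+ 2 * ((w * (1 - r)) * (s * (x * c0 + y * c1))))); last by ring.
apply: (le_trans (ler_norm _)); rewrite normrM (@ger0_norm _ 2) // normrM (ger0_norm (sqr_ge0 w)).
rewrite (_ : 8 * C * a ^- 4 = 2 * (a ^- 4 * (1 * (1 * (4 * C))))); last by ring.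
rewrite ler_pM2l //; apply: ler_pM; rewrite ?sqr_ge0 ?normr_ge0 // normrM.
apply: ler_pM; rewrite ?normr_ge0 // normrM.
by apply: ler_pM; rewrite ?normr_ge0 // ger0_norm.
Qed.

(** For [r < a] only the vertical derivative survives, and [r^2 omega^2 <= omega <= invx]. For
    [r >= a] the bound [omega <= a^-2] is available for the horizontal terms. The constant collects
    the mixed term, [8 C], and the two horizontal squares, [2 C^2]. *)
Lemma geom_error_le : exists2 K : R, 0 <= K & forall a b : R, 0 < a -> 0 < b -> forall p,
  geom_error (cutoff a b) p <= K * (error_weight (2 * a) (2 * b) p * cutoff (2 * a) (2 * b) p ^+ 2).
Proof.
have [C C0 hC] := @cutoff_derive R; have C0' : 0 <= C by exact: ltW.
pose K : R := 8 * C + 2 * C ^+ 2.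
have K0 : 0 <= K by rewrite /K addr_ge0 // mulr_ge0 // ?sqr_ge0.
(* The factor 16 pays for replacing [a^-4] by [(2 a)^-4]; the doubled scales are those at which the
   majorant's cutoff is 1 on the support of the errors. *)
exists (16 * K) => [|a b a0 b0 p]; first exact: (mulr_ge0 (ler0n _ 16) K0).
have [h0 h1 h2 hi hr] := hC a b a0 b0.
have A0 : 0 < 2 * a by rewrite mulr_gt0. have B0 : 0 < 2 * b by rewrite mulr_gt0.
have [pin|pout] := boolP (inbox (2 * a) (2 * b) p); last first.
  rewrite /geom_error !hi // !expr0n /= !mulr0 !addr0 !mulr0 !addr0.
  apply: (mulr_ge0 (mulr_ge0 (ler0n _ 16) K0)); apply: mulr_ge0; last exact: sqr_ge0.
  exact: ltW (error_weight_gt0 p A0 B0).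
rewrite cutoff1 // expr1n mulr1.
have a4 : 0 <= a ^- 4 by rewrite invr_ge0 exprn_ge0 // ltW.
have b2 : 0 <= b ^- 2 by rewrite invr_ge0 exprn_ge0 // ltW.
have g0 := ltW (invx_gt0 p); have w0 := ltW (omega_gt0 p).
have bg : 0 <= b ^- 2 * invx p by exact: mulr_ge0.
apply: (@le_trans _ _ (K * (a ^- 4 + b ^- 2 * invx p))); last first.
  rewrite -mulrA mulrCA ler_wpM2l // /error_weight.
  rewrite (_ : 16 * ((2 * a) ^- 4 + (2 * b) ^- 2 * invx p) = a ^- 4 + 4 * (b ^- 2 * invx p)).
    by rewrite lerD2l ler_peMl // ler1n.
  by field; rewrite !gt_eqF.
have wr := omega_rsq p; have r0 := rsq_ge0 p; have wg := omega_le_invx p.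
have wrr : rsq p * omega p ^+ 2 <= omega p.
  have e : rsq p * omega p <= 1 by move: wr; rewrite mulrDr mulr1 mulrC; move: w0; clear; lra.
  by rewrite expr2 mulrA -[leRHS]mul1r ler_wpM2r.
have wrr0 : 0 <= rsq p * omega p ^+ 2 by rewrite mulr_ge0 // sqr_ge0.
have sqC e t : 0 < e -> `|t| <= C / e -> t ^+ 2 <= C ^+ 2 * e ^- 2.
  by move=> e_gt0 ht; rewrite -(real_normK (num_real t)); exact: normr_divX_le.
have T2 : rsq p * omega p ^+ 2 * pd e2 (cutoff a b) p ^+ 2 <= C ^+ 2 * (b ^- 2 * invx p).
  rewrite (_ : C ^+ 2 * (b ^- 2 * invx p) = invx p * (C ^+ 2 * b ^- 2)); last by ring.
  apply: ler_pM => //; first exact: sqr_ge0.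
    exact: (le_trans wrr wg).
  exact: sqC.
have kb : C ^+ 2 * (b ^- 2 * invx p) <= K * (b ^- 2 * invx p).
  apply: ler_wpM2r => //; rewrite /K; have := sqr_ge0 C; move: C0'; clear; lra.
have [hlt|hge] := ltP (rsq p) (a ^+ 2).
  have [z0 z1] := hr p hlt.
  rewrite /geom_error z0 z1 !mulr0 !addr0 mulr0 !expr0n /= !add0r.
  apply: (le_trans T2); apply: (le_trans kb); apply: ler_wpM2l => //.
  by rewrite lerDr.
have wa : omega p <= a ^- 2.
  rewrite /omega lef_pV2 ?posrE ?onep_rsq_gt0 ?exprn_gt0 //.
  by rewrite (le_trans hge) // lerDr.
have wa4 : rsq p * omega p ^+ 2 <= a ^- 2 by exact: le_trans wrr wa.
have /and3P[x2 y2 _] := pin.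
have T1 := mixed_error_le a0 w0 r0 wr wa (cutoff_ge0 a b p) (cutoff_le1 a b p) x2 y2 (h0 p) (h1 p) C0'.
have T3 t : `|t| <= C / a -> rsq p * omega p ^+ 2 * t ^+ 2 <= C ^+ 2 * a ^- 4.
  move=> ht; rewrite (_ : C ^+ 2 * a ^- 4 = a ^- 2 * (C ^+ 2 * a ^- 2)).
    by apply: ler_pM => //; [exact: sqr_ge0|exact: sqC].
  by field; rewrite gt_eqF.
have := T3 _ (h0 p); have := T3 _ (h1 p); move: T1 T2 kb; rewrite /geom_error.
rewrite !(mulrDr (rsq p * omega p ^+ 2)) (mulrDr K).
rewrite (_ : K * a ^- 4 = 8 * C * a ^- 4 + (C ^+ 2 * a ^- 4 + C ^+ 2 * a ^- 4)); last by rewrite /K; ring.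
move: (2 * omega p ^+ 3 * _ * _ * _) (_ * pd e0 _ p ^+ 2) (_ * pd e1 _ p ^+ 2) (_ * pd e2 _ p ^+ 2).
move: (8 * C * a ^- 4) (C ^+ 2 * a ^- 4) (K * _) (C ^+ 2 * (_ * _)).
by clear; move=> q1 q2 q3 q4 q5 q6 q7 q8; lra.
Qed.

End ErrorTerm.

(** * Vanishing of the horizontal gradient away from the axis *)

Section Liouville.
Context {R : realType}.
Variables (u F c : R3 R -> R) (M : R).
Hypothesis hu : Ck 2 u.
Hypothesis hF : forall p, laplacian u p = F p.
Hypothesis dF : forall i p, is_derive p (basis3 i) F (c p * pd i u p).
Hypothesis cc : continuous c.
Hypothesis u_le1 : forall p, `|u p| <= 1.
Hypothesis F_leM : forall p, `|F p| <= M.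
Hypothesis hstab : forall (phi : R3 R -> R) (L : R), smooth phi -> vanish L phi ->
  0 <= Int (fun p => grad_sq phi p + c p * phi p ^+ 2).
Hypothesis hrot : forall p, coord3 (@Ordinal 3 0 isT) p * pd (@Ordinal 3 1 isT) u p =
  coord3 (@Ordinal 3 1 isT) p * pd (@Ordinal 3 0 isT) u p.

Local Notation e0 := (@Ordinal 3 0 isT).
Local Notation e1 := (@Ordinal 3 1 isT).
Local Notation e2 := (@Ordinal 3 2 isT).

Definition hdensity (a b : R) p := hgrad u p * (4 * rsq p * omega p ^+ 4 * cutoff a b p ^+ 2).

Lemma hgrad_ge0 p : 0 <= hgrad u p.
Proof. by rewrite /hgrad; exact: (addr_ge0 (sqr_ge0 _) (sqr_ge0 _)). Qed.

Lemma hgrad_le_grad_sq p : hgrad u p <= grad_sq u p.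
Proof. by rewrite grad_sqE /hgrad lerDl sqr_ge0. Qed.

Lemma hweight_ge0 (p : R3 R) : 0 <= 4 * rsq p * omega p ^+ 4.
Proof.
exact: (mulr_ge0 (mulr_ge0 (ler0n _ 4) (rsq_ge0 p)) (exprn_ge0 4 (ltW (omega_gt0 p)))).
Qed.

Lemma hdensity_ge0 a b p : 0 <= hdensity a b p.
Proof. exact: (mulr_ge0 (hgrad_ge0 p) (mulr_ge0 (hweight_ge0 p) (sqr_ge0 _))). Qed.

Lemma continuous_hgrad : continuous (hgrad u).
Proof. by rewrite /hgrad; cont. Qed.

Lemma continuous_geom (xi : R3 R -> R) : Ck 1 xi -> continuous (geom xi).
Proof.
move=> hxi; have cxi : continuous xi := Ck_continuous hxi.
have cd i : continuous (pd i xi) := Ck_continuous (Ck_pd i hxi).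
have cx i : continuous (@coord3 R i) by exact: coord3_continuous.
have csum i : continuous (fun p => coord3 i p * pd i xi p) by exact: continuousMf.
have csq (f : R3 R -> R) : continuous f -> continuous (fun p => f p ^+ 2) by move=> h; exact: continuousXf.
apply: continuousDf; apply: continuousMf.
- by apply: continuousMf => // p; exact: cvg_cst.
- by apply: continuousDf; exact: csum.
- by apply: continuousDf; exact: csq.
- by apply: continuousDf; [apply: continuousDf|]; exact: csq.
Qed.

Lemma continuous_hdensity a b : continuous (hdensity a b).
Proof.
have h : Ck 0 (fun p : R3 R => 4 * rsq p * omega p ^+ 4 * cutoff a b p ^+ 2).
  apply: CkM; last by apply: CkX; exact: smooth_cutoff.
  apply: CkM; last by apply: CkX; exact: smooth_omega.
  by apply: CkZ; apply: CkD; apply: CkX; exact: Ck_coord3.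
exact: (continuousMf continuous_hgrad (Ck_continuous h)).
Qed.

Lemma vanish_cutoff (a b : R) : 0 < a -> 0 < b -> vanish (Num.max (2 * a) (2 * b)) (cutoff a b).
Proof.
move=> a0 b0 p hp; apply: (cutoff0 a0 b0).
by apply: vanish_inbox hp; rewrite le_max lexx ?orbT.
Qed.

Lemma vanish_hdensity a b L : vanish L (cutoff a b) -> vanish L (hdensity a b).
Proof. by move=> h p hp; rewrite /hdensity h // expr0n /= !mulr0. Qed.

(** The geometric inequality with [xi = omega chi] bounds the main term by the error term. In the
    error the horizontal gradient is enlarged to the full gradient, to which the energy estimate at
    the doubled scales applies. *)
Lemma Int_hdensity_le : exists2 K : R, 0 <= K & forall a b : R, 1 <= a -> 1 <= b ->
  Int (hdensity a b) <= K * (b / a ^+ 2 + a / b).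
Proof.
have cF : continuous F := Ck_continuous (Ck_source hu hF dF cc).
have [K K0 hK] := @geom_error_le R.
have [N N0 hN] := energy_growth hu hF u_le1 F_leM cF.
exists (K * N); first exact: mulr_ge0.
move=> a b a1 b1; have a0 : 0 < a by exact: (lt_le_trans ltr01 a1).
have b0 : 0 < b by exact: (lt_le_trans ltr01 b1).
have A1 : 1 <= 2 * a by apply: (le_trans a1); rewrite ler_peMl ?ler1n // ltW.
have B1 : 1 <= 2 * b by apply: (le_trans b1); rewrite ler_peMl ?ler1n // ltW.
have A0 : 0 < 2 * a by exact: (lt_le_trans ltr01 A1).
have B0 : 0 < 2 * b by exact: (lt_le_trans ltr01 B1).
pose L := Num.max (Num.max (2 * a) (2 * b)) (Num.max (2 * (2 * a)) (2 * (2 * b))).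
have vchi : vanish L (cutoff a b).
  move=> p hp; apply: (vanish_cutoff a0 b0); apply: le_lt_trans hp.
  by rewrite /L le_max lexx.
have vtau : vanish L (cutoff (2 * a) (2 * b)).
  move=> p hp; apply: (vanish_cutoff A0 B0); apply: le_lt_trans hp.
  by rewrite /L le_max lexx orbT.
pose xi (p : R3 R) : R := omega p * cutoff a b p.
have sxi : smooth xi by move=> k; exact: (CkM (smooth_omega k) (smooth_cutoff a b k)).
have vxi : vanish L xi by move=> p hp; rewrite /xi vchi // mulr0.
have G0 := stable_geometric hu hF dF cc hstab hrot sxi vxi.
pose E p := grad_sq u p * (error_weight (2 * a) (2 * b) p * cutoff (2 * a) (2 * b) p ^+ 2).
have cE : continuous E.
  rewrite /E (_ : grad_sq u = (fun p => pd e0 u p ^+ 2 + pd e1 u p ^+ 2 + pd e2 u p ^+ 2)).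
    have h : Ck 0 (fun p => error_weight (2 * a) (2 * b) p * cutoff (2 * a) (2 * b) p ^+ 2).
      by apply: CkM; [exact: smooth_error_weight|apply: CkX; exact: smooth_cutoff].
    apply: continuousMf (Ck_continuous h); cont.
  by apply/funext => p; rewrite grad_sqE.
have vE : vanish L E by move=> p hp; rewrite /E vtau // expr0n /= !mulr0.
have vf := vanish_hdensity vchi; have cf := @continuous_hdensity a b.
have cG : continuous (fun p => hgrad u p * geom xi p).
  exact: (continuousMf continuous_hgrad (continuous_geom (sxi 1%N))).
have vG : vanish L (fun p => hgrad u p * geom xi p).
  move=> p hp; rewrite /geom (vxi p hp) !(vanish_pd _ vxi hp).
  by rewrite !(mulr0, mul0r, expr0n, addr0) /= ?addr0 ?mulr0.
have cKE : continuous (fun p => K * E p) by apply: continuousMf => // p; exact: cvg_cst.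
have vKE : vanish L (fun p => K * E p) by move=> p hp; rewrite vE // mulr0.
have cB : continuous (fun p => K * E p - hdensity a b p) by exact: continuousBf.
have vB : vanish L (fun p => K * E p - hdensity a b p).
  by move=> p hp; rewrite vKE // vf // subrr.
have : Int (fun p => hgrad u p * geom xi p) <= Int (fun p => K * E p - hdensity a b p).
  apply: (le_Int cG cB vG vB) => p.
  have hchi : Ck 1 (cutoff a b) := smooth_cutoff a b 1.
  rewrite /xi (geom_omega p hchi) -/(geom_error (cutoff a b) p) /hdensity /E.
  have he := ler_wpM2l (hgrad_ge0 p) (hK a b a0 b0 p).
  have W0 : 0 <= error_weight (2 * a) (2 * b) p * cutoff (2 * a) (2 * b) p ^+ 2.
    exact: (mulr_ge0 (ltW (error_weight_gt0 p A0 B0)) (sqr_ge0 _)).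
  have hg := ler_wpM2l K0 (ler_wpM2r W0 (hgrad_le_grad_sq p)).
  move: he hg; move: (geom_error _ p) (error_weight _ _ p * _) (4 * _ * _ * _) (hgrad u p) (grad_sq u p).
  move=> ge w f h g; rewrite mulrDr mulrN.
  rewrite (_ : h * (K * w) = K * (h * w)); last by ring.
  move: (h * ge) (h * f) (K * (h * w)) (K * (g * w)) => y1 y2 y3 y4 z1 z2.
  by rewrite addrC lerD2r (le_trans z1).
rewrite (IntB cKE cf vKE vf) (IntZ K cE vE) => hle.
have := le_trans G0 hle; rewrite subr_ge0 => h1; apply: (le_trans h1).
rewrite -mulrA ler_wpM2l //; apply: (le_trans (hN _ _ A1 B1)); rewrite ler_wpM2l //.
have -> : 2 * b / (2 * a) ^+ 2 = b / a ^+ 2 / 2 by field; rewrite gt_eqF.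
have -> : 2 * a / (2 * b) = a / b by field; rewrite gt_eqF.
have x0 : 0 <= b / a ^+ 2 by rewrite divr_ge0 ?exprn_ge0 // ltW.
by rewrite lerD2r ler_pdivrMr // ler_peMr // ler1n.
Qed.

(** From [2 s <= t] the support of the cutoff at parameter [s] lies in the box where the cutoff at
    [t] is 1, because [2 s^n <= (2 s)^n] for the exponents in use. *)
Lemma hdensity_mono (s t : R) p : 1 <= s -> 2 * s <= t ->
  hdensity (s ^+ 2) (s ^+ 3) p <= hdensity (t ^+ 2) (t ^+ 3) p.
Proof.
move=> s1 st; have s0 : 0 < s by exact: (lt_le_trans ltr01 s1).
have t0 : 0 < t by apply: lt_le_trans st; rewrite mulr_gt0.
have [pin|pout] := boolP (inbox (2 * s ^+ 2) (2 * s ^+ 3) p); last first.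
  rewrite {1}/hdensity (cutoff0 _ _ pout) ?exprn_gt0 // expr0n /= !mulr0.
  exact: hdensity_ge0.
have le_n n : 2 * s ^+ n.+1 <= t ^+ n.+1.
  have h : (2 * s) ^+ n.+1 <= t ^+ n.+1 by apply: lerXn2r; rewrite ?nnegrE ?mulr_ge0 // ltW.
  apply: le_trans h; rewrite exprMn; apply: ler_wpM2r; first by rewrite exprn_ge0 // ltW.
  by rewrite exprS ler_peMr // exprn_ege1 // ler1n.
have pin' : inbox (t ^+ 2) (t ^+ 3) p.
  case/and3P: pin => h1 h2 h3; apply/and3P.
  by split; [exact: (le_trans h1 (le_n 1%N))|exact: (le_trans h2 (le_n 1%N))|exact: (le_trans h3 (le_n 2%N))].
rewrite /hdensity (cutoff1 _ _ pin') ?exprn_gt0 // expr1n.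
apply: (ler_wpM2l (hgrad_ge0 p)); apply: (ler_wpM2l (hweight_ge0 p)).
by rewrite exprn_ile1 // ?cutoff_ge0 ?cutoff_le1.
Qed.

(** With [a = t^2] and [b = t^3] both error ratios equal [1 / t], so by monotonicity the integral at
    [s] is at most [2 K / t] for all large [t], hence not positive; the integrand is continuous and
    nonnegative. *)
Lemma hdensity_eq0 (s : R) p : 1 <= s -> hdensity (s ^+ 2) (s ^+ 3) p = 0.
Proof.
move=> s1; have s0 : 0 < s by exact: (lt_le_trans ltr01 s1).
have [K K0 hK] := Int_hdensity_le.
have v (t : R) : 0 < t -> exists L : R, vanish L (cutoff (t ^+ 2) (t ^+ 3)).
  by move=> t0; eexists; apply: vanish_cutoff; exact: exprn_gt0.
have [L vL] := v s s0.
apply: (Int_le0_eq0 (@continuous_hdensity _ _) (vanish_hdensity vL) (hdensity_ge0 _ _)).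
have bound t : 2 * s <= t -> Int (hdensity (s ^+ 2) (s ^+ 3)) <= K * 2 / t.
  move=> st; have t1 : 1 <= t by apply: le_trans st; apply: (le_trans s1); rewrite ler_peMl ?ler1n // ltW.
  have t0 : 0 < t by exact: (lt_le_trans ltr01 t1).
  have [L' vL'] := v t t0.
  have vm (a b : R3 R -> R) (x y : R) : vanish x a -> vanish (Num.max x y) a.
    by move=> h q hq; apply: h; apply: le_lt_trans hq; rewrite le_max lexx.
  have vm' (a b : R3 R -> R) (x y : R) : vanish y a -> vanish (Num.max x y) a.
    by move=> h q hq; apply: h; apply: le_lt_trans hq; rewrite le_max lexx orbT.
  apply: (@le_trans _ _ (Int (hdensity (t ^+ 2) (t ^+ 3)))).
    apply: (le_Int (L := Num.max L L')) => [| | | |q].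
    - exact: continuous_hdensity.
    - exact: continuous_hdensity.
    - by apply: vm => //; exact: vanish_hdensity.
    - by apply: vm' => //; exact: vanish_hdensity.
    - exact: hdensity_mono.
  apply: (le_trans (hK _ _ (exprn_ege1 2 t1) (exprn_ege1 3 t1))).
  have -> : t ^+ 3 / (t ^+ 2) ^+ 2 + t ^+ 2 / t ^+ 3 = 2 / t by field; rewrite gt_eqF.
  by rewrite mulrA.
rewrite leNgt; apply/negP => pos; set d := Int _ in pos bound.
have K2 : 0 <= K * 2 by exact: mulr_ge0.
(* Large enough for monotonicity from [s], and larger than [2 K / d], which contradicts the bound
   [d <= 2 K / t]. *)
pose t := 2 * s + K * 2 / d + 1.
have Kd : 0 <= K * 2 / d by rewrite divr_ge0 // ltW.
have st : 2 * s <= t by rewrite /t -addrA lerDl addr_ge0.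
have t0 : 0 < t by apply: lt_le_trans st; exact: mulr_gt0.
have := bound t st; rewrite ler_pdivlMr // leNgt => /negP; apply.
rewrite -(ltr_pdivrMl _ _ pos) mulrC /t -addrA addrCA ltrDl.
by rewrite ltr_pwDr // mulr_ge0 // ltW.
Qed.

Lemma hgrad_rsq_eq0 p : hgrad u p * rsq p = 0.
Proof.
(* As [s >= 1], both [s^2] and [s^3] are at least [|p|], so [p] lies where the cutoff equals 1. *)
pose s : R := 1 + `|p|.
have s1 : 1 <= s by rewrite /s lerDl.
have s0 : 0 < s by exact: (lt_le_trans ltr01 s1).
have ps : `|p| <= s by rewrite /s lerDr.
have s2 n : s <= s ^+ n.+1 by rewrite exprS ler_peMr ?exprn_ege1 // ltW.
have pin : inbox (s ^+ 2) (s ^+ 3) p.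
  have := ps; rewrite normR3_le => /and3P[h1 h2 h3]; apply/and3P.
  by split; [exact: (le_trans h1 (s2 1%N))|exact: (le_trans h2 (s2 1%N))|exact: (le_trans h3 (s2 2%N))].
have := hdensity_eq0 p s1; rewrite /hdensity (cutoff1 _ _ pin) ?exprn_gt0 // expr1n mulr1.
have -> : hgrad u p * (4 * rsq p * omega p ^+ 4) = (4 * omega p ^+ 4) * (hgrad u p * rsq p).
  by move: (hgrad u p) (rsq p) (omega p) => x y z; ring.
move/eqP; rewrite mulf_eq0 => /orP[|/eqP//].
by rewrite gt_eqF // mulr_gt0 // exprn_gt0 // omega_gt0.
Qed.

End Liouville.

(** * Derivatives relative to a set and the potential *)

Section SameMeasurable.
Context {R : realType}.
Import HBNNSimple.

Lemma nnsfun_transfer d1 d2 (T1 : measurableType d1) (T2 : measurableType d2) (f : T2 -> T1) :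
  measurable_fun setT f -> forall h : {nnsfun T1 >-> R}, exists h' : {nnsfun T2 >-> R}, h' = (h \o f) :> (T2 -> R).
Proof.
move=> mf h.
have mh : measurable_fun setT (h \o f) by exact: measurableT_comp.
have fh : finite_set (range (h \o f)).
  by apply: sub_finite_set (fimfunP h) => _ [x _ <-]; exists (f x).
have h0 (x : T2) : 0 <= (h \o f) x by exact: fun_ge0.
pose A := isMeasurableFun.Build _ _ _ _ _ mh.
pose B := FiniteImage.Build _ _ _ fh.
pose C := isNonNegFun.Build _ _ _ h0.
pose H : {nnsfun T2 >-> R} := HB.pack (h \o f) A B C.
by exists H.
Qed.

Local Notation mR := (measurableTypeR R).

(* [lebesgue_measure] lives on [measurableTypeR R], whereas [stable] integrates over [R]
   itself; both carry the same sigma-algebra, but under different displays. *)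
Lemma integral_measurableTypeR (mu : set (R3 R) -> \bar R) (f : R3 R -> \bar R) :
  (\int[mu : set (mR * mR * mR) -> \bar R]_p f p = \int[mu : set (R * R * R)%type -> \bar R]_p f p)%E.
Proof.
(* The integral is built from suprema over nonnegative simple functions below the integrand, so it
   suffices that both displays have the same simple functions. *)
have E (g : R3 R -> \bar R) :
  [set sintegral mu h | h in [set h : {nnsfun (mR * mR * mR)%type >-> R} | forall x, ((h x)%:E <= g x)%E]] =
  [set sintegral mu h | h in [set h : {nnsfun (R * R * R)%type >-> R} | forall x, ((h x)%:E <= g x)%E]].
  have m1 : @measurable_fun _ _ (mR * mR * mR)%type (R * R * R)%type setT id.
    by move=> _ Y mY; rewrite setTI.
  have m2 : @measurable_fun _ _ (R * R * R)%type (mR * mR * mR)%type setT id.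
    by move=> _ Y mY; rewrite setTI.
  apply/seteqP; split => _ [h hg <-].
    have [h' h'E] := nnsfun_transfer m2 h.
    by exists h' => [x /=|]; rewrite h'E //; exact: hg.
  have [h' h'E] := nnsfun_transfer m1 h.
  by exists h' => [x /=|]; rewrite h'E //; exact: hg.
by rewrite /integral !E.
Qed.
End SameMeasurable.

Section DerivativeOn.
Context {R : realType}.
Variables (I : set R) (g : R -> R).

(** The difference quotient completed by the derivative at [y = x], as in Caratheodory's form of
    differentiability. It avoids dividing by an increment of the inner function that may vanish. *)
Definition slope (x y : R) : R :=
  if y == x then derive_on I g x else quotient_on g x y.

Lemma slopeE x y : g y - g x = slope x y * (y - x).
Proof.
rewrite /slope /quotient_on; have [->|yx] := eqVneq y x; first by rewrite !subrr mulr0.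
by rewrite mulfVK // subr_eq0.
Qed.

Lemma cvg_slope (T : Type) (F : set_system T) {FF : Filter F} (f : T -> R) x :
  derivable_on I g x -> f @ F --> x -> (forall t, I (f t)) ->
  (fun t => slope x (f t)) @ F --> derive_on I g x.
Proof.
move=> dg fx fI; apply/cvgrPdist_lt => e e0.
have hq : nbhs x [set y | y != x -> I y -> ball (derive_on I g x) e (quotient_on g x y)].
  exact: (dg _ (nbhsx_ballx _ _ e0)).
have := fx _ hq; rewrite /nbhs /=; apply: filterS => t /= ht; rewrite /slope.
have [_|ftx] := eqVneq (f t) x; first by rewrite subrr normr0.
exact: (ht ftx (fI t)).
Qed.

(** Since [f] never leaves [I], the derivative of [g] relative to [I] is enough. This covers points
    where the solution takes the value 1 or -1 and the derivative of the potential is one-sided. *)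
Lemma is_derive_on_comp (V : normedModType R) (f : V -> R) (p v : V) (a : R) :
  derivable_on I g (f p) -> (forall q, I (f q)) -> is_derive p v f a ->
  is_derive p v (fun q => g (f q)) (derive_on I g (f p) * a).
Proof.
move=> dg fI hf; rewrite -[p]addr0 -(scale0r v) in hf *.
move/is_derive_line: hf => hf; apply/is_derive_line.
set h := fun s : R => f (p + s *: v) in hf *.
have p0 : f p = h 0 by rewrite /h scale0r addr0.
rewrite scale0r addr0 p0 in dg *.
have [hd <-] := hf.
have hcont : h s @[s --> (0 : R)] --> h 0.
  by apply: differentiable_continuous; apply/derivable1_diffP.
pose k (s : R) : R := s^-1 *: ((h \o shift 0) (s *: (1 : R)) - h 0).
have key : (fun s : R => s^-1 *: (((g \o h) \o shift 0) (s *: (1 : R)) - (g \o h) 0)) @ 0^' -->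
    derive_on I g (h 0) * 'D_1 h 0.
  have -> : (fun s : R => s^-1 *: (((g \o h) \o shift 0) (s *: (1 : R)) - (g \o h) 0)) =
      (fun s => slope (h 0) (h s) * k s).
    apply/funext => s; rewrite /k /= addr0 -[s%:A]/(s * 1) mulr1 slopeE.
    by rewrite /GRing.scale /= mulrCA.
  apply: cvgM; last exact: hd.
  apply: cvg_slope => //; last by move=> t; exact: fI.
  by apply: cvg_trans hcont; apply: cvg_app; exact: cvg_within.
by apply: DeriveDef; [exact: cvgP key|exact: cvg_lim key].
Qed.

Lemma continuous_on_comp (T : topologicalType) (f : T -> R) :
  (forall x, I x -> derivable_on I g x) -> (forall q, I (f q)) -> continuous f ->
  continuous (fun q => g (f q)).
Proof.
move=> dg fI cf p.
have E : (fun q => g (f q)) = (fun q => g (f p) + slope (f p) (f q) * (f q - f p)).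
  by apply/funext => q; rewrite -slopeE subrKC.
have h0 : (fun q => f q - f p) @ p --> (0 : R).
  by rewrite -(subrr (f p)); apply: cvgB; [exact: cf|exact: cvg_cst].
have h1 := cvg_slope (FF := nbhs_filter p) (dg _ (fI p)) (cf p) fI.
rewrite E /continuous_at subrr mulr0.
rewrite -[X in _ --> X + _](addr0 _) -addrA; apply: cvgD; first exact: cvg_cst.
by rewrite addr0 -[X in _ --> X](mulr0 (derive_on I g (f p))); exact: (cvgM h1 h0).
Qed.

End DerivativeOn.

Section Potential.
Context {R : realType}.
Implicit Types (W : R -> R) (f u phi : R3 R -> R) (p : R3 R).

Lemma bounded_on_Icc (g : R -> R) : (forall x, Icc x -> derivable_on Icc g x) ->
  exists M : R, forall x : R, -1 <= x <= 1 -> `|g x| <= M.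
Proof.
(* Clamping to [[-1, 1]] gives a function that is continuous on the whole line and agrees with [g]
   on the interval. *)
move=> dg; pose cl (x : R) : R := Num.max (-1) (Num.min 1 x).
have clI x : Icc (cl x).
  have N11 : (-1 : R) <= 1 by exact: le_trans (lerN10 _) ler01.
  by rewrite /Icc /= in_itv /= /cl le_max lexx /= ge_max ge_min lexx N11.
have ccl : continuous cl.
  move=> x.
  have c0 (c : R) : {for x, continuous (cst c : R -> R)} by exact: cvg_cst.
  have ci : {for x, continuous (id : R -> R)} by exact: cvg_id.
  exact: (@continuous_max R R (cst (-1 : R)) _ x (c0 _) (@continuous_min R R (cst (1 : R)) id x (c0 _) ci)).
have cg : continuous (fun x => g (cl x)) := continuous_on_comp dg clI ccl.
have : compact ((fun x => g (cl x)) @` `[-1, 1]).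
  by apply: continuous_compact; [exact: continuous_subspaceT|exact: segment_compact].
move=> /compact_bounded [M [_ hM]]; exists (M + 1) => x /andP[x0 x1].
apply: (hM (M + 1)); first by rewrite ltrDl.
exists x; first by rewrite /= in_itv /= x0 x1.
by rewrite /cl (min_idPr x1) (max_idPr x0).
Qed.

Lemma vanish_compact_support phi L : vanish L phi -> compact_support phi.
Proof.
move=> h; have cK := @compact_norm_le R L.
apply: (subclosed_compact _ cK); first exact: closed_closure.
rewrite closureE => p; apply; split; first exact: (compact_closed (@norm_hausdorff _ _) cK).
by move=> q /=; apply: contraNT; rewrite -ltNge => /h ->.
Qed.

Lemma stable_Int W u phi L : stable W u -> smooth phi -> vanish L phi ->
  0 <= Int (fun p => grad_sq phi p + derive_onn Icc 2 W (u p) * phi p ^+ 2).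
Proof.
move=> hs sphi vphi; rewrite /Int; apply: fine_ge0.
rewrite integral_measurableTypeR; exact: (hs phi sphi (vanish_compact_support vphi)).
Qed.

End Potential.

(** * Consequences of axial symmetry *)

Section AxialSymmetry.
Context {R : realType}.
Variables (u : R3 R -> R) (v : R -> R -> R).
Hypothesis uE : forall x y z, u (x, y, z) = v (Num.sqrt (x ^+ 2 + y ^+ 2)) z.

Local Notation e0 := (@Ordinal 3 0 isT).
Local Notation e1 := (@Ordinal 3 1 isT).
Local Notation e2 := (@Ordinal 3 2 isT).

Lemma axial_profile (x y z : R) : u (x, y, z) = u (Num.sqrt (x ^+ 2 + y ^+ 2), 0, z).
Proof. by rewrite !uE expr0n /= addr0 sqrtr_sqr ger0_norm // sqrtr_ge0. Qed.

Lemma is_derive_slice_pd (x y z : R) : Ck 1 u ->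
  is_derive x 1 (fun x => u (x, y, z)) (pd e0 u (x, y, z)).
Proof. by move=> hu; rewrite pdE; exact: is_derive_slice0. Qed.

(** On the axis both sides are zero. Elsewhere the chain rule is applied to the profile
    [k s = u (s, 0, z)], which inherits the regularity of [u], whereas nothing is assumed about the
    function [v]. *)
Lemma axial_rotation p : Ck 1 u -> coord3 e0 p * pd e1 u p = coord3 e1 p * pd e0 u p.
Proof.
move=> hu; case: p => [[x y] z].
have [r0|r0] := eqVneq (x ^+ 2 + y ^+ 2) 0.
  move/eqP: r0; rewrite paddr_eq0 ?sqr_ge0 // !sqrf_eq0 => /andP[/eqP -> /eqP ->].
  by rewrite /coord3 /= !mul0r.
have rpos : 0 < rsq (x, y, z) by rewrite lt_def r0 rsq_ge0.
pose k (s : R) := u (s, 0, z).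
pose s := Num.sqrt (rsq (x, y, z)).
have dk : is_derive s 1 k (pd e0 u (s, 0, z)) by exact: is_derive_slice_pd.
have drsq i : is_derive (x, y, z) (basis3 i) (@rsq R) (2 * x * (e0 == i)%:R + 2 * y * (e1 == i)%:R).
  exact: (is_deriveDf (is_derive_coord3_sqr i e0 (x, y, z)) (is_derive_coord3_sqr i e1 (x, y, z))).
have dsq i := is_derive_compf (is_derive_compf (drsq i) (is_derive1_sqrt rpos)) dk.
have partial_eq i : i != e2 -> pd i u (x, y, z) =
    pd e0 u (s, 0, z) * ((2 * s)^-1 * (2 * x * (e0 == i)%:R + 2 * y * (e1 == i)%:R)).
  move=> hi; apply: is_derive_pd.
  rewrite -[(x, y, z)]addr0 -(scale0r (basis3 i)); apply/is_derive_line.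
  have := dsq i; rewrite -{1}[(x, y, z)]addr0 -{1}(scale0r (basis3 i)) => /is_derive_line.
  congr (is_derive _ _ _ _); apply/funext => t.
  have : coord3 e2 ((x, y, z) + t *: basis3 i) = z.
    by rewrite coord3_line coord3_basis eq_sym (negbTE hi) mulr0 addr0.
  case: (_ + _) => [[x' y'] z'] /=; rewrite /k /coord3 /= => ->.
  by rewrite [RHS]axial_profile.
rewrite !partial_eq //= /coord3 /=; move: (pd _ _ _) (_^-1) => a b.
by rewrite !mulr0 !mulr1 add0r addr0; ring.
Qed.

(** Off the axis the hypothesis kills the derivative of the profile. On the axis it says nothing,
    but there the profile is an even function of [s], so its derivative vanishes at 0 as well. *)
Lemma axial_constant (x y z : R) : Ck 1 u -> (forall p, hgrad u p * rsq p = 0) ->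
  u (x, y, z) = u (0, 0, z).
Proof.
move=> hu h0; rewrite axial_profile; pose k (s : R) := u (s, 0, z).
have dk (s : R) : is_derive s 1 k (pd e0 u (s, 0, z)) by exact: is_derive_slice_pd.
have k0 (s : R) : pd e0 u (s, 0, z) = 0.
  have [->|s0] := eqVneq s 0; last first.
    have := h0 (s, 0, z); move/eqP; rewrite mulf_eq0 /rsq /coord3 /= expr0n addr0 sqrf_eq0 (negbTE s0) orbF.
    by rewrite /hgrad paddr_eq0 ?sqr_ge0 // sqrf_eq0 => /andP[/eqP].
  have ev : (fun s => k (- s)) = k by apply/funext => t; rewrite /k !uE sqrrN.
  have dN : is_derive (0 : R) (1 : R) (fun s : R => - s) (-1) by exact: is_deriveN.
  have dk0 : is_derive (- (0 : R)) 1 k (pd e0 u (0, 0, z)) by rewrite oppr0.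
  have := is_derive_compf dN dk0; rewrite ev => -[_ h1]; have [_ h2] := dk 0.
  by move: h1; rewrite h2 mulrN1 => /eqP; rewrite -addr_eq0 -mulr2n mulrn_eq0 /= => /eqP.
have [t _] := @MVTr _ k (fun s => pd e0 u (s, 0, z)) 0 (Num.sqrt (x ^+ 2 + y ^+ 2)) dk.
by rewrite k0 mul0r => /eqP; rewrite subr_eq0 => /eqP.
Qed.

End AxialSymmetry.

Theorem theorem1p5 (R : realType) (W : R -> R) (u : R3 R -> R)
    (hW : double_well W) (hu : solution W u)
    (hsym : axially_symmetric u) (hstable : stable W u) :
  exists g : R -> R, forall x1 x2 z : R, u (x1, x2, z) = g z.
Proof.
(* Differentiability of [W], [W'] and [W''] on the closed interval. That of [W'] gives the chain
   rule for [F] and the bound [M]; that of [W''] gives the continuity of [c]. *)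
case: hW => -[dW [dW1 [dW2 _]]] _ _ _ _ _ _.
case: hu => C2 range equation; case: hsym => v uE.
have uI p : Icc (u p) by rewrite /Icc /= in_itv /=.
have C1 : Ck 1 u := Ck_mono C2.
have cu : continuous u := Ck_continuous C1.
have [M hM] := bounded_on_Icc dW1.
exists (fun z => u (0, 0, z)) => x y z.
apply: (axial_constant uE) => // p.
apply: (@hgrad_rsq_eq0 _ u (fun q => derive_onn Icc 1 W (u q)) (fun q => derive_onn Icc 2 W (u q)) M) => //.
- by move=> i q; exact: (is_derive_on_comp (dW1 _ (uI q)) uI (Ck_is_derive_pd i q C1)).
- exact: (continuous_on_comp dW2).
- by move=> q; rewrite ler_norml.
- by move=> q; exact: hM.
- by move=> phi L; exact: stable_Int.
- by move=> q; exact: axial_rotation.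
Qed.
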